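(* Let $k$ be a field and let $\mathcal{F}$ denote the filtration $\emptyset = \cdots = X_{-1} = X_0 \subset X_1 \subset \cdots \subset X_p \subset X_{p+1} \subset \cdots \subset X_N = X_{N+1} = \cdots = X$, where each $X_i$ is a finite CW-complex. Let $(E^{(r)}(\mathcal{F}), d^{(r)})_{r\ge 1}$ be the homology spectral sequence of $\mathcal{F}$ and let $b_n^{s,t}(\mathcal{F})$ be its persistent Betti numbers. Then, for all $r,p,q\in\mathbb{Z}$ with $r\ge 1$, setting $n=p+q$, $$\dim_k E^{(r)}_{p,q}(\mathcal{F}) = \left(b_n^{p,p+r-1}(\mathcal{F}) - b_n^{p-1,p+r-1}(\mathcal{F})\right) + \left(b_{n-1}^{p-r,p-1}(\mathcal{F}) - b_{n-1}^{p-r,p}(\mathcal{F})\right).$$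
   Context: All homology groups have coefficients in the fixed field $k$ ($H_n=0$ for $n<0$). The filtration is indexed by $\mathbb{Z}$, with $X_i=\emptyset$ for $i\le 0$ and $X_i=X$ for $i\ge N$. Persistent homology. For $s\le t$ in $\mathbb{Z}$, $i_n^{s,t}: H_n(X_s)\to H_n(X_t)$ is the homomorphism induced by the inclusion $X_s\hookrightarrow X_t$; $H_n^{s,t}(\mathcal{F}) = \operatorname{Im}(i_n^{s,t})\subset H_n(X_t)$ and $b_n^{s,t}(\mathcal{F}) = \dim_k H_n^{s,t}(\mathcal{F})$. Exact couples. An exact couple consists of $k$-vector spaces $E,D$ and linear maps $i:D\to D$, $j:D\to E$, $\partial:E\to D$ such that the triangle $D\xrightarrow{i}D\xrightarrow{j}E\xrightarrow{\partial}D\xrightarrow{i}D$ is exact at each vertex. Then $d=j\circ\partial$ satisfies $d^2=0$. The derived couple has $E'=\ker d/\operatorname{Im} d$, $D'=\operatorname{Im} i$, $\partial'(x+dE)=\partial(x)$ for $x\in\ker d$, $i'=i|_{\operatorname{Im} i}$, and $j'(i(x))=j(x)+dE$; it is again an exact couple. Spectral sequence. Set $E^{(1)}_{p,q}(\mathcal{F})=H_{p+q}(X_p,X_{p-1})$, $D^{(1)}_{p,q}(\mathcal{F})=H_{p+q}(X_p)$, $E^{(1)}(\mathcal{F})=\bigoplus_{p,q}E^{(1)}_{p,q}(\mathcal{F})$, $D^{(1)}(\mathcal{F})=\bigoplus_{p,q}D^{(1)}_{p,q}(\mathcal{F})$ ($p,q\in\mathbb{Z}$). The maps of the long exact homology sequences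 of the pairs $(X_p,X_{p-1})$, namely $i_{p,q}:D^{(1)}_{p,q}\to D^{(1)}_{p+1,q-1}$ (inclusion), $j_{p,q}:D^{(1)}_{p,q}\to E^{(1)}_{p,q}$, $\partial_{p,q}:E^{(1)}_{p,q}\to D^{(1)}_{p-1,q}$ (connecting map), make this an exact couple $\mathcal{C}^{(1)}(\mathcal{F})$. Let $\mathcal{C}^{(r+1)}(\mathcal{F})=(\mathcal{C}^{(r)}(\mathcal{F}))'$, with spaces $E^{(r)}(\mathcal{F}),D^{(r)}(\mathcal{F})$, maps $\partial^{(r)},i^{(r)},j^{(r)}$, and $d^{(r)}=j^{(r)}\circ\partial^{(r)}$. The bigradings are inherited and indexed so that $E^{(r+1)}_{p,q}$ is a subquotient of $E^{(r)}_{p,q}$ and $D^{(r+1)}_{p,q}$ is a subspace of $D^{(r)}_{p,q}$. Then $\partial^{(r)}$, $i^{(r)}$, $j^{(r)}$, $d^{(r)}$ have bidegrees $(-1,0)$, $(1,-1)$, $(-r+1,r-1)$, $(-r,r-1)$ respectively; in particular $E^{(r+1)}_{p,q}=\ker(d^{(r)}|_{E^{(r)}_{p,q}})/d^{(r)}(E^{(r)}_{p+r,q-r+1})$ and $D^{(r+1)}_{p,q}=i^{(r)}(D^{(r)}_{p-1,q+1})$. *)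

(* Defs.v *)
From HB Require Import structures.
From mathcomp Require Import freeg.
From mathcomp Require Import all_boot all_order all_algebra finmap.
From mathcomp Require Import all_classical all_reals all_analysis.
From mathcomp Require Import zify.

Set Implicit Arguments.
Unset Strict Implicit.
Unset Printing Implicit Defensive.
Import Order.TTheory GRing.Theory Num.Theory.
Import numFieldNormedType.Exports.
Local Open Scope ring_scope.
Local Open Scope classical_set_scope.
Local Open Scope quotient_scope.

Section Dimension.
Context (k : fieldType) (V : lmodType k).

Definition has_dim (U : set V) (n : nat) : Prop := exists e : 'I_n -> V,
  (forall a : 'I_n -> k, \sum_i a i *: e i = 0 -> forall i, a i = 0) /\
  U = [set \sum_i a i *: e i | a in [set: 'I_n -> k]].

(* [0] when [U] is not a finite-dimensional subspace. *)
Definition dimk (U : set V) : nat := xget 0%N (has_dim U).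

End Dimension.

Section Submodule.
Context (k : fieldType) (V : lmodType k) (U : submodClosed V).

Record submod := Submod { submod_val :> V; submodP : submod_val \in U }.

HB.instance Definition _ := [isSub for submod_val].
HB.instance Definition _ := [Choice of submod by <:].
HB.instance Definition _ := [SubChoice_isSubLmodule of submod by <:].

Lemma submod_inj : injective submod_val.
Proof. exact: val_inj. Qed.

End Submodule.

Section KernelImage.
Context (k : fieldType) (V W : lmodType k) (f : {linear V -> W}).

Definition lkernel : {pred V} := [pred x | f x == 0].
Definition limage : {pred W} := [pred y | `[< exists x, f x = y >]].

Lemma limageP y : reflect (exists x, f x = y) (y \in limage).
Proof. exact: asboolP. Qed.

Lemma lkernel_closed : submod_closed lkernel.
Proof.
split=> [|a x y]; rewrite !inE ?linear0 // linearP => /eqP-> /eqP->.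
by rewrite scaler0 addr0.
Qed.
HB.instance Definition _ := GRing.isSubmodClosed.Build k V lkernel lkernel_closed.

Lemma limage_closed : submod_closed limage.
Proof.
split=> [|a _ _ /limageP[x <-] /limageP[y <-]]; apply/limageP.
  by exists 0; rewrite linear0.
by exists (a *: x + y); rewrite linearP.
Qed.
HB.instance Definition _ := GRing.isSubmodClosed.Build k W limage limage_closed.

End KernelImage.

Section Subquotient.
Context (k : fieldType) (V : lmodType k) (Z B : submodClosed V).

Definition restr_pred : {pred submod Z} := [pred z : submod Z | submod_val z \in B].

Lemma restr_closed : submod_closed restr_pred.
Proof.
by split=> [|a x y]; rewrite !inE ?rpred0 // => xB yB; rewrite rpredD ?rpredZ.
Qed.
HB.instance Definition _ :=
  GRing.isSubmodClosed.Build k (submod Z) restr_pred restr_closed.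

(* [Z / (Z :&: B)]; [B] need not be contained in [Z] *)
Definition subquot : Type := Quotient.quot restr_pred.
HB.instance Definition _ := GRing.Zmodule.on subquot.

Definition subq_pi (z : submod Z) : subquot := \pi_(Quotient.quot restr_pred) z.
Definition subq_repr (c : subquot) : submod Z := repr (c : Quotient.quot restr_pred).

Lemma subq_reprK c : subq_pi (subq_repr c) = c.
Proof. exact: reprK. Qed.

Lemma subq_eqP x y :
  subq_pi x = subq_pi y <-> submod_val x - submod_val y \in B.
Proof.
have -> : (submod_val x - submod_val y \in B) = (x - y \in restr_pred) by [].
by rewrite Quotient.idealrBE (rwP eqP).
Qed.

Lemma subq_piD : {morph subq_pi : x y / x + y}.
Proof. by move=> x y; rewrite /subq_pi piE. Qed.

Lemma subq_pi_repr x : submod_val (subq_repr (subq_pi x)) - submod_val x \in B.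
Proof. by apply/subq_eqP; rewrite subq_reprK. Qed.

Definition subq_scale (a : k) (c : subquot) : subquot := subq_pi (a *: subq_repr c).

Lemma subq_scaleE a x : subq_scale a (subq_pi x) = subq_pi (a *: x).
Proof. by apply/subq_eqP; rewrite -scalerBr rpredZ ?subq_pi_repr. Qed.

Lemma subq_scaleA a b c : subq_scale a (subq_scale b c) = subq_scale (a * b) c.
Proof. by rewrite -[c]subq_reprK !subq_scaleE scalerA. Qed.
Lemma subq_scale1 : left_id 1 subq_scale.
Proof. by move=> c; rewrite -[c]subq_reprK subq_scaleE scale1r. Qed.
Lemma subq_scaleDr : right_distributive subq_scale +%R.
Proof.
move=> a x y; rewrite -[x]subq_reprK -[y]subq_reprK -subq_piD !subq_scaleE.
by rewrite scalerDr subq_piD.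
Qed.
Lemma subq_scaleDl c : {morph subq_scale^~ c : a b / a + b}.
Proof.
by move=> a b /=; rewrite -[c]subq_reprK !subq_scaleE scalerDl subq_piD.
Qed.
HB.instance Definition _ := GRing.Zmodule_isLmodule.Build k subquot
  subq_scaleA subq_scale1 subq_scaleDr subq_scaleDl.

Lemma subq_pi_linear : linear subq_pi.
Proof. by move=> a x y; rewrite subq_piD -subq_scaleE. Qed.
HB.instance Definition _ :=
  GRing.isLinear.Build k (submod Z) subquot *:%R subq_pi subq_pi_linear.

Lemma subq_pi_eq0 z : subq_pi z = 0 <-> submod_val z \in B.
Proof. by rewrite -(linear0 subq_pi) -(subr0 (submod_val z)); exact: subq_eqP. Qed.

End Subquotient.

Section InducedMap.
Context (k : fieldType) (V V' : lmodType k) (f : {linear V -> V'}).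
Context (Z B : submodClosed V) (Z' B' : submodClosed V').

Definition subq_map (fZ : {in Z, forall x, f x \in Z'})
    (fB : {in B, forall x, f x \in B'}) (c : subquot Z B) : subquot Z' B' :=
  subq_pi B' (Submod (fZ _ (submodP (subq_repr c)))).

Variables (fZ : {in Z, forall x, f x \in Z'}) (fB : {in B, forall x, f x \in B'}).

Lemma subq_mapE z :
  subq_map fZ fB (subq_pi B z) = subq_pi B' (Submod (fZ (submodP z))).
Proof. by apply/subq_eqP; rewrite /= -linearB fB ?subq_pi_repr. Qed.

Lemma subq_map_linear : linear (subq_map fZ fB).
Proof.
move=> a x y; rewrite -[x]subq_reprK -[y]subq_reprK -linearP !subq_mapE -linearP.
by apply/subq_eqP; rewrite /= linearP subrr rpred0.
Qed.
HB.instance Definition _ := GRing.isLinear.Build k (subquot Z B) (subquot Z' B')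
  *:%R (subq_map fZ fB) subq_map_linear.
End InducedMap.

Section ExactCouple.
Context (k : fieldType).

Record exact_couple := ExactCouple {
  coupleE : lmodType k;
  coupleD : lmodType k;
  couple_i : {linear coupleD -> coupleD};
  couple_j : {linear coupleD -> coupleE};
  couple_bd : {linear coupleE -> coupleD};
  couple_ij : forall x, couple_j x = 0 <-> exists y, x = couple_i y;
  couple_jbd : forall x, couple_bd x = 0 <-> exists y, x = couple_j y;
  couple_bdi : forall x, couple_i x = 0 <-> exists y, x = couple_bd y }.

Section Derived.
Variable C : exact_couple.
Local Notation E := (coupleE C).
Local Notation D := (coupleD C).
Local Notation i := (couple_i C).
Local Notation j := (couple_j C).
Local Notation bd := (couple_bd C).

Definition couple_d : {linear E -> E} := j \o bd.

Definition derivedE : lmodType k := subquot (lkernel couple_d) (limage couple_d).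
Definition derivedD : lmodType k := submod (limage i).

Lemma derived_i_subproof (x : derivedD) : i (submod_val x) \in limage i.
Proof. by apply/limageP; exists (submod_val x). Qed.
Definition derived_i (x : derivedD) : derivedD := Submod (derived_i_subproof x).

Lemma derived_bd_subproof (e : derivedE) :
  bd (submod_val (subq_repr e)) \in limage i.
Proof.
have := submodP (subq_repr e); rewrite inE => /eqP.
by move=> /(couple_ij (bd (submod_val (subq_repr e))))[y ->]; apply/limageP; exists y.
Qed.
(* bd'(x + dE) = bd x *)
Definition derived_bd (e : derivedE) : derivedD := Submod (derived_bd_subproof e).

Definition preim_i (y : derivedD) : D := projT1 (cid (limageP _ _ (submodP y))).
Lemma preim_iK y : i (preim_i y) = submod_val y.
Proof. by rewrite /preim_i; case: cid. Qed.

Lemma derived_j_subproof (x : D) : j x \in lkernel couple_d.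
Proof.
rewrite inE /=; have -> : bd (j x) = 0 by apply/couple_jbd; exists x.
by rewrite linear0.
Qed.
(* j'(i x) = j x + dE *)
Definition derived_j (y : derivedD) : derivedE :=
  subq_pi (limage couple_d) (Submod (derived_j_subproof (preim_i y))).

Lemma derived_jE x y : submod_val y = i x ->
  derived_j y = subq_pi (limage couple_d) (Submod (derived_j_subproof x)).
Proof.
move=> yx; apply/subq_eqP => /=; rewrite -linearB.
have /couple_bdi[e ->] : i (preim_i y - x) = 0.
  by rewrite linearB /= preim_iK yx subrr.
by apply/limageP; exists e.
Qed.

Lemma derived_bdE z : submod_val (derived_bd (subq_pi _ z)) = bd (submod_val z).
Proof.
apply/eqP; rewrite -subr_eq0 /= -linearB.
have /limageP[e <-] := subq_pi_repr (limage couple_d) z.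
by apply/eqP/couple_jbd; exists (bd e).
Qed.

Lemma derived_i_linear : linear derived_i.
Proof. by move=> a x y; apply: submod_inj; rewrite /= linearP. Qed.
HB.instance Definition _ :=
  GRing.isLinear.Build k derivedD derivedD *:%R derived_i derived_i_linear.

Lemma derived_j_linear : linear derived_j.
Proof.
move=> a x y; rewrite (@derived_jE (a *: preim_i x + preim_i y)); last first.
  by rewrite linearP /= !preim_iK.
by rewrite /derived_j -linearP; apply/subq_eqP; rewrite /= linearP subrr rpred0.
Qed.
HB.instance Definition _ :=
  GRing.isLinear.Build k derivedD derivedE *:%R derived_j derived_j_linear.

Lemma derived_bd_linear : linear derived_bd.
Proof.
move=> a x y; rewrite -[x]subq_reprK -[y]subq_reprK -subq_pi_linear.
apply: submod_inj; rewrite [LHS]derived_bdE.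
rewrite [X in bd X]/= linearP; congr (a *: _ + _); exact/esym/derived_bdE.
Qed.
HB.instance Definition _ :=
  GRing.isLinear.Build k derivedE derivedD *:%R derived_bd derived_bd_linear.

Lemma derived_ij x : derived_j x = 0 <-> exists y, x = derived_i y.
Proof.
split=> [|[y ->]].
  rewrite -(linear0 (subq_pi _)) => /subq_eqP; rewrite subr0 /=.
  move=> /limageP[e /esym/eqP]; rewrite -subr_eq0 -linearB => /eqP.
  move=> /couple_ij[w wE].
  have wi : i w \in limage i by apply/limageP; exists w.
  exists (Submod wi); apply: submod_inj => /=.
  rewrite -wE linearB /= preim_iK.
  by have -> : i (bd e) = 0 by [apply/couple_bdi; exists e]; rewrite subr0.
rewrite (@derived_jE (submod_val y)) // -(linear0 (subq_pi _)).
apply/subq_eqP; rewrite subr0 /= -[submod_val y]preim_iK.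
have -> : j (i (preim_i y)) = 0 by apply/couple_ij; exists (preim_i y).
by rewrite rpred0.
Qed.

Lemma derived_jbd x : derived_bd x = 0 <-> exists y, x = derived_j y.
Proof.
split=> [/(congr1 (@submod_val _ _ _))/= /couple_jbd[w we]|[y ->]].
  have wi : i w \in limage i by apply/limageP; exists w.
  exists (Submod wi); rewrite (@derived_jE w) // -[LHS]subq_reprK.
  by apply/subq_eqP; rewrite /= we subrr rpred0.
apply: submod_inj; rewrite [LHS]derived_bdE /=.
by apply/couple_jbd; exists (preim_i y).
Qed.

Lemma derived_bdi x : derived_i x = 0 <-> exists y, x = derived_bd y.
Proof.
split=> [/(congr1 (@submod_val _ _ _))/= /couple_bdi[e xe]|[y ->]].
  have ek : e \in lkernel couple_d.
    by rewrite inE /= -xe -preim_iK; apply/eqP/couple_ij; exists (preim_i x).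
  by exists (subq_pi _ (Submod ek)); apply: submod_inj; rewrite [RHS]derived_bdE.
apply: submod_inj => /=.
by apply/couple_bdi; exists (submod_val (subq_repr y)).
Qed.

Definition derived_couple : exact_couple :=
  @ExactCouple derivedE derivedD derived_i derived_j derived_bd
    derived_ij derived_jbd derived_bdi.

End Derived.
End ExactCouple.

Section DirectSum.
Context (k : fieldType) (I : choiceType) (V : I -> lmodType k).

Record dsum := Dsum {
  dsum_val :> forall i, V i;
  dsum_fin : finite_set [set i | dsum_val i != 0] }.

HB.instance Definition _ := gen_eqMixin dsum.
HB.instance Definition _ := gen_choiceMixin dsum.

Lemma dsumP (x y : dsum) : (forall i, x i = y i) -> x = y.
Proof.
case: x y => [x fx] [y fy] /= xy.
have xyE : x = y by exact/functional_extensionality_dep.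
by subst y; congr Dsum; exact: Prop_irrelevance.
Qed.

Lemma dsum0_fin : finite_set [set i | (0 : V i) != 0].
Proof. by apply: (@sub_finite_set _ _ set0) => // i; rewrite /= eqxx. Qed.
Lemma dsumN_fin (x : dsum) : finite_set [set i | - x i != 0].
Proof. by apply: sub_finite_set (dsum_fin x) => i; rewrite /= oppr_eq0. Qed.
Lemma dsumD_fin (x y : dsum) : finite_set [set i | x i + y i != 0].
Proof.
apply: (@sub_finite_set _ _ ([set i | x i != 0] `|` [set i | y i != 0])).
  move=> i /=; have [->|] := eqVneq (x i) 0; last by left.
  by rewrite add0r; right.
by rewrite finite_setU; split; exact: dsum_fin.
Qed.
Lemma dsumZ_fin a (x : dsum) : finite_set [set i | a *: x i != 0].
Proof.
apply: sub_finite_set (dsum_fin x) => i /=.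
by apply: contra_neq => ->; rewrite scaler0.
Qed.

Definition dsum_zero := Dsum dsum0_fin.
Definition dsum_opp x := Dsum (dsumN_fin x).
Definition dsum_add x y := Dsum (dsumD_fin x y).
Definition dsum_scale a x := Dsum (dsumZ_fin a x).

Lemma dsum_addA : associative dsum_add.
Proof. by move=> x y z; apply: dsumP => i; rewrite /= addrA. Qed.
Lemma dsum_addC : commutative dsum_add.
Proof. by move=> x y; apply: dsumP => i; rewrite /= addrC. Qed.
Lemma dsum_add0 : left_id dsum_zero dsum_add.
Proof. by move=> x; apply: dsumP => i; rewrite /= add0r. Qed.
Lemma dsum_addN : left_inverse dsum_zero dsum_opp dsum_add.
Proof. by move=> x; apply: dsumP => i; rewrite /= addNr. Qed.
HB.instance Definition _ :=
  GRing.isZmodule.Build dsum dsum_addA dsum_addC dsum_add0 dsum_addN.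

Lemma dsum_scaleA a b x : dsum_scale a (dsum_scale b x) = dsum_scale (a * b) x.
Proof. by apply: dsumP => i; rewrite /= scalerA. Qed.
Lemma dsum_scale1 : left_id 1 dsum_scale.
Proof. by move=> x; apply: dsumP => i; rewrite /= scale1r. Qed.
Lemma dsum_scaleDr : right_distributive dsum_scale +%R.
Proof. by move=> a x y; apply: dsumP => i; rewrite /= scalerDr. Qed.
Lemma dsum_scaleDl x : {morph dsum_scale^~ x : a b / a + b}.
Proof. by move=> a b; apply: dsumP => i; rewrite /= scalerDl. Qed.
HB.instance Definition _ := GRing.Zmodule_isLmodule.Build k dsum
  dsum_scaleA dsum_scale1 dsum_scaleDr dsum_scaleDl.

Lemma dsum_in_fin i (v : V i) :
  finite_set [set l | dfwith (fun j => 0 : V j) i v l != 0].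
Proof.
apply: (@sub_finite_set _ _ [set i]) => // l /=.
by case: dfwithP => // l' _; rewrite eqxx.
Qed.
Definition dsum_in i (v : V i) := Dsum (dsum_in_fin v).

Lemma dsum_in_linear i : linear (@dsum_in i).
Proof.
move=> a x y; apply: dsumP => l; rewrite /=; have [<-|il] := eqVneq i l.
  by rewrite !dfwithin.
by rewrite !dfwithout // scaler0 addr0.
Qed.
HB.instance Definition _ i :=
  GRing.isLinear.Build k (V i) dsum *:%R (@dsum_in i) (@dsum_in_linear i).

Context (W : lmodType k) (f : forall i, {linear V i -> W}).

Definition dsum_lift (x : dsum) : W := \sum_(i \in [set: I]) f i (x i).

Lemma dsum_fset (x : dsum) : exists A : {fset I}, forall i, i \notin A -> x i = 0.
Proof.
exists (fset_set [set i | x i != 0]) => i.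
rewrite in_fset_set; last exact: dsum_fin.
by rewrite notin_setE /= => /negP; rewrite negbK => /eqP.
Qed.

Lemma dsum_liftE (x : dsum) (A : {fset I}) : (forall i, i \notin A -> x i = 0) ->
  dsum_lift x = \sum_(i <- A) f i (x i).
Proof.
by move=> xA; rewrite /dsum_lift (fsbigTE A) // => i /xA->; rewrite linear0.
Qed.

Lemma dsum_lift_linear : linear dsum_lift.
Proof.
move=> a x y; have [A xA] := dsum_fset x; have [B yB] := dsum_fset y.
have AB (z : dsum) : (forall i, i \notin (A `|` B)%fset -> z i = 0) ->
    dsum_lift z = \sum_(i <- (A `|` B)%fset) f i (z i) by exact: dsum_liftE.
rewrite !AB => [||i|i]; rewrite ?inE ?negb_or.
- by rewrite scaler_sumr -big_split; apply: eq_bigr => i _; rewrite /= linearP.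
- by move=> i; rewrite inE negb_or => /andP[_ /yB].
- by move=> /andP[/xA].
- by move=> /andP[/xA + /yB]; rewrite /= => -> ->; rewrite scaler0 addr0.
Qed.
HB.instance Definition _ :=
  GRing.isLinear.Build k dsum W *:%R dsum_lift dsum_lift_linear.

End DirectSum.

Section GradedMap.
Context (k : fieldType) (I J : choiceType).
Context (U : I -> lmodType k) (V : J -> lmodType k).
Context (s : I -> J) (g : forall a, {linear U a -> V (s a)}).

Definition dsum_map : {linear dsum U -> dsum V} :=
  dsum_lift (fun a => @dsum_in k J V (s a) \o g a).

Hypothesis s_inj : injective s.
Lemma dsum_mapE x a : dsum_map x (s a) = g a (x a).
Proof.
have [A xA] := dsum_fset x.
pose A' := (a |` A)%fset.
rewrite /dsum_map /= (@dsum_liftE _ _ _ _ _ x A'); last first.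
  by move=> i; rewrite !inE negb_or => /andP[_ /xA].
have sumE (r : seq I) (F : I -> dsum V) b :
    (\sum_(i <- r) F i : dsum V) b = \sum_(i <- r) F i b.
  by elim/big_rec2: _ => // i y1 y2 _ <-.
rewrite sumE (big_fsetD1 a) ?inE ?eqxx //= dfwithin big1_fset ?addr0 // => i.
rewrite !inE => /andP[ia _] _; rewrite dfwithout //.
by apply: contra_neq ia => /s_inj.
Qed.
End GradedMap.

Section GradedExact.
Context (k : fieldType) (I J K : choiceType).
Context (U : I -> lmodType k) (V : J -> lmodType k) (W : K -> lmodType k).
Context (s : I -> J) (g : forall a, {linear U a -> V (s a)}).
Context (t : J -> K) (h : forall b, {linear V b -> W (t b)}).
Hypotheses (s_inj : injective s) (t_inj : injective t).
Hypotheses (s_surj : forall b, exists a, b = s a).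
Hypotheses (t_surj : forall c, exists b, c = t b).
Hypothesis gh : forall a (y : V (s a)), h (s a) y = 0 <-> exists u, y = g a u.

Lemma dsum_map_exact (y : dsum V) :
  dsum_map h y = 0 <-> exists u, y = dsum_map g u.
Proof.
split=> [hy|[u ->]]; last first.
  apply: dsumP => c; have [b ->] := t_surj c; have [a ->] := s_surj b.
  by rewrite dsum_mapE // dsum_mapE //; apply/gh; exists (u a).
have ex a : exists u : U a, y (s a) = g a u.
  by apply/gh; rewrite -(dsum_mapE h) // hy.
pose u a : U a := if y (s a) == 0 then 0 else projT1 (cid (ex a)).
have ufin : finite_set [set a | u a != 0].
  apply: (@sub_finite_set _ _ (s @^-1` [set b | y b != 0])) => [a /=|].
    by apply: contraNN => ys; rewrite /u ys.
  by apply: finite_preimage; [move=> ? ? _ _; exact: s_inj|exact: dsum_fin].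
exists (Dsum ufin); apply: dsumP => b; have [a ->] := s_surj b.
rewrite dsum_mapE //= /u; case: eqP => [->|_]; first by rewrite linear0.
by case: cid.
Qed.
End GradedExact.

Section FreeModule.
Context (k : fieldType) (S : choiceType) (V : lmodType k) (f : S -> V).

Lemma fglift_additive : additive (fglift f : {freeg S / k} -> V).
Proof. exact: lift_is_additive. Qed.

HB.instance Definition _ :=
  GRing.isAdditive.Build {freeg S / k} V (fglift f) fglift_additive.

Lemma fglift_scalable : scalable (fglift f : {freeg S / k} -> V).
Proof.
move=> a x; have -> : fglift f x = \sum_(s <- dom x) coeff s x *: f s.
  by rewrite -{1}[x]freeg_sumE raddf_sum; apply: eq_bigr => s _; exact: liftU.
rewrite scaler_sumr -{1}[x]freeg_sumE scaler_sumr raddf_sum.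
apply: eq_bigr => s _.
have -> : a *: << coeff s x *g s >> = << a * coeff s x *g s >>.
  by apply/eqP/freeg_eqP => t; rewrite coeffZ !coeffU mulrA.
by rewrite /= liftU scalerA.
Qed.
HB.instance Definition _ :=
  GRing.isScalable.Build k {freeg S / k} V *:%R (fglift f) fglift_scalable.
End FreeModule.

Section Simplex.
Context (R : realType).

Definition std_simplex (n : nat) : set 'rV[R]_n.+1 :=
  [set x | (forall i, 0 <= x 0 i) /\ \sum_i x 0 i = 1].
Arguments std_simplex : clear implicits.

Definition face_row n (i : 'I_n.+2) (x : 'rV[R]_n.+1) : 'rV[R]_n.+2 :=
  \row_j (if unlift i j is Some l then x 0 l else 0).

Lemma face_rowE n (i : 'I_n.+2) x : face_row i x 0 i = 0.
Proof. by rewrite mxE unlift_none. Qed.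
Lemma face_row_lift n (i : 'I_n.+2) x l : face_row i x 0 (lift i l) = x 0 l.
Proof. by rewrite mxE liftK. Qed.

Lemma face_row_simplex n (i : 'I_n.+2) (x : std_simplex n) :
  face_row i (set_val x) \in std_simplex n.+1.
Proof.
have [x0 x1] := set_mem (valP x); apply/mem_set; split=> [j|].
  by case: (unliftP i j) => [l ->|->]; rewrite ?face_rowE ?face_row_lift.
rewrite (bigD1_ord i) //= face_rowE add0r -[RHS]x1.
by apply: eq_bigr => j _; rewrite face_row_lift.
Qed.

Definition face n (i : 'I_n.+2) (x : std_simplex n) : std_simplex n.+1 :=
  exist _ (face_row i (set_val x)) (face_row_simplex i x).

Lemma face_row_continuous n (i : 'I_n.+2) : continuous (@face_row n i).
Proof.
move=> x s /nbhs_ballP [e e0 es]; apply/nbhs_ballP; exists e => //= y [_ xy].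
apply: es; split=> // a j; rewrite !mxE.
by case: unliftP => [l _|_]; [exact: xy|exact: ballxx].
Qed.

Lemma face_continuous n (i : 'I_n.+2) : continuous (@face n i).
Proof.
apply: continuous_comp_initial.
have -> : set_val \o @face n i = @face_row n i \o set_val by [].
move=> x; apply: continuous_comp; last exact: face_row_continuous.
exact: initial_continuous.
Qed.
HB.instance Definition _ n (i : 'I_n.+2) :=
  @isContinuous.Build (std_simplex n) (std_simplex n.+1) (@face n i)
    (@face_continuous n i).

Lemma liftC n (i : 'I_n.+1) (j : 'I_n) (i' : 'I_n.+1) (j' : 'I_n) l :
  i' = lift i j -> i = lift i' j' -> lift i (lift j l) = lift i' (lift j' l).
Proof.
move=> i'E /(congr1 val)/= iE; apply: val_inj; rewrite /= bumpC i'E /=.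
suff -> : unbump j i = j' by [].
by move: iE; rewrite i'E /= /bump /unbump; lia.
Qed.

Lemma faceC n (i i' : 'I_n.+3) (j j' : 'I_n.+2) (x : std_simplex n) :
  i' = lift i j -> i = lift i' j' -> face i (face j x) = face i' (face j' x).
Proof.
move=> i'E iE; apply: val_inj => /=; apply/rowP => l.
case: (unliftP i l) => [l1 ->|->]; last first.
  by rewrite face_rowE iE face_row_lift face_rowE.
rewrite face_row_lift; case: (unliftP j l1) => [l2 ->|->].
  by rewrite face_row_lift (liftC l2 i'E iE) !face_row_lift.
by rewrite face_rowE -i'E face_rowE.
Qed.

End Simplex.
Arguments std_simplex : clear implicits.

Section SingularChains.
Context (R : realType) (k : fieldType) (T : topologicalType).

Definition singular_simplex : choiceType :=
  {n : nat & continuousType (std_simplex R n) T}.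

Definition singular_chain : lmodType k := {freeg singular_simplex / k}.

Definition singular_simplex_bd (s : singular_simplex) : singular_chain :=
  match s with
  | existT 0%N _ => 0
  | existT n.+1 f => \sum_(i < n.+2)
      (-1) ^+ i *: << existT _ n (f \o face i : continuousType _ _) >>
  end.

Definition singular_bd : {linear singular_chain -> singular_chain} :=
  fglift singular_simplex_bd.

Lemma singular_bdU s : singular_bd << s >> = singular_simplex_bd s.
Proof. by rewrite /singular_bd /= liftU scale1r. Qed.

Lemma singular_simplex_bd_bd s : singular_bd (singular_simplex_bd s) = 0.
Proof.
case: s => [[|[|n]] f]; first by rewrite linear0.
  rewrite linear_sum /= big1 // => i _.
  by rewrite linearZ /= singular_bdU scaler0.
rewrite linear_sum /=.
pose F (p : 'I_n.+3 * 'I_n.+2) : singular_chain :=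
  (-1) ^+ (p.1 + p.2) *:
  << existT _ n ((f \o face p.1) \o face p.2 : continuousType _ _)
     : singular_simplex >>.
transitivity (\sum_p F p).
  rewrite -(pair_bigA _ (fun i j => F (i, j))) /=; apply: eq_bigr => i _.
  rewrite linearZ /= singular_bdU /= scaler_sumr; apply: eq_bigr => j _.
  by rewrite scalerA -exprD.
pose h (p : 'I_n.+3 * 'I_n.+2) : 'I_n.+3 * 'I_n.+2 :=
  (lift p.1 p.2, odflt p.2 (unlift (lift p.1 p.2) p.1)).
have h2 p : p.1 = lift (h p).1 (h p).2.
  rewrite /h /=; case: unliftP => //= pE; have := neq_lift p.1 p.2.
  by rewrite -pE eqxx.
have hK : involutive h.
  move=> p; rewrite [RHS]surjective_pairing {1}/h -h2; congr pair.
  by rewrite {2}/h /= liftK.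
have hlt p : ((h p).2 < (h p).1)%N = ~~ (p.2 < p.1)%N.
  have /(congr1 val) := h2 p; rewrite /= /bump; lia.
rewrite (bigID (fun p : 'I_n.+3 * 'I_n.+2 => (p.2 < p.1)%N)) /=.
rewrite (reindex_inj (inv_inj hK)).
rewrite (eq_bigl _ _ hlt).
rewrite -big_split /= big1 // => p lep.
rewrite /F.
have -> : ((f \o face (h p).1) \o face (h p).2 : continuousType _ _) =
          ((f \o face p.1) \o face p.2 : continuousType _ _).
  by apply/continuousEP => x /=; rewrite (@faceC _ _ (h p).1 p.1 _ p.2).
rewrite -scalerDl.
have -> : ((h p).1 + (h p).2 = (p.1 + p.2).+1)%N.
  have /(congr1 val) := h2 p; rewrite /= /bump; lia.
by rewrite exprS mulN1r addNr scale0r.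
Qed.

Lemma singular_bd_bd c : singular_bd (singular_bd c) = 0.
Proof.
rewrite -[c]freeg_sumE !linear_sum /= big1 // => s _.
rewrite /singular_bd /= liftU !linearZ /= -/singular_bd.
by rewrite [fglift _ _]singular_simplex_bd_bd scaler0.
Qed.

End SingularChains.

Section CWComplex.
Context (R : realType) (T : topologicalType).

Definition disk n : set 'rV[R]_n := [set x | \sum_i x 0 i ^+ 2 <= 1].
Definition open_disk n : set 'rV[R]_n := [set x | \sum_i x 0 i ^+ 2 < 1].
Definition disk_sphere n : set 'rV[R]_n := [set x | \sum_i x 0 i ^+ 2 = 1].

(* [A], with the subspace topology, is a finite CW-complex (Whitehead): it is
   Hausdorff and partitioned into finitely many open cells [phi i @` open_disk],
   where the characteristic map [phi i] sends the boundary sphere into cells of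
   smaller dimension.  With finitely many cells, closure-finiteness, the weak
   topology, and [phi i] being a homeomorphism from the open disk onto its cell
   all follow. *)
Definition finite_CW (A : set T) : Prop :=
  hausdorff_space (set_type A) /\
  exists (I : finType) (d : I -> nat) (phi : forall i, 'rV[R]_(d i) -> T),
  [/\ forall i, {within @disk (d i), continuous (phi i)},
      forall i, {in @open_disk (d i) &, injective (phi i)},
      trivIset [set: I] (fun i => phi i @` @open_disk (d i)),
      A = \bigcup_i (phi i @` @open_disk (d i)) &
      forall i, phi i @` @disk_sphere (d i) `<=`
        \bigcup_(j in [set j | (d j < d i)%N]) (phi j @` @open_disk (d j))].

End CWComplex.

Section Homology.
Context (R : realType) (k : fieldType) (T : topologicalType).
Implicit Types (n m : int) (A B : set T).
Local Notation singular_simplex := (singular_simplex R T).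
Local Notation singular_chain := (singular_chain R k T).
Local Notation bd := (@singular_bd R k T).

(* Degree-[n] singular chains of the subspace [A], inside the total complex of
   [T]: singular simplices of [A] are those of [T] with values in [A].  The
   space is zero for [n < 0]. *)
Definition chains n A : {pred singular_chain} := [pred c : singular_chain |
  `[< forall s : singular_simplex, coeff s c != 0 ->
        (projT1 s)%:Z = n /\ forall x, A (projT2 s x) >]].

Lemma chainsP n A (c : singular_chain) :
  reflect (forall s : singular_simplex, coeff s c != 0 ->
             (projT1 s)%:Z = n /\ forall x, A (projT2 s x))
    (c \in chains n A).
Proof. exact: asboolP. Qed.

Lemma chains_closed n A : submod_closed (chains n A).
Proof.
split=> [|a x y /chainsP xC /chainsP yC]; apply/chainsP => s.
  by rewrite coeff0 eqxx.
rewrite coeffD coeffZ; have [x0|/xC//] := eqVneq (coeff s x) 0.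
by rewrite x0 mulr0 add0r => /yC.
Qed.
HB.instance Definition _ n A :=
  GRing.isSubmodClosed.Build k singular_chain (chains n A)
    (chains_closed n A).

Lemma chainsS n A B : A `<=` B -> {subset chains n A <= chains n B}.
Proof.
move=> AB c /chainsP cA; apply/chainsP => s /cA[-> sA].
by split=> // x; exact/AB/sA.
Qed.

Definition cycles n A : {pred singular_chain} :=
  [pred c | (c \in chains n A) && (bd c == 0)].
Lemma cyclesE n A c : (c \in cycles n A) = (c \in chains n A) && (bd c == 0).
Proof. by []. Qed.
Definition boundaries n A : {pred singular_chain} :=
  [pred c | `[< exists2 y, y \in chains (n + 1) A & c = bd y >]].

Lemma boundariesP n A c :
  reflect (exists2 y, y \in chains (n + 1) A & c = bd y) (c \in boundaries n A).
Proof. exact: asboolP. Qed.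

Lemma cycles_closed n A : submod_closed (cycles n A).
Proof.
split=> [|a x y]; rewrite !cyclesE ?rpred0 ?linear0 ?eqxx //.
move=> /andP[xC /eqP x0] /andP[yC /eqP y0].
by rewrite linearP x0 y0 scaler0 addr0 eqxx rpredD ?rpredZ.
Qed.
HB.instance Definition _ n A :=
  GRing.isSubmodClosed.Build k singular_chain (cycles n A)
    (cycles_closed n A).

Lemma boundaries_closed n A : submod_closed (boundaries n A).
Proof.
split=> [|a _ _ /boundariesP[x xC ->] /boundariesP[y yC ->]]; apply/boundariesP.
  by exists 0; rewrite ?rpred0 ?linear0.
by exists (a *: x + y); rewrite ?rpredD ?rpredZ // linearP.
Qed.
HB.instance Definition _ n A :=
  GRing.isSubmodClosed.Build k singular_chain (boundaries n A)
    (boundaries_closed n A).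

Definition rel_cycles n A B : {pred singular_chain} :=
  [pred c | (c \in chains n A) && (bd c \in chains (n - 1) B)].
Lemma rel_cyclesE n A B c :
  (c \in rel_cycles n A B) = (c \in chains n A) && (bd c \in chains (n - 1) B).
Proof. by []. Qed.
Definition rel_boundaries n A B : {pred singular_chain} :=
  [pred c | `[< exists y b, [/\ y \in chains (n + 1) A, b \in chains n B &
                               c = bd y + b] >]].

Lemma rel_boundariesP n A B c :
  reflect (exists y b, [/\ y \in chains (n + 1) A, b \in chains n B & c = bd y + b])
    (c \in rel_boundaries n A B).
Proof. exact: asboolP. Qed.

Lemma rel_cycles_closed n A B : submod_closed (rel_cycles n A B).
Proof.
split=> [|a x y]; rewrite !rel_cyclesE ?rpred0 ?linear0 ?rpred0 //.
by move=> /andP[xC x0] /andP[yC y0]; rewrite linearP !rpredD ?rpredZ.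
Qed.
HB.instance Definition _ n A B :=
  GRing.isSubmodClosed.Build k singular_chain (rel_cycles n A B)
    (rel_cycles_closed n A B).

Lemma rel_boundaries_closed n A B : submod_closed (rel_boundaries n A B).
Proof.
split=> [|a _ _ /rel_boundariesP[x [b [xC bC ->]]] /rel_boundariesP[y [c [yC cC ->]]]].
  by apply/rel_boundariesP; exists 0, 0; rewrite !rpred0 linear0 addr0.
apply/rel_boundariesP; exists (a *: x + y), (a *: b + c).
by rewrite !rpredD ?rpredZ // linearP scalerDr addrACA.
Qed.
HB.instance Definition _ n A B := GRing.isSubmodClosed.Build k singular_chain
  (rel_boundaries n A B) (rel_boundaries_closed n A B).

(* [rel_homology n A B] is the homology of [C(A) / C(B)], with its cycles and
   boundaries written as chains of [A]. *)
Definition homology n A : lmodType k := subquot (cycles n A) (boundaries n A).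
Definition rel_homology n A B : lmodType k :=
  subquot (rel_cycles n A B) (rel_boundaries n A B).

Section Maps.
Variables (n m : int) (A B : set T).

Lemma incl_cycles (nm : n = m) (AB : A `<=` B) :
  {in cycles n A, forall c, idfun c \in cycles m B}.
Proof. by move=> c; rewrite !cyclesE nm => /andP[/(chainsS AB)-> ->]. Qed.
Lemma incl_boundaries (nm : n = m) (AB : A `<=` B) :
  {in boundaries n A, forall c, idfun c \in boundaries m B}.
Proof.
move=> _ /boundariesP[y yA ->]; apply/boundariesP; exists y => //.
by rewrite -nm (chainsS AB).
Qed.
(* The equation between degrees saves casts such as the one along
   [p + q = (p + 1) + (q - 1)]. *)
Definition homology_incl (nm : n = m) (AB : A `<=` B) :
    {linear homology n A -> homology m B} :=
  subq_map (incl_cycles nm AB) (incl_boundaries nm AB).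

Lemma rel_incl_cycles : {in cycles n A, forall c, idfun c \in rel_cycles n A B}.
Proof.
by move=> c; rewrite cyclesE rel_cyclesE => /andP[-> /eqP->]; rewrite rpred0.
Qed.
Lemma rel_incl_boundaries :
  {in boundaries n A, forall c, idfun c \in rel_boundaries n A B}.
Proof.
move=> _ /boundariesP[y yA ->]; apply/rel_boundariesP; exists y, 0.
by rewrite rpred0 addr0.
Qed.
Definition homology_rel : {linear homology n A -> rel_homology n A B} :=
  subq_map rel_incl_cycles rel_incl_boundaries.

Lemma connecting_cycles (mn : m = n - 1) :
  {in rel_cycles n A B, forall c, bd c \in cycles m B}.
Proof.
move=> c; rewrite rel_cyclesE cyclesE mn singular_bd_bd eqxx andbT.
by move=> /andP[].
Qed.
Lemma connecting_boundaries (mn : m = n - 1) :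
  {in rel_boundaries n A B, forall c, bd c \in boundaries m B}.
Proof.
move=> _ /rel_boundariesP[y [b [yA bB ->]]]; apply/boundariesP; exists b.
  by rewrite mn subrK.
by rewrite linearD /= singular_bd_bd add0r.
Qed.
Definition connecting (mn : m = n - 1) :
    {linear rel_homology n A B -> homology m B} :=
  subq_map (connecting_cycles mn) (connecting_boundaries mn).

End Maps.

Lemma homology_ij n m (nm : n = m) A B A' (AB : A `<=` B) (A'A : A' = A)
    (y : homology m B) :
  homology_rel m B A' y = 0 <-> exists u, y = homology_incl nm AB u.
Proof.
case: _ / nm y => y; subst A'; rewrite -[y]subq_reprK; set z := subq_repr y.
have zP := submodP z; move: (zP); rewrite !(cyclesE, rel_cyclesE) => /andP[zB /eqP z0].
split=> [/=|[u ->]].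
  rewrite subq_mapE => /subq_pi_eq0/rel_boundariesP[c [b [cB bA zE]]].
  have bZ : b \in cycles n A.
    rewrite cyclesE bA; move: z0.
    by rewrite /= zE linearD /= singular_bd_bd add0r => /eqP.
  exists (subq_pi _ (Submod bZ)); rewrite /= subq_mapE; apply/subq_eqP => /=.
  by apply/boundariesP; exists c => //; rewrite zE addrK.
rewrite -[u]subq_reprK /= !subq_mapE; apply/subq_pi_eq0/rel_boundariesP.
exists 0, (submod_val (subq_repr u)); rewrite rpred0 linear0 add0r; split=> //.
by have := submodP (subq_repr u); rewrite !(cyclesE, rel_cyclesE) => /andP[].
Qed.

Lemma homology_jbd n m A B (mn : m = n - 1) (y : rel_homology n A B)
    (BA : B `<=` A) :
  connecting A B mn y = 0 <-> exists u, y = homology_rel n A B u.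
Proof.
rewrite -[y]subq_reprK; set z := subq_repr y.
have zP := submodP z; move: (zP); rewrite !(cyclesE, rel_cyclesE) => /andP[zA zB].
split=> [/=|[u ->]].
  rewrite subq_mapE => /subq_pi_eq0/boundariesP[b bB zE].
  have {}bB : b \in chains n B by move: bB; rewrite {1}mn subrK.
  rewrite /= in zE.
  have bZ : submod_val z - b \in cycles n A.
    have bA := chainsS BA bB.
    by rewrite cyclesE (rpredB zA bA) linearB /= zE subrr eqxx.
  exists (subq_pi _ (Submod bZ)); rewrite /= subq_mapE; apply/subq_eqP => /=.
  apply/rel_boundariesP; exists 0, b; rewrite rpred0 linear0 add0r.
  by split=> //; rewrite opprB addrC subrK.
rewrite -[u]subq_reprK /= !subq_mapE; apply/subq_pi_eq0 => /=.
have := submodP (subq_repr u); rewrite !(cyclesE, rel_cyclesE) => /andP[_ /eqP->].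
by rewrite rpred0.
Qed.

Lemma homology_bdi n m m' A B A' (mn : m = n - 1) (mm' : m = m')
    (BA' : B `<=` A') (A'A : A' = A) (y : homology m B) :
  homology_incl mm' BA' y = 0 <-> exists u, y = @connecting n m A B mn u.
Proof.
case: _ / mm'; subst A'; rewrite -[y]subq_reprK; set z := subq_repr y.
have zP := submodP z; move: (zP); rewrite !(cyclesE, rel_cyclesE) => /andP[zB /eqP z0].
split=> [/=|[u ->]].
  rewrite subq_mapE => /subq_pi_eq0/boundariesP[c cA zE].
  have {}cA : c \in chains n A by move: cA; rewrite {1}mn subrK.
  rewrite /= in zE.
  have cZ : c \in rel_cycles n A B.
    by rewrite rel_cyclesE cA -mn (_ : bd c = submod_val z) //; exact/esym.
  exists (subq_pi _ (Submod cZ)); rewrite /= subq_mapE; apply/subq_eqP => /=.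
  by rewrite zE subrr rpred0.
rewrite -[u]subq_reprK /= !subq_mapE; apply/subq_pi_eq0/boundariesP.
exists (submod_val (subq_repr u)) => //=; have -> : m + 1 = n by rewrite mn subrK.
by have := submodP (subq_repr u); rewrite !(cyclesE, rel_cyclesE) => /andP[].
Qed.

End Homology.

Record filtration (T : Type) := Filtration {
  filt :> int -> set T;
  filtS : forall s t : int, s <= t -> filt s `<=` filt t }.

Section SpectralSequence.
Context (R : realType) (k : fieldType) (T : topologicalType) (X : filtration T).

Definition pageD (a : int * int) : lmodType k :=
  homology R k (a.1 + a.2) (X a.1).
Definition pageE (a : int * int) : lmodType k :=
  rel_homology R k (a.1 + a.2) (X a.1) (X (a.1 - 1)).

Definition shift_i (a : int * int) : int * int := (a.1 + 1, a.2 - 1).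
Definition shift_bd (a : int * int) : int * int := (a.1 - 1, a.2).

Lemma shift_iE (a : int * int) : a.1 + a.2 = (shift_i a).1 + (shift_i a).2.
Proof. by rewrite /shift_i /= addrACA subrr addr0. Qed.
Lemma shift_bdE (a : int * int) : (shift_bd a).1 + (shift_bd a).2 = a.1 + a.2 - 1.
Proof. by rewrite /shift_bd /= addrAC. Qed.
Lemma filt_succ (a : int * int) : X a.1 `<=` X (shift_i a).1.
Proof. by apply: filtS; rewrite lerDl. Qed.

Definition page_i a : {linear pageD a -> pageD (shift_i a)} :=
  homology_incl R k (shift_iE a) (@filt_succ a).
Definition page_j a : {linear pageD a -> pageE (id a)} :=
  homology_rel R k (a.1 + a.2) (X a.1) (X (a.1 - 1)).
Definition page_bd a : {linear pageE a -> pageD (shift_bd a)} :=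
  connecting R k (X a.1) (X (a.1 - 1)) (shift_bdE a).

Lemma shift_i_inj : injective shift_i.
Proof. by move=> [a b] [c d] [/addIr-> /addIr->]. Qed.
Lemma shift_bd_inj : injective shift_bd.
Proof. by move=> [a b] [c d] [/addIr-> ->]. Qed.
Lemma shift_i_surj a : exists b, a = shift_i b.
Proof. by case: a => a b; exists (a - 1, b + 1); rewrite /shift_i /= subrK addrK. Qed.
Lemma shift_bd_surj a : exists b, a = shift_bd b.
Proof. by case: a => a b; exists (a + 1, b); rewrite /shift_bd /= addrK. Qed.
Lemma id_surj (a : int * int) : exists b, a = id b. Proof. by exists a. Qed.

Lemma total_ij x : dsum_map page_j x = 0 <-> exists y, x = dsum_map page_i y.
Proof.
apply: dsum_map_exact => //; [exact: shift_i_inj|exact: shift_i_surj|exact: id_surj|].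
by move=> a y; apply: homology_ij; rewrite /= addrK.
Qed.
Lemma total_jbd x : dsum_map page_bd x = 0 <-> exists y, x = dsum_map page_j y.
Proof.
apply: dsum_map_exact => //; [exact: shift_bd_inj|exact: id_surj|exact: shift_bd_surj|].
by move=> a y; apply: homology_jbd; apply: filtS; rewrite gerBl.
Qed.
Lemma total_bdi x : dsum_map page_i x = 0 <-> exists y, x = dsum_map page_bd y.
Proof.
apply: dsum_map_exact; [exact: shift_bd_inj|exact: shift_i_inj|
  exact: shift_bd_surj|exact: shift_i_surj|].
by move=> a y; apply: homology_bdi; rewrite /= subrK.
Qed.

Definition couple1 : exact_couple k := ExactCouple total_ij total_jbd total_bdi.

(* An exact couple together with the bigraded pieces of its space [E]. *)
Record bigraded_couple := BigradedCouple {
  bcouple :> exact_couple k;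
  bcoupleE : int -> int -> set (coupleE bcouple) }.

Definition bigraded1 : bigraded_couple := @BigradedCouple couple1
  (fun p q => range (@dsum_in k (int * int)%type pageE (p, q))).

(* The piece of bidegree [(p, q)] of [E' = ker d / im d] is the image of the part
   of [ker d] lying in the piece of bidegree [(p, q)] of [E]. *)
Definition bigraded_derived (C : bigraded_couple) : bigraded_couple :=
  @BigradedCouple (derived_couple C)
    (fun p q => subq_pi (limage (couple_d C)) @`
       [set z | bcoupleE p q (submod_val z)]).

(* [C^(r)], for [r >= 1]; index [0] repeats the first page. *)
Definition bigraded_page (r : nat) : bigraded_couple :=
  iter r.-1 bigraded_derived bigraded1.

Definition spectralE (r : nat) (p q : int) : set (coupleE (bigraded_page r)) :=
  bcoupleE p q.

(* [0] by convention when [t < s]. *)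
Definition betti (n s t : int) : nat :=
  match @idP (s <= t) with
  | ReflectT st => dimk (range (homology_incl R k (erefl n) (@filtS T X s t st)))
  | ReflectF _ => 0%N
  end.

End SpectralSequence.
Arguments spectralE R k {T} X r p q _.
Arguments betti R k {T} X n s t.

(* Main.v *)
Require Import Defs.
From HB Require Import structures.
From mathcomp Require Import freeg.
From mathcomp Require Import all_boot all_order all_algebra finmap.
From mathcomp Require Import all_classical all_reals all_analysis.
From mathcomp Require Import zify ring lra.
Set Implicit Arguments.
Unset Strict Implicit.
Unset Printing Implicit Defensive.
Import Order.TTheory GRing.Theory Num.Theory.
Import numFieldNormedType.Exports.
Local Open Scope ring_scope.
Local Open Scope classical_set_scope.

(** Every derived couple is an exact triangle [E -> D -> D -> E] whose [D] part is known:
    in filtration degree [s] and total degree [n], the [r]-th one has for [D] the image of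
    [H_n(X_(s-r+1)) -> H_n(X_s)], of dimension b_n^(s-r+1,s), and [i] maps this piece onto
    the image of [H_n(X_(s-r+1)) -> H_n(X_(s+1))], of dimension b_n^(s-r+1,s+1).  Exactness
    cuts [E_(p,q)] in two.  The boundary map sends it onto the kernel of [i] in filtration
    degree [p - 1], and what the boundary map kills is the image of [j], that is, the
    cokernel of the map [i] arriving in filtration degree [p + r - 1].  Both are
    differences of two ranks of [i], which are persistent Betti numbers: this is
    [dimk_Epiece].  To work with homogeneous elements throughout, each couple carries
    projections onto its bigraded pieces that commute with its three maps, and an embedding
    of its [D] into the [D] of the first couple ([graded_page], [graded_derived]).

    Counting is legitimate because all dimensions are finite, and this is where the CW
    structure enters ([finite_CW_fin]).  The statement proved by induction on the cells is
    that the cycles of a subspace are spanned, modulo boundaries, by a finite list.  A top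
    cell is attached by a Mayer-Vietoris argument ([attach_cell_fin]): the complement of a
    small closed ball inside the cell is pushed radially onto the smaller complex, a
    concentric open ball contracts to a point, and they overlap in an annulus, whose
    homology comes from that of R^d minus the origin.  The latter is handled by removing
    coordinates one at a time: the set where one of the coordinates from the [j]-th on is
    nonzero is the union of two star-shaped open sets that meet in the same set for [j + 1]
    ([fin_homology_nonzero_from]).

    Two facts on singular chains are needed: homotopic maps agree on cycles modulo
    boundaries ([homotopy_boundary]), and a cycle of a union of two open sets is homologous
    to a sum of chains of the two sets ([cycle_small_chains]).  Both come from one
    construction.  In the free module on tuples of points, prefixing a point [c] to a tuple
    satisfies d(c.s) = s - c.(ds), so every tuple is the boundary of a cone up to a cone
    over its boundary.  Coning recursively, with an apex that is chosen naturally, builds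
    both the barycentric subdivision and a chain homotopy between any two natural chain maps
    that agree on the empty tuple ([tuple_htpyE]); evaluating on the tuple of vertices of
    each standard simplex transports the result to singular chains ([universal_htpy]).  The
    homotopy between the identity and an iterated subdivision gives the second fact, and the
    one between the two ends of a prism gives the first. *)

(** * Subspaces, spans modulo a subspace, and rank-nullity *)

Section SpanModulo.
Context (k : fieldType) (V : lmodType k).
Implicit Types (B U Z : set V) (e : seq V).

Definition vsubspace U := U 0 /\ forall a x y, U x -> U y -> U (a *: x + y).

(** Membership in the span of [e] plus [B], in a recursive form suited to inductions on [e]. *)
Fixpoint span_mod B e : set V :=
  if e is x :: e' then [set v | exists a, span_mod B e' (v - a *: x)] else B.

(** The elements of the list need not lie in [Z]: see [fg_mod_inside]. *)
Definition fg_mod Z B := exists e, Z `<=` span_mod B e.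

Lemma vsubspaceD U x y : vsubspace U -> U x -> U y -> U (x + y).
Proof. by move=> [_ cU] xU yU; rewrite -(scale1r x); exact: cU. Qed.
Lemma vsubspaceZ U a x (sU : vsubspace U) : U x -> U (a *: x).
Proof. by case: sU => [U0 cU] xU; rewrite -[_ *: _]addr0; exact: cU. Qed.
Lemma vsubspaceB U x y : vsubspace U -> U x -> U y -> U (x - y).
Proof.
by move=> sU xU yU; rewrite -scaleN1r; apply: vsubspaceD => //; exact: vsubspaceZ.
Qed.
Lemma vsubspace_sum U (sU : vsubspace U) (I : Type) (r : seq I) (F : I -> V) :
  (forall i, U (F i)) -> U (\sum_(i <- r) F i).
Proof.
move=> FU; elim/big_ind: _ => // [|x y]; first by case: sU.
exact: vsubspaceD.
Qed.

Lemma vsubspaceI U Z : vsubspace U -> vsubspace Z -> vsubspace (U `&` Z).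
Proof.
move=> [U0 cU] [Z0 cZ]; split=> // a x y [xU xZ] [yU yZ].
by split; [exact: cU|exact: cZ].
Qed.

Lemma vsubspace_pred (P : submodClosed V) : vsubspace [set x | x \in P].
Proof.
by split=> [|a x y] /=; [exact: rpred0|move=> xP yP; rewrite rpredD ?rpredZ].
Qed.

Lemma span_mod_vsubspace B e : vsubspace B -> vsubspace (span_mod B e).
Proof.
move=> sB; elim: e => //= x e [e0 eP]; split=> [|a u v [b bu] [c cv]].
  by exists 0; rewrite scale0r subr0.
exists (a * b + c); rewrite scalerDl -scalerA opprD addrACA -scalerN -scalerDr.
exact: eP.
Qed.

Lemma span_modS B B' e : B `<=` B' -> span_mod B e `<=` span_mod B' e.
Proof. by move=> BB'; elim: e => //= x e IH v [a /IH va]; exists a. Qed.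

Lemma span_mod0 B e : B `<=` span_mod B e.
Proof.
move=> v vB; elim: e => //= x e IH; exists 0.
by rewrite scale0r subr0.
Qed.

Lemma span_mod_cat B e1 e2 : span_mod B (e1 ++ e2) = span_mod (span_mod B e2) e1.
Proof. by elim: e1 => //= x e1 ->. Qed.

Lemma fg_modS Z Z' B B' : Z' `<=` Z -> B `<=` B' -> fg_mod Z B -> fg_mod Z' B'.
Proof.
by move=> ZZ' BB' [e eZ]; exists e => z /ZZ'/eZ; exact: span_modS.
Qed.

(** A subspace of a finitely generated space is finitely generated: an element of [Z]
    outside the span of the tail replaces the head of the list, and if there is none then
    the head is useless.  Choosing generators inside [Z] is what allows them to be lifted or
    projected later. *)
Lemma fg_mod_inside Z B : vsubspace Z -> vsubspace B -> fg_mod Z B ->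
  exists e, (forall x, x \in e -> Z x) /\ Z `<=` span_mod B e.
Proof.
move=> sZ sB [e]; elim: e => [|x e IH] in Z sZ *; first by exists [::].
move=> eZ; have se := span_mod_vsubspace e sB.
have [|e' [e'Z e'P]] := IH (Z `&` span_mod B e) (vsubspaceI sZ se).
  exact: subIsetr.
have [ZZ|] := pselect (Z `<=` span_mod B e).
  by exists e'; split=> [y /e'Z[]//|z zZ]; apply: e'P; split=> //; exact: ZZ.
move=> /existsNP[z0 /not_implyP[z0Z z0e]].
have [a0 a0P] := eZ _ z0Z.
have a00 : a0 != 0.
  by apply/eqP => a00; apply: z0e; move: a0P; rewrite a00 scale0r subr0.
exists (z0 :: e'); split=> [y|z zZ].
  by rewrite inE => /orP[/eqP->//|/e'Z[]].
have [a aP] := eZ _ zZ; exists (a / a0); apply: e'P; split.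
  by apply: vsubspaceB => //; exact: vsubspaceZ.
suff -> : z - a / a0 *: z0 = (z - a *: x) - (a / a0) *: (z0 - a0 *: x).
  by apply: vsubspaceB => //; exact: vsubspaceZ.
by rewrite scalerBr scalerA divfK // opprB addrC addrA subrK addrC.
Qed.

End SpanModulo.

Section SpanImage.
Context (k : fieldType) (V W : lmodType k) (f : {linear V -> W}).

Lemma span_mod_map (B : set V) (B' : set W) e v :
  (forall b, B b -> B' (f b)) -> span_mod B e v -> span_mod B' (map f e) (f v).
Proof.
move=> BB'; elim: e => [|x e IH] in v *; first exact: BB'.
by move=> /= [a /IH]; rewrite linearB linearZ; exists a.
Qed.

Lemma vsubspace_image (U : set V) : vsubspace U -> vsubspace (f @` U).
Proof.
move=> [U0 cU]; split; first by exists 0; rewrite ?linear0.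
by move=> a _ _ [x xU <-] [y yU <-]; exists (a *: x + y); rewrite ?linearP; auto.
Qed.
Lemma vsubspace_preimage (U : set W) : vsubspace U -> vsubspace (f @^-1` U).
Proof.
move=> [U0 cU]; split; first by rewrite /= linear0.
by move=> a x y /= xU yU; rewrite linearP; exact: cU.
Qed.

End SpanImage.

Section FiniteDimension.
Context (k : fieldType).
Implicit Types (V W : lmodType k).

Lemma vsubspace0 V : vsubspace [set 0 : V].
Proof. by split=> [//|a x y -> ->]; rewrite /= scaler0 addr0. Qed.

Definition fin_dim V (U : set V) := vsubspace U /\ fg_mod U [set 0].

Lemma span_modP V (e : seq V) v : span_mod [set 0] e v ->
  exists a : 'I_(size e) -> k, v = \sum_i a i *: e`_i.
Proof.
elim: e => [|x e IH] in v * => /= [->|[b /IH[a va]]].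
  by exists (fun=> 0); rewrite big_ord0.
exists (fun i => if unlift ord0 i is Some j then a j else b).
rewrite big_ord_recl unlift_none /= -[LHS](subrK (b *: x)) va addrC.
by congr (_ + _); apply: eq_bigr => i _; rewrite liftK.
Qed.

(** A spanning family of minimal length is independent. *)
Lemma fin_dim_has_dim V (U : set V) : fin_dim U -> exists n, has_dim U n.
Proof.
move=> [sU /(fg_mod_inside sU (vsubspace0 V))[e0 [e0U Ue0]]].
pose spans n := `[< exists e : 'I_n -> V,
  U = [set \sum_i a i *: e i | a in [set: 'I_n -> k]] >].
have ex : exists n, spans n.
  exists (size e0); apply/asboolP; exists (fun i => e0`_i); apply/seteqP; split.
    by move=> v /Ue0/span_modP[a ->]; exists a.
  move=> _ [a _ <-]; apply: (vsubspace_sum sU) => i; apply: (vsubspaceZ _ sU).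
  by apply: e0U; exact: mem_nth.
case: (ex_minnP ex) => n /asboolP[e eU] n_min; exists n, e; split=> // a a0 i.
have [//|ai] := eqVneq (a i) 0.
case: n => [|n] in e eU n_min a a0 i ai *; first by case: i ai.
(* the relation expresses [e i] through the other vectors, which then span *)
suff /n_min : spans n by rewrite ltnn.
apply/asboolP; exists (e \o lift i); rewrite eU; apply/seteqP; split; last first.
  move=> _ [b _ <-].
  exists (fun j => if unlift i j is Some l then b l else 0) => //.
  rewrite (bigD1_ord i) //= unlift_none scale0r add0r.
  by apply: eq_bigr => j _; rewrite liftK.
move=> _ [b _ <-]; exists (fun j => b (lift i j) - b i / a i * a (lift i j)) => //.
move: a0; rewrite [X in X = _ -> _](bigD1_ord i) //= => /eqP.
rewrite addr_eq0 => /eqP aE.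
rewrite [RHS](bigD1_ord i) //=.
have -> : b i *: e i = (b i / a i) *: (a i *: e i) by rewrite scalerA divfK.
rewrite aE scalerN scaler_sumr -sumrN -big_split /=.
by apply: eq_bigr => j _; rewrite scalerA scalerBl addrC.
Qed.

(** Expressing a basis in a spanning family gives a matrix with independent rows. *)
Lemma has_dim_le V (U : set V) n m : has_dim U n -> has_dim U m -> (n <= m)%N.
Proof.
move=> [e [eI eU]] [f [_ fU]].
have ef i : exists a : 'I_m -> k, e i = \sum_j a j *: f j.
  have : U (e i).
    rewrite eU; exists (fun j => (j == i)%:R) => //.
    rewrite (bigD1 i) //= eqxx scale1r big1 ?addr0 // => j /negbTE->.
    by rewrite scale0r.
  by rewrite fU => -[a _ <-]; exists a.
have [A AP] := choice ef.
pose M := \matrix_(i < n, j < m) A i j.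
suff /eqP <- : row_free M by exact: rank_leq_col.
apply/row_freeP; apply/row_freeP; rewrite -kermx_eq0.
apply/rowV0P => x /sub_kermxP xM; apply/rowP => i; rewrite mxE.
apply: (eI (fun i => x 0 i)); transitivity (\sum_j (x *m M) 0 j *: f j).
  rewrite (eq_bigr (fun i => \sum_j (x 0 i * A i j) *: f j)).
    rewrite exchange_big /=; apply: eq_bigr => j _; rewrite mxE scaler_suml.
    by apply: eq_bigr => l _; rewrite mxE.
  by move=> l _; rewrite AP scaler_sumr; apply: eq_bigr => j _; rewrite scalerA.
by rewrite xM big1 // => j _; rewrite mxE scale0r.
Qed.

Lemma dimkE V (U : set V) n : has_dim U n -> dimk U = n.
Proof.
move=> Un; rewrite /dimk; case: xgetP => [m _ Um|/(_ n)//].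
by apply/eqP; rewrite eqn_leq (has_dim_le Um Un) (has_dim_le Un Um).
Qed.

Lemma fin_dimP V (U : set V) : fin_dim U -> has_dim U (dimk U).
Proof. by move=> /fin_dim_has_dim[n Un]; rewrite (dimkE Un). Qed.

Lemma fin_dimS V (U Z : set V) : fin_dim U -> vsubspace Z -> Z `<=` U -> fin_dim Z.
Proof. by move=> [_ [e eU]] sZ ZU; split=> //; exists e => z /ZU/eU. Qed.

Lemma dimk0 V : dimk [set 0 : V] = 0%N.
Proof.
apply: dimkE; exists (fun=> 0); split=> [a _ []//|].
apply/seteqP; split=> [_ ->|_ [a _ <-]]; last by rewrite /= big_ord0.
by exists (fun=> 0); rewrite ?big_ord0.
Qed.

Section RankNullity.
Context (V W : lmodType k) (f : {linear V -> W}) (U : set V).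
Local Notation ker := (U `&` [set x | f x = 0]).

Lemma fin_dim_image : fin_dim U -> fin_dim (f @` U).
Proof.
move=> [sU [e Ue]]; split; first exact: vsubspace_image.
exists (map f e) => _ [x /Ue xe <-]; apply: span_mod_map xe => _ ->.
by rewrite /= linear0.
Qed.

Lemma vsubspace_ker : vsubspace U -> vsubspace ker.
Proof.
move=> sU; apply: vsubspaceI => //.
exact: (@vsubspace_preimage _ _ _ f _ (vsubspace0 W)).
Qed.

(** A basis of the kernel followed by lifts of a basis of the image. *)
Lemma has_dim_ker_image a b : vsubspace U ->
  has_dim (f @` U) a -> has_dim ker b -> has_dim U (b + a).
Proof.
move=> sU [g [gI gU]] [h [hI hU]].
have hP j : ker (h j).
  rewrite hU; exists (fun i => (i == j)%:R) => //.
  rewrite (bigD1 j) //= eqxx scale1r big1 ?addr0 // => i /negbTE->.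
  by rewrite scale0r.
have gP i : exists x, U x /\ f x = g i.
  have : (f @` U) (g i).
    rewrite gU; exists (fun j => (j == i)%:R) => //.
    rewrite (bigD1 i) //= eqxx scale1r big1 ?addr0 // => j /negbTE->.
    by rewrite scale0r.
  by move=> [x xU fx]; exists x.
have [G GP] := choice gP.
pose e (i : 'I_(b + a)) := match fintype.split i with inl j => h j | inr j => G j end.
have eE c : \sum_i c i *: e i =
    \sum_j c (lshift a j) *: h j + \sum_j c (rshift b j) *: G j.
  rewrite big_split_ord; congr (_ + _); apply: eq_bigr => j _; congr (_ *: _).
    by rewrite /e (unsplitK (inl j)).
  by rewrite /e (unsplitK (inr j)).
have fG c : f (\sum_j c j *: G j) = \sum_j c j *: g j.
  by rewrite linear_sum; apply: eq_bigr => j _; rewrite linearZ (GP j).2.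
have fh c : f (\sum_j c j *: h j) = 0.
  by rewrite linear_sum big1 // => j _; rewrite linearZ /= (hP j).2 scaler0.
exists e; split=> [c|].
  rewrite eE => c0.
  have cG j : c (rshift b j) = 0.
    apply: (gI (fun j => c (rshift b j))); rewrite -fG.
    by have := congr1 f c0; rewrite linearD linear0 fh add0r.
  move=> i; case: (split_ordP i) => j ->; last exact: cG.
  apply: (hI (fun j => c (lshift a j))); rewrite -[RHS]c0.
  by rewrite [X in _ = _ + X]big1 ?addr0 // => l _; rewrite cG scale0r.
apply/seteqP; split=> [x xU|_ [c _ <-]]; last first.
  rewrite eE; apply: vsubspaceD => //; apply: (vsubspace_sum sU) => i; apply: (vsubspaceZ _ sU).
    by case: (hP i).
  by case: (GP i).
have : (f @` U) (f x) by exists x.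
rewrite gU => -[c _ cx].
have : ker (x - \sum_j c j *: G j).
  split; last by rewrite /= linearB fG cx subrr.
  apply: vsubspaceB => //; apply: (vsubspace_sum sU) => i; apply: (vsubspaceZ _ sU).
  by case: (GP i).
rewrite hU => -[c' _ c'x].
exists (fun i : 'I_(b + a) => match fintype.split i with inl j => c' j | inr j => c j end) => //.
rewrite eE -[RHS](subrK (\sum_j c j *: G j)) -c'x.
congr (_ + _); apply: eq_bigr => j _; first by rewrite (unsplitK (inl j)).
by rewrite (unsplitK (inr j)).
Qed.

Lemma fin_dim_ker_image : vsubspace U -> fin_dim (f @` U) -> fin_dim ker -> fin_dim U.
Proof.
move=> sU /fin_dimP fa /fin_dimP fb; split=> //.
have [e [_ ->]] := has_dim_ker_image sU fa fb; move: (_ + _)%N e => n e.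
exists (codom e) => _ [a _ <-]; rewrite codomE.
rewrite -big_enum; elim: (enum _) => [|i s IH] /=; first by rewrite big_nil.
by exists (a i); rewrite big_cons addrAC subrr add0r.
Qed.

Lemma rank_nullity : fin_dim U -> dimk U = (dimk (f @` U) + dimk ker)%N.
Proof.
move=> fU; rewrite addnC; apply/dimkE/has_dim_ker_image; first by case: fU.
  exact/fin_dimP/fin_dim_image.
apply: fin_dimP; apply: (fin_dimS fU); last exact: subIsetl.
by apply: vsubspace_ker; case: fU.
Qed.

Lemma dimk_inj : injective f -> fin_dim U -> dimk (f @` U) = dimk U.
Proof.
move=> fI fU; rewrite rank_nullity //.
suff -> : ker = [set 0] by rewrite dimk0 addn0.
apply/seteqP; split=> [x [_ fx]|_ ->]; last by split; [case: fU.1|exact: linear0].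
by apply: fI; rewrite fx linear0.
Qed.

End RankNullity.
End FiniteDimension.

(** * Chains of tuples of points *)

Section Supported.
Context (k : fieldType) (S : choiceType).
Implicit Types (P : set S) (c : {freeg S / k}).

(** With singular simplices for [S] and a suitable [P], this is the defining condition of
    [chains]; lemmas on it thus serve both for tuples and for singular simplices. *)
Definition supported P : set {freeg S / k} := [set c | forall s, coeff s c != 0 -> P s].

Lemma supported_vsubspace P : vsubspace (supported P).
Proof.
split=> [s|a x y xP yP s]; first by rewrite coeff0 eqxx.
rewrite coeffD coeffZ; have [x0|/xP//] := eqVneq (coeff s x) 0.
by rewrite x0 mulr0 add0r => /yP.
Qed.

Lemma supportedU P s : P s -> supported P << s >>.
Proof.
by move=> Ps t; rewrite coeffU mul1r; have [<-//|_] := eqVneq s t; rewrite eqxx.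
Qed.

Lemma supportedS P Q : P `<=` Q -> supported P `<=` supported Q.
Proof. by move=> PQ c cP s /cP/PQ. Qed.

Context (V : lmodType k).
Implicit Types (F G : {linear {freeg S / k} -> V}).

Lemma linear_freegE F c : F c = \sum_(s <- dom c) coeff s c *: F << s >>.
Proof.
rewrite -{1}[c]freeg_sumE linear_sum; apply: eq_bigr => s _.
rewrite -linearZ; congr (F _); apply/eqP/freeg_eqP => t.
by rewrite coeffZ !coeffU mul1r.
Qed.

Lemma supported_linear F P (U : set V) c : vsubspace U ->
  (forall s, P s -> U (F << s >>)) -> supported P c -> U (F c).
Proof.
move=> sU FU cP; rewrite linear_freegE big_seq; elim/big_ind: _ => [|x y|s].
- by case: sU.
- exact: vsubspaceD.
- by rewrite mem_dom => /cP Ps; apply: vsubspaceZ => //; exact: FU.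
Qed.

Lemma supported_eq F G P c : (forall s, P s -> F << s >> = G << s >>) ->
  supported P c -> F c = G c.
Proof.
move=> FG cP; rewrite linear_freegE [RHS]linear_freegE.
rewrite ![\sum_(_ <- dom c) _]big_seq; apply: eq_bigr => s.
by rewrite mem_dom => /cP/FG->.
Qed.

End Supported.

Lemma linear_eqU (k : fieldType) (S : choiceType) (V : lmodType k)
    (F G : {linear {freeg S / k} -> V}) c :
  (forall s, F << s >> = G << s >>) -> F c = G c.
Proof. by move=> FG; apply: (@supported_eq _ _ _ _ _ setT). Qed.

Section TupleChains.
Context (k : fieldType) (K : choiceType).
Local Notation L := {freeg (seq K) / k}.
Implicit Types (x : K) (s : seq K).

(** The empty tuple is allowed, so that the chains of tuples form an augmented complex, with
    the coefficient of the empty tuple as augmentation; the cone formula [tupbd_cone] then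
    holds in all degrees. *)
Definition cone x : {linear L -> L} := fglift (fun s => << x :: s >>).

Lemma coneU x s : cone x << s >> = << x :: s >>.
Proof. by rewrite /cone /= liftU scale1r. Qed.

Fixpoint tuple_bd s : L := if s is x :: s' then << s' >> - cone x (tuple_bd s') else 0.
Definition tupbd : {linear L -> L} := fglift tuple_bd.

Lemma tupbdU s : tupbd << s >> = tuple_bd s.
Proof. by rewrite /tupbd /= liftU scale1r. Qed.

Lemma tupbd_cone x c : tupbd (cone x c) = c - cone x (tupbd c).
Proof.
have -> : tupbd (cone x c) = (tupbd \o cone x) c by [].
have -> : c - cone x (tupbd c) = (idfun \- (cone x \o tupbd)) c by [].
by apply: linear_eqU => s; rewrite /= coneU !tupbdU.
Qed.

Lemma tupbd_tupbd c : tupbd (tupbd c) = 0.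
Proof.
have -> : 0 = (\0 : {linear L -> L}) c by [].
have -> : tupbd (tupbd c) = (tupbd \o tupbd) c by [].
apply: linear_eqU => s; change (tupbd (tupbd << s >>) = 0); rewrite tupbdU.
elim: s => [|x s IH]; first exact: linear0.
rewrite [tuple_bd _]/= linearB tupbd_cone tupbdU IH linear0 subr0; exact: subrr.
Qed.

Fixpoint del i s := match s, i with
  | [::], _ => [::] | _ :: s', 0%N => s' | x :: s', i.+1 => x :: del i s' end.

Lemma nth_del x0 i s j : nth x0 (del i s) j = nth x0 s (bump i j).
Proof.
elim: s i j => [|x s IH] [|i] [|j] //=; rewrite ?nth_nil //.
by rewrite IH /bump /= ltnS; case: (i <= j)%N.
Qed.
Lemma size_del i s : (i < size s)%N -> size (del i s) = (size s).-1.
Proof.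
elim: s i => [|x s IH] [|i] //=; rewrite ltnS => /[dup] + /IH->.
by case: (size s).
Qed.

Lemma tuple_bdE s : tuple_bd s = \sum_(i < size s) (-1) ^+ i *: << del i s >>.
Proof.
elim: s => [|x s IH] /=; first by rewrite big_ord0.
rewrite big_ord_recl expr0 scale1r /= IH linear_sum -sumrN; congr (_ + _).
by apply: eq_bigr => i _; rewrite linearZ /= coneU -scaleNr exprS mulN1r.
Qed.

Definition of_size n : set (seq K) := [set s | size s = n].

Lemma tupbd_size n s : size s = n.+1 -> supported (of_size n) (tuple_bd s).
Proof.
move=> sn; have sP := @supported_vsubspace k _ (of_size n).
rewrite tuple_bdE; apply: (vsubspace_sum sP) => i.
apply: (vsubspaceZ _ sP); apply: supportedU.
by rewrite /of_size /= size_del // sn.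
Qed.

End TupleChains.

Arguments tupbd {k K}.
Arguments tuple_bd {k K} s.
Arguments cone {k K} x.
Arguments of_size {K} n.

Section TupleMap.
Context (k : fieldType) (K K' : choiceType) (g : K -> K').
Local Notation L := {freeg (seq K) / k}.
Local Notation L' := {freeg (seq K') / k}.

Definition tmap : {linear L -> L'} := fglift (fun s => << map g s >>).
Lemma tmapU s : tmap << s >> = << map g s >>.
Proof. by rewrite /tmap /= liftU scale1r. Qed.

Lemma tmap_cone x c : tmap (cone x c) = cone (g x) (tmap c).
Proof.
have -> : tmap (cone x c) = (tmap \o cone x) c by [].
have -> : cone (g x) (tmap c) = (cone (g x) \o tmap) c by [].
by apply: linear_eqU => s; rewrite /= coneU !tmapU coneU.
Qed.

Lemma tmap_tuple_bd s : tmap (tuple_bd s) = tuple_bd (map g s).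
Proof.
by elim: s => [|x s IH] /=; rewrite ?linear0 // linearB /= tmap_cone IH tmapU.
Qed.
Lemma tmap_tupbd c : tmap (tupbd c) = tupbd (tmap c).
Proof.
have -> : tmap (tupbd c) = (tmap \o tupbd) c by [].
have -> : tupbd (tmap c) = (tupbd \o tmap) c by [].
by apply: linear_eqU => s; rewrite /= tmapU !tupbdU tmap_tuple_bd.
Qed.
End TupleMap.
Arguments tmap {k K K'} g.

(** * Subdivision and homotopy of tuples by coning *)

Lemma tupbd_supported (k : fieldType) (K : choiceType) n (z : {freeg (seq K) / k}) :
  supported (of_size n.+1) z -> supported (of_size n) (tupbd z).
Proof.
apply: supported_linear; first exact: supported_vsubspace.
by move=> s sn; rewrite tupbdU; exact: tupbd_size.
Qed.

Section ConeOperators.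
Context (k : fieldType) (K K' : choiceType) (apex : K -> seq K -> K').
Local Notation L := {freeg (seq K) / k}.
Local Notation L' := {freeg (seq K') / k}.

(** Naturality of the apex is only available when it depends on a nonempty tuple, whence the
    case distinction. *)
Definition cone_ext (u : seq K -> L') : {linear L -> L'} :=
  fglift (fun s => if s is x :: s' then cone (apex x s') (u s) else 0).

Lemma cone_extU u x s : cone_ext u << x :: s >> = cone (apex x s) (u (x :: s)).
Proof. by rewrite /cone_ext /= liftU scale1r. Qed.
Lemma cone_ext_nil u : cone_ext u << [::] >> = 0.
Proof. by rewrite /cone_ext /= liftU scaler0. Qed.

Lemma cone_ext_size n u z :
  (forall s, size s = n.+1 -> supported (of_size n) (u s)) ->
  supported (of_size n.+1) z -> supported (of_size n.+1) (cone_ext u z).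
Proof.
move=> un; apply: supported_linear; first exact: supported_vsubspace.
move=> [//|x s] sn; rewrite cone_extU.
apply: (supported_linear _ _ (un _ sn)); first exact: supported_vsubspace.
by move=> t tn; rewrite coneU; apply: supportedU; rewrite /of_size /= tn.
Qed.

Section Homotopy.
Variables (F G : nat -> {linear L -> L'}).

(** The chain homotopy between [F] and [G]: if it is correct in lower degrees, then
    F s - G s - h(ds) is a cycle, hence the boundary of any cone over it. *)
Fixpoint tuple_htpy n : {linear L -> L'} :=
  if n is m.+1 then
    cone_ext (fun s => F m.+1 << s >> - G m.+1 << s >> - tuple_htpy m (tuple_bd s))
  else \0.

Hypothesis FG0 : forall z, supported (of_size 0) z -> F 0%N z = G 0%N z.
Hypothesis Fbd : forall n z, supported (of_size n.+1) z -> tupbd (F n.+1 z) = F n (tupbd z).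
Hypothesis Gbd : forall n z, supported (of_size n.+1) z -> tupbd (G n.+1 z) = G n (tupbd z).

Lemma tuple_htpyE n z : supported (of_size n.+1) z ->
  tupbd (tuple_htpy n.+1 z) = F n.+1 z - G n.+1 z - tuple_htpy n (tupbd z).
Proof.
elim: n z => [|n IH] z zn.
all: pose rhs : {linear L -> L'} := F _ \- G _ \- (tuple_htpy _ \o tupbd).
all: rewrite -[LHS]/((tupbd \o tuple_htpy _) z) -[RHS]/(rhs _ _ _ z).
all: apply: supported_eq zn => -[//|x s] sn; rewrite /rhs.
all: rewrite -[LHS]/(tupbd (tuple_htpy _ _)) -[RHS]/(F _ _ - G _ _ - tuple_htpy _ (tupbd _)).
all: rewrite cone_extU tupbd_cone -tupbdU; set w := (X in X - cone _ _ = _).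
all: have sz := @supportedU k _ (of_size _) _ sn.
(* the base of the cone has to be a cycle *)
all: suff -> : tupbd w = 0 by rewrite linear0 subr0.
all: rewrite /w !linearB /= Fbd // Gbd //.
  (* the boundary is here a multiple of the empty tuple, on which the two maps agree *)
  rewrite FG0 ?subrr ?sub0r ?linear0 ?oppr0 //.
  exact: tupbd_supported.
rewrite IH; last exact: tupbd_supported.
by rewrite tupbd_tupbd linear0 subr0 subrr.
Qed.

End Homotopy.
End ConeOperators.

Section Subdivision.
Context (k : fieldType) (K : choiceType) (apex : K -> seq K -> K).
Local Notation L := {freeg (seq K) / k}.

(** Barycentric subdivision when the apex is the barycenter: the cone over the subdivided
    boundary.  Commuting with the boundary does not depend on the choice of apex. *)
Fixpoint subdiv n : {linear L -> L} :=
  if n is m.+1 then cone_ext apex (fun s => subdiv m (tuple_bd s)) else idfun.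

Lemma subdiv_size n z : supported (of_size n) z -> supported (of_size n) (subdiv n z).
Proof.
elim: n z => [//|n IH] z zn; apply: cone_ext_size zn => s sn.
by apply: IH; exact: tupbd_size.
Qed.

Lemma subdiv_tupbd n z : supported (of_size n.+1) z ->
  tupbd (subdiv n.+1 z) = subdiv n (tupbd z).
Proof.
elim: n z => [|n IH] z zn.
all: rewrite -[LHS]/((tupbd \o subdiv _) z) -[RHS]/((subdiv _ \o tupbd) z).
all: apply: supported_eq zn => -[//|x s] sn.
all: rewrite -[LHS]/(tupbd (subdiv _ _)) -[RHS]/(subdiv _ (tupbd _)).
all: rewrite cone_extU tupbd_cone tupbdU; set w := (X in X - cone _ _ = _).
all: suff -> : tupbd w = 0 by rewrite linear0 subr0.
  have -> : w = tupbd << x :: s >> by rewrite tupbdU.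
  exact: tupbd_tupbd.
rewrite /w IH; last exact: tupbd_size.
by rewrite -tupbdU tupbd_tupbd linear0.
Qed.

Fixpoint iter_subdiv m n : {linear L -> L} :=
  if m is m'.+1 then subdiv n \o iter_subdiv m' n else idfun.

Lemma iter_subdiv_size m n z :
  supported (of_size n) z -> supported (of_size n) (iter_subdiv m n z).
Proof. by move=> zn; elim: m => //= m IH; exact: subdiv_size. Qed.

Lemma iter_subdiv_tupbd m n z : supported (of_size n.+1) z ->
  tupbd (iter_subdiv m n.+1 z) = iter_subdiv m n (tupbd z).
Proof.
move=> zn; elim: m => //= m <-; apply: subdiv_tupbd.
exact: iter_subdiv_size.
Qed.

Lemma iter_subdiv0 m z : iter_subdiv m 0 z = z.
Proof. by elim: m => //= m ->. Qed.

End Subdivision.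
Arguments subdiv {k K} apex n.
Arguments iter_subdiv {k K} apex m n.

Section Naturality.
Context (k : fieldType) (K1 K2 K1' K2' : choiceType) (g : K1 -> K2) (g' : K1' -> K2').
Context (apex1 : K1 -> seq K1 -> K1') (apex2 : K2 -> seq K2 -> K2').
Hypothesis apex_nat : forall x s, g' (apex1 x s) = apex2 (g x) (map g s).

Lemma cone_ext_nat u1 u2 (z : {freeg (seq K1) / k}) :
  (forall s, tmap g' (u1 s) = u2 (map g s)) ->
  tmap g' (cone_ext apex1 u1 z) = cone_ext apex2 u2 (tmap g z).
Proof.
move=> u12.
rewrite -[LHS]/((tmap g' \o cone_ext apex1 u1) z).
rewrite -[RHS]/((cone_ext apex2 u2 \o tmap g) z).
apply: linear_eqU => s.
rewrite -[LHS]/(tmap g' (cone_ext _ _ _)) -[RHS]/(cone_ext _ _ (tmap g _)) tmapU.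
case: s => [|x s]; first by rewrite /= !cone_ext_nil linear0.
by rewrite !cone_extU tmap_cone u12 apex_nat.
Qed.

Lemma tuple_htpy_nat (F1 G1 : nat -> {linear {freeg (seq K1) / k} -> {freeg (seq K1') / k}})
  (F2 G2 : nat -> {linear {freeg (seq K2) / k} -> {freeg (seq K2') / k}}) n z :
  (forall n z, tmap g' (F1 n z) = F2 n (tmap g z)) ->
  (forall n z, tmap g' (G1 n z) = G2 n (tmap g z)) ->
  tmap g' (tuple_htpy apex1 F1 G1 n z) = tuple_htpy apex2 F2 G2 n (tmap g z).
Proof.
move=> F12 G12; elim: n z => [|n IH] z; first exact: linear0.
apply: cone_ext_nat => s.
by rewrite !linearB /= F12 G12 IH tmapU tmap_tuple_bd.
Qed.

End Naturality.

Section SubdivisionNaturality.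
Context (k : fieldType) (K1 K2 : choiceType) (g : K1 -> K2).
Context (apex1 : K1 -> seq K1 -> K1) (apex2 : K2 -> seq K2 -> K2).
Hypothesis apex_nat : forall x s, g (apex1 x s) = apex2 (g x) (map g s).

Lemma iter_subdiv_nat m n (z : {freeg (seq K1) / k}) :
  tmap g (iter_subdiv apex1 m n z) = iter_subdiv apex2 m n (tmap g z).
Proof.
have nat1 i y : tmap g (subdiv (k := k) apex1 i y) = subdiv apex2 i (tmap g y).
  elim: i y => [//|i IH] y; apply: cone_ext_nat => // s.
  by rewrite IH tmap_tuple_bd.
elim: m => [//|m IH].
by rewrite -[LHS]/(tmap g (subdiv apex1 n (iter_subdiv apex1 m n z))) nat1 IH.
Qed.
End SubdivisionNaturality.

(** * Realizing tuples as singular chains *)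

Section Realization.
Context (R : realType) (k : fieldType) (T : topologicalType).
Local Notation Delta := (std_simplex R).

Definition cts_map (S : topologicalType) (g : S -> T) (cg : continuous g) :
    continuousType S T :=
  HB.pack g (@isContinuous.Build S T g cg).

(** The value 0 for a discontinuous [g] makes pushforward total, so that no continuity proof
    is carried inside terms. *)
Definition sing n (g : Delta n -> T) : singular_chain R k T :=
  match pselect (continuous g) with
  | left cg => << existT _ n (cts_map cg) >>
  | right _ => 0
  end.

Lemma sing_eq n (g : Delta n -> T) (f : continuousType (Delta n) T) :
  g =1 f -> sing g = << existT _ n f >>.
Proof.
move=> /funext gf; rewrite /sing; case: pselect => [cg|[]]; last first.
  by rewrite gf => x; exact: cts_fun.
by congr << existT _ n _ >>; apply/continuousEP => x /=; rewrite gf.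
Qed.

Lemma sing_bd n (g : Delta n.+1 -> T) : continuous g ->
  singular_bd R k T (sing g) = \sum_(i < n.+2) (-1) ^+ i *: sing (g \o face i).
Proof.
move=> cg; rewrite (@sing_eq _ g (cts_map cg)) // singular_bdU /=.
by apply: eq_bigr => i _; congr (_ *: _); apply/esym/sing_eq.
Qed.

Lemma sing_bd0 (g : Delta 0 -> T) : singular_bd R k T (sing g) = 0.
Proof.
by rewrite /sing; case: pselect => cg; rewrite ?linear0 // singular_bdU.
Qed.

Lemma sing_chains n (g : Delta n -> T) A : (forall x, A (g x)) ->
  sing g \in chains n%:Z A.
Proof.
rewrite /sing => gA; case: pselect => [cg|_]; last exact: rpred0.
apply/chainsP.
by apply: (@supportedU _ _ (fun s : singular_simplex R T =>
  (projT1 s)%:Z = n%:Z /\ forall x, A (projT2 s x))).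
Qed.

End Realization.

Section Mixing.
Context (R : realType).
Local Notation Delta := (std_simplex R).

(** Enough affine structure on [K] to span a singular simplex by finitely many points: [mix n
    v t] is the combination of [v 0], ..., [v n] with barycentric coordinates [t].  Points are
    indexed by [nat] so that passing to a face is composition with [bump]. *)
Record mixing (K : topologicalType) := Mixing {
  mix :> forall n, (nat -> K) -> Delta n -> K;
  mix_continuous : forall n v, continuous (@mix n v);
  mix_face : forall n v (i : 'I_n.+2) t, mix v (face i t) = mix (v \o bump i) t;
  mix_ext : forall n v w, (forall i, (i <= n)%N -> v i = w i) -> @mix n v =1 @mix n w }.

Definition affine K K' (M : mixing K) (M' : mixing K') (g : K -> K') :=
  forall n v t, g (M n v t) = M' n (g \o v) t.

Section RealTuple.
Context (k : fieldType) (T : topologicalType) (K : topologicalType) (M : mixing K).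
Implicit Types (f : K -> T) (s : seq K).

Definition real_tuple f s : singular_chain R k T :=
  if s is x :: s' then sing k (f \o M (size s') (nth x s)) else 0.

(** The singular chain of a tuple: the affine simplex that it spans in [K], followed by [f].
    The empty tuple goes to 0, so that the augmented complex of tuples maps to the
    unaugmented complex of singular chains. *)
Definition realize f : {linear {freeg (seq K) / k} -> singular_chain R k T} :=
  fglift (real_tuple f).

Lemma realizeU f s : realize f << s >> = real_tuple f s.
Proof. by rewrite /realize /= liftU scale1r. Qed.

Lemma real_tupleE x0 n f s : size s = n.+1 ->
  real_tuple f s = sing k (f \o M n (nth x0 s)).
Proof.
case: s => [//|x s] /= [<-]; congr (sing k (f \o _)); apply/funext.
by apply: mix_ext => i il; apply: set_nth_default.
Qed.

Lemma real_tuple_bd f s : continuous f ->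
  singular_bd R k T (real_tuple f s) = realize f (tuple_bd s).
Proof.
move=> cf; have cfM n v : continuous (f \o M n v).
  by move=> x; apply: continuous_comp; [exact: mix_continuous|exact: cf].
case: s => [|x [|y s]]; first by rewrite !linear0.
  by rewrite /= sing_bd0 linear0 subr0 realizeU.
rewrite (@real_tupleE x (size s).+1) // sing_bd // tuple_bdE linear_sum.
apply: eq_bigr => i _; rewrite linearZ; congr (_ *: _).
rewrite realizeU (@real_tupleE x (size s)); last by rewrite size_del.
congr (sing k _); apply/funext => t /=; rewrite mix_face; congr f.
by apply: mix_ext => j _; rewrite /= nth_del.
Qed.

Lemma realize_tupbd f z : continuous f ->
  singular_bd R k T (realize f z) = realize f (tupbd z).
Proof.
move=> cf; rewrite -[LHS]/((singular_bd R k T \o realize f) z).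
rewrite -[RHS]/((realize f \o tupbd) z); apply: linear_eqU => s.
rewrite -[LHS]/(singular_bd R k T (realize f _)) -[RHS]/(realize f (tupbd _)).
by rewrite realizeU tupbdU real_tuple_bd.
Qed.

Lemma realize_chains f (A : set T) n z : (forall x, A (f x)) ->
  supported (of_size n.+1) z -> realize f z \in chains n%:Z A.
Proof.
move=> fA zn; apply: (supported_linear (vsubspace_pred (chains n%:Z A)) _ zn) => s sn.
case: s sn => [//|x s] [<-] /=; rewrite realizeU; apply: sing_chains => t.
exact: fA.
Qed.

End RealTuple.

Lemma realize_tmap k (T : topologicalType) (K K' : topologicalType)
    (M : mixing K) (M' : mixing K') (g : K -> K')
    (f : K' -> T) z : affine M M' g ->
  realize k M' f (tmap g z) = realize k M (f \o g) z.
Proof.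
move=> ag; rewrite -[LHS]/((realize k M' f \o tmap g) z).
apply: linear_eqU => s; rewrite -[LHS]/(realize k M' f (tmap g _)).
rewrite tmapU !realizeU; case: s => [//|x s].
rewrite (@real_tupleE _ _ _ _ (g x) (size s)) /= ?size_map //.
congr (sing k _); apply/funext => t /=; rewrite ag; congr f.
apply: mix_ext => i il; rewrite -[RHS]/(g (nth x (x :: s) i)).
by rewrite -(nth_map _ (g x)).
Qed.

End Mixing.

(** * Affine mixing in simplices and prisms *)

Lemma row_continuous (R : realType) (T : topologicalType) n (f : T -> 'rV[R]_n) :
  (forall j, continuous (fun x => f x 0 j : R)) -> continuous f.
Proof.
move=> cf x s /nbhs_ballP[e e0 es].
have : \forall y \near x, forall j, ball (f x 0 j) e (f y 0 j).
  by apply: filter_forall => j; apply: (cf j x); exact: nbhsx_ballx.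
by apply: filterS => y xy; apply: es; split=> // a j; rewrite (ord1 a).
Qed.

Lemma sum_continuous (R : realType) (T : topologicalType) n (F : 'I_n -> T -> R) :
  (forall i, continuous (F i)) -> continuous (fun x => \sum_i F i x).
Proof.
move=> cF x; apply: cvg_big => [|i _]; first exact: add_continuous.
exact: cF.
Qed.

Lemma mulf_continuous (R : realType) (T : topologicalType) (f g : T -> R) :
  continuous f -> continuous g -> continuous (fun x => f x * g x).
Proof. by move=> cf cg x; apply: cvgM; [exact: cf|exact: cg]. Qed.

Lemma pair_continuous (T U V : topologicalType) (f : T -> U) (g : T -> V) :
  continuous f -> continuous g -> continuous (fun x => (f x, g x)).
Proof. by move=> cf cg x; apply: cvg_pair; [exact: cf|exact: cg]. Qed.

Section SimplexMixing.
Context (R : realType).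
Local Notation Delta := (std_simplex R).

Lemma simplex_coord_continuous n (i : 'I_n.+1) :
  continuous (fun t : Delta n => set_val t 0 i : R).
Proof.
move=> t; apply: (@continuous_comp _ _ _ (set_val : Delta n -> _) (fun M => M 0 i)).
  exact: initial_continuous.
exact: coord_continuous.
Qed.

Lemma into_simplex_continuous (T : topologicalType) n (f : T -> Delta n) :
  (forall i, continuous (fun x => set_val (f x) 0 i : R)) -> continuous f.
Proof. by move=> cf; apply: continuous_comp_initial; exact: row_continuous. Qed.

Lemma simplexP n (t t' : Delta n) :
  (forall i, set_val t 0 i = set_val t' 0 i) -> t = t'.
Proof. by move=> tt'; apply: val_inj; apply/rowP. Qed.

Lemma coord_ge0 n (t : Delta n) i : 0 <= set_val t 0 i.
Proof. by have [] := set_mem (valP t). Qed.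
Lemma coord_sum n (t : Delta n) : \sum_i set_val t 0 i = 1.
Proof. by have [] := set_mem (valP t). Qed.

Section Mix.
Variables (m n : nat) (v : nat -> Delta m) (t : Delta n).

Definition simplex_mix_row : 'rV[R]_m.+1 :=
  \row_j \sum_(i < n.+1) set_val t 0 i * set_val (v i) 0 j.

Lemma simplex_mix_subproof : simplex_mix_row \in Delta m.
Proof.
apply/mem_set; split=> [j|].
  by rewrite mxE; apply: sumr_ge0 => i _; rewrite mulr_ge0 ?coord_ge0.
under eq_bigr do rewrite mxE.
rewrite exchange_big /= -[RHS](coord_sum t); apply: eq_bigr => i _.
by rewrite -mulr_sumr coord_sum mulr1.
Qed.
Definition simplex_mix : Delta m := exist _ simplex_mix_row simplex_mix_subproof.

Lemma simplex_mixE j :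
  set_val simplex_mix 0 j = \sum_(i < n.+1) set_val t 0 i * set_val (v i) 0 j.
Proof. by rewrite mxE. Qed.
End Mix.

Lemma face_sum n (i : 'I_n.+2) (t : Delta n) (F : nat -> R) :
  \sum_(j < n.+2) set_val (face i t) 0 j * F j =
  \sum_(j < n.+1) set_val t 0 j * F (bump i j).
Proof.
rewrite (bigD1_ord i) //= face_rowE mul0r add0r.
by apply: eq_bigr => j _; rewrite face_row_lift.
Qed.

Section Mixings.
Variable m : nat.
Lemma simplex_mix_continuous n (v : nat -> Delta m) : continuous (@simplex_mix m n v).
Proof.
apply: into_simplex_continuous => j.
have -> : (fun t => set_val (simplex_mix v t) 0 j : R) =
    (fun t : Delta n => \sum_(i < n.+1) set_val t 0 i * set_val (v i) 0 j).
  by apply/funext => t; rewrite simplex_mixE.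
apply: sum_continuous => i.
apply: mulf_continuous; [exact: simplex_coord_continuous|exact: cst_continuous].
Qed.
Lemma simplex_mix_face n (v : nat -> Delta m) (i : 'I_n.+2) t :
  simplex_mix v (face i t) = simplex_mix (v \o bump i) t.
Proof.
apply: simplexP => j; rewrite !simplex_mixE.
exact: (face_sum i t (fun l => set_val (v l) 0 j)).
Qed.
Lemma simplex_mix_ext n (v w : nat -> Delta m) :
  (forall i, (i <= n)%N -> v i = w i) -> @simplex_mix m n v =1 simplex_mix w.
Proof.
move=> vw t; apply: simplexP => j; rewrite !simplex_mixE.
by apply: eq_bigr => i _; rewrite (vw i (ltn_ord i)).
Qed.
Definition simplex_mixing : mixing R (Delta m) :=
  Mixing simplex_mix_continuous simplex_mix_face simplex_mix_ext.

(** The prism is taken with the whole line as second factor; maps on it are extended from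
    the unit interval by [clamp]. *)
Definition prism_mix n (v : nat -> Delta m * R) (t : Delta n) : Delta m * R :=
  (simplex_mix (fst \o v) t, \sum_(i < n.+1) set_val t 0 i * (v i).2).

Lemma prism_mix_continuous n v : continuous (@prism_mix n v).
Proof.
apply: pair_continuous; first exact: simplex_mix_continuous.
apply: sum_continuous => i.
apply: mulf_continuous; [exact: simplex_coord_continuous|exact: cst_continuous].
Qed.
Lemma prism_mix_face n v (i : 'I_n.+2) t :
  prism_mix v (face i t) = prism_mix (v \o bump i) t.
Proof.
congr (_, _); first exact: simplex_mix_face.
exact: (face_sum i t (fun l => (v l).2)).
Qed.
Lemma prism_mix_ext n v w :
  (forall i, (i <= n)%N -> v i = w i) -> @prism_mix n v =1 prism_mix w.
Proof.
move=> vw t; congr (_, _).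
  by apply: simplex_mix_ext => i /vw /= ->.
by apply: eq_bigr => i _; rewrite (vw i (ltn_ord i)).
Qed.
Definition prism_mixing : mixing R (Delta m * R)%type :=
  Mixing prism_mix_continuous prism_mix_face prism_mix_ext.
End Mixings.

Lemma face_affine n (i : 'I_n.+2) :
  affine (simplex_mixing n) (simplex_mixing n.+1) (face i).
Proof.
move=> l v t; apply: simplexP => j.
rewrite simplex_mixE; case: (unliftP i j) => [j' ->|->].
  rewrite [LHS]face_row_lift [LHS]simplex_mixE.
  by apply: eq_bigr => a _; rewrite [in RHS]face_row_lift.
rewrite [LHS]face_rowE big1 // => a _.
by rewrite [X in _ * X]face_rowE mulr0.
Qed.

Definition prism_face n (i : 'I_n.+2) (x : Delta n * R) : Delta n.+1 * R :=
  (face i x.1, x.2).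
Lemma prism_face_affine n (i : 'I_n.+2) :
  affine (prism_mixing n) (prism_mixing n.+1) (prism_face i).
Proof. by move=> l v t; congr (_, _); exact: face_affine. Qed.

Lemma vertex_subproof n (i : nat) : (delta_mx 0 (inord i) : 'rV[R]_n.+1) \in Delta n.
Proof.
apply/mem_set; split=> [j|]; first by rewrite mxE ler0n.
rewrite (bigD1 (inord i)) //= mxE !eqxx big1 ?addr0 // => j /negbTE ji.
by rewrite mxE ji andbF.
Qed.
Definition vertex n i : Delta n := exist _ (delta_mx 0 (inord i)) (vertex_subproof n i).

(** The tuple whose realization by [f] is the singular simplex [f] itself. *)
Definition id_tuple n : seq (Delta n) := mkseq (vertex n) n.+1.

Lemma vertexE n i (j : 'I_n.+1) : set_val (vertex n i) 0 j = (j == inord i)%:R.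
Proof. by rewrite mxE eqxx. Qed.

Lemma simplex_mix_id n x0 t : simplex_mix (nth x0 (id_tuple n)) t = t.
Proof.
apply: simplexP => j; rewrite simplex_mixE (bigD1 j) //= big1 ?addr0 => [|i ij].
  by rewrite nth_mkseq // vertexE inord_val eqxx mulr1.
by rewrite nth_mkseq // vertexE inord_val eq_sym (negbTE ij) mulr0.
Qed.

Lemma del_id_tuple n (i : 'I_n.+2) : del i (id_tuple n.+1) = map (face i) (id_tuple n).
Proof.
have sz : size (del i (id_tuple n.+1)) = n.+1 by rewrite size_del size_mkseq.
apply: (@eq_from_nth _ (vertex _ 0)); rewrite sz ?size_map ?size_iota // => j jn.
rewrite (nth_map (vertex _ 0)) ?size_mkseq // nth_del.
have bj : (bump i j < n.+2)%N by rewrite /bump; lia.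
rewrite !nth_mkseq //; apply: simplexP => l; rewrite vertexE.
have -> : inord (bump i j) = lift i (inord j) :> 'I_n.+2.
  by apply: val_inj; rewrite /= !inordK.
case: (unliftP i l) => [l' ->|->]; last by rewrite [RHS]face_rowE (negbTE (neq_lift _ _)).
by rewrite [RHS]face_row_lift vertexE (inj_eq lift_inj).
Qed.

End SimplexMixing.

(** * Natural operators on singular chains *)

Lemma tuple_htpy_size (k : fieldType) (K K' : choiceType) (apex : K -> seq K -> K')
    (F G : nat -> {linear {freeg (seq K) / k} -> {freeg (seq K') / k}}) :
  (forall n z, supported (of_size n) z -> supported (of_size n) (F n z)) ->
  (forall n z, supported (of_size n) z -> supported (of_size n) (G n z)) ->
  forall n z, supported (of_size n) z -> supported (of_size n.+1) (tuple_htpy apex F G n z).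
Proof.
move=> Fn Gn; elim=> [|n IH] z zn.
  by move=> s; rewrite /= coeff0 eqxx.
apply: (supported_linear _ _ zn); first exact: supported_vsubspace.
move=> [//|x s] sn; rewrite cone_extU.
have sV m := @supported_vsubspace k (seq K') (of_size m).
have sn' : supported (of_size n.+1) (<< x :: s >> : {freeg (seq K) / k}).
  by apply: supportedU; exact: sn.
apply: (@supported_linear _ _ _ (cone _) (of_size n.+1)) => //.
  by move=> t tn; rewrite coneU; apply: supportedU; rewrite /of_size /= tn.
apply: (vsubspaceB (sV _)); first by apply: (vsubspaceB (sV _)); [exact: Fn|exact: Gn].
by apply: IH; exact: tupbd_size.
Qed.

Lemma size_id_tuple (R : realType) n : size (id_tuple R n) = n.+1.
Proof. exact: size_mkseq. Qed.

Section UniversalOperators.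
Context (R : realType) (k : fieldType) (T T' : topologicalType).
Local Notation Delta := (std_simplex R).
Context (Kn : nat -> topologicalType) (M : forall n, mixing R (Kn n)).
Context (kface : forall n (i : 'I_n.+2), Kn n -> Kn n.+1).
Hypothesis kface_affine : forall n (i : 'I_n.+2), affine (M n) (M n.+1) (kface i).
Context (ext : forall n, (Delta n -> T) -> Kn n -> T').
Hypothesis ext_face : forall n (i : 'I_n.+2) (f : Delta n.+1 -> T),
  ext f \o kface i = ext (f \o face i).

Local Notation family := (forall m, nat ->
  {linear {freeg (seq (Delta m)) / k} -> {freeg (seq (Kn m)) / k}}).
Local Notation natural := (fun Phi : family => forall m (i : 'I_m.+2) n z,
  tmap (kface i) (Phi m n z) = Phi m.+1 n (tmap (face i) z)).

(** A natural family of operators on tuples is determined on singular chains by its values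
    on the tuples of vertices: the simplex [f] is sent to the realization of that value
    through [ext f], where [Kn n] stands for the standard simplex or the prism over it. *)
Definition universal (Phi : family) : {linear singular_chain R k T -> singular_chain R k T'} :=
  fglift (fun s : singular_simplex R T =>
    let: existT n f := s in realize k (M n) (ext f) (Phi n n.+1 << id_tuple R n >>)).

Lemma universalU (Phi : family) n (f : continuousType (Delta n) T) :
  universal Phi << existT _ n f >> =
  realize k (M n) (ext f) (Phi n n.+1 << id_tuple R n >>).
Proof. by rewrite /universal /= liftU scale1r. Qed.

Lemma id_tuple_size n :
  supported (of_size n.+1) (<< id_tuple R n >> : {freeg (seq (Delta n)) / k}).
Proof. by apply: supportedU; exact: size_id_tuple. Qed.

Lemma universal_chains (Phi : family) (n : int) (A : set T) (B : set T') d
    (z : singular_chain R k T) :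
  (forall m n z, supported (of_size n) z -> supported (of_size (n + d)%N) (Phi m n z)) ->
  (forall m (f : Delta m -> T), (forall x, A (f x)) -> forall y, B (ext f y)) ->
  z \in chains n A -> universal Phi z \in chains (n + d%:Z) B.
Proof.
move=> Phid extB /chainsP zA.
apply: (supported_linear (vsubspace_pred (chains (n + d%:Z) B)) _ zA).
move=> [m f] /= [<- fA]; rewrite universalU -PoszD.
apply: realize_chains; first by move=> y; apply: extB.
by rewrite -addSn; apply: Phid; exact: id_tuple_size.
Qed.

Section Homotopy.
Variables (F G : family) (apex : forall m, Delta m -> seq (Delta m) -> Kn m).
Hypothesis apex_nat : forall m (i : 'I_m.+2) x s,
  kface i (apex x s) = apex (face i x) (map (face i) s).
Hypotheses (Fnat : natural F) (Gnat : natural G).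
Hypothesis FG0 : forall m z, supported (of_size 0) z -> F m 0%N z = G m 0%N z.
Hypothesis Fbd : forall m n z, supported (of_size n.+1) z -> tupbd (F m n.+1 z) = F m n (tupbd z).
Hypothesis Gbd : forall m n z, supported (of_size n.+1) z -> tupbd (G m n.+1 z) = G m n (tupbd z).

Definition family_htpy : family := fun m => tuple_htpy (@apex m) (F m) (G m).

(** The boundary of the vertex tuple is the alternating sum of its images under the face
    maps; by naturality, evaluating the homotopy there amounts to evaluating the operator on
    the faces of [f]. *)
Lemma universal_htpyU n (f : continuousType (Delta n) T) : continuous (ext f) ->
  singular_bd R k T' (universal family_htpy << existT _ n f >>) =
  universal F << existT _ n f >> - universal G << existT _ n f >> -
  universal family_htpy (singular_bd R k T << existT _ n f >>).
Proof.
move=> cf; rewrite !universalU realize_tupbd //.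
rewrite tuple_htpyE; [|exact: FG0|exact: Fbd|exact: Gbd|exact: id_tuple_size].
rewrite !linearB; congr (_ - _); rewrite singular_bdU.
rewrite tupbdU tuple_bdE size_id_tuple.
case: n f cf => [|n] f cf.
  (* a vertex has the empty tuple as boundary, which is realized by 0 *)
  rewrite big_ord_recl big_ord0 addr0 [X in _ = X]linear0.
  by rewrite [X in realize _ _ _ X]/= linear0.
rewrite [X in _ = universal _ X]/= !linear_sum; apply: eq_bigr => i _.
rewrite !linearZ; congr (_ *: _).
rewrite universalU del_id_tuple -tmapU.
have -> : tuple_htpy (@apex n.+1) (F n.+1) (G n.+1) n.+1 (tmap (face i) << id_tuple R n >>) =
    tmap (kface i) (family_htpy n n.+1 << id_tuple R n >>).
  apply/esym/tuple_htpy_nat => *; [exact: apex_nat|exact: Fnat|exact: Gnat].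
rewrite (realize_tmap _ _ (kface_affine i)) ext_face.
by [].
Qed.

Lemma universal_htpy (n : int) (A : set T) (z : singular_chain R k T) :
  (forall n (f : Delta n -> T), continuous f -> (forall x, A (f x)) -> continuous (ext f)) ->
  z \in cycles n A ->
  singular_bd R k T' (universal family_htpy z) = universal F z - universal G z.
Proof.
move=> extA; rewrite cyclesE => /andP[/chainsP zA /eqP z0].
transitivity ((universal F \- universal G \-
    (universal family_htpy \o singular_bd R k T)) z); last first.
  rewrite -[LHS]/(universal F z - universal G z - universal family_htpy (singular_bd R k T z)).
  by rewrite z0 linear0 subr0.
rewrite -[LHS]/((singular_bd R k T' \o universal family_htpy) z).
apply: supported_eq zA => -[m f] /= [_ fA]; apply: universal_htpyU; apply: extA => //.
exact: cts_fun.
Qed.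

End Homotopy.
End UniversalOperators.

(** * Homotopy invariance and iterated subdivision *)

Section Pushforward.
Context (R : realType) (k : fieldType).
Implicit Types (S T U : topologicalType).

(** Continuity along every continuous map into [A].  It composes without any reference to
    subspace topologies, and only the maps coming from simplices and prisms matter here. *)
Definition cont_on S T (A : set S) (f : S -> T) := forall (Y : topologicalType) (g : Y -> S),
  continuous g -> (forall y, A (g y)) -> continuous (f \o g).

Definition push S T (f : S -> T) : {linear singular_chain R k S -> singular_chain R k T} :=
  fglift (fun s : singular_simplex R S => sing k (f \o projT2 s)).

Lemma pushU S T (f : S -> T) (s : singular_simplex R S) :
  push f << s >> = sing k (f \o projT2 s).
Proof. by rewrite /push /= liftU scale1r. Qed.

Lemma push_chains S T (f : S -> T) A B n z : (forall x, A x -> B (f x)) ->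
  z \in chains n A -> push f z \in chains n B.
Proof.
move=> AB /chainsP zA; apply: (supported_linear (vsubspace_pred (chains n B)) _ zA).
by move=> [m s] /= [<- sA]; rewrite pushU; apply: sing_chains => x; exact: AB.
Qed.

Lemma push_eq S T (f g : S -> T) A n z : (forall x, A x -> f x = g x) ->
  z \in chains n A -> push f z = push g z.
Proof.
move=> fg /chainsP zA; apply: supported_eq zA => s [_ sA]; rewrite !pushU.
by congr (sing k _); apply/funext => x; exact: fg.
Qed.

Lemma push_id T (z : singular_chain R k T) : push id z = z.
Proof.
rewrite -[RHS]/((idfun : {linear _ -> _}) z); apply: linear_eqU => -[n s].
by rewrite pushU; exact: sing_eq.
Qed.

Lemma push_comp S T U (f : S -> T) (g : T -> U) A n z : cont_on A f ->
  z \in chains n A -> push g (push f z) = push (g \o f) z.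
Proof.
move=> cf /chainsP zA; rewrite -[LHS]/((push g \o push f) z).
apply: supported_eq zA => -[m s] [_ sA].
rewrite -[LHS]/(push g (push f _)) !pushU /=.
have cfs : continuous (f \o s) by apply: cf => //; exact: cts_fun.
by rewrite (@sing_eq _ _ _ _ _ (cts_map cfs)) // pushU.
Qed.

Lemma push_bd S T (f : S -> T) A n z : cont_on A f -> z \in chains n A ->
  singular_bd R k T (push f z) = push f (singular_bd R k S z).
Proof.
move=> cf /chainsP zA; rewrite -[LHS]/((singular_bd R k T \o push f) z).
rewrite -[RHS]/((push f \o singular_bd R k S) z).
apply: supported_eq zA => -[m s] /= [_ sA].
rewrite -[LHS]/(singular_bd R k T (push f _)) -[RHS]/(push f (singular_bd R k S _)).
rewrite pushU singular_bdU.
have cfs : continuous (f \o s) by apply: cf => //; exact: cts_fun.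
case: m s sA cfs => [|m] s sA cfs; first by rewrite sing_bd0 linear0.
rewrite sing_bd // [singular_simplex_bd _ _]/= linear_sum; apply: eq_bigr => i _.
by rewrite linearZ pushU.
Qed.

Lemma push_cycles S T (f : S -> T) A B n z : cont_on A f -> (forall x, A x -> B (f x)) ->
  z \in cycles n A -> push f z \in cycles n B.
Proof.
move=> cf AB; rewrite !cyclesE => /andP[zA /eqP z0].
by rewrite (push_chains AB) // (push_bd cf zA) z0 linear0 eqxx.
Qed.

Lemma push_boundaries S T (f : S -> T) A B n z : cont_on A f -> (forall x, A x -> B (f x)) ->
  z \in boundaries n A -> push f z \in boundaries n B.
Proof.
move=> cf AB /boundariesP[y yA ->]; apply/boundariesP; exists (push f y).
  exact: push_chains yA.
by rewrite (push_bd cf yA).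
Qed.

End Pushforward.

Section HomotopyInvariance.
Context (R : realType) (k : fieldType) (T T' : topologicalType).
Local Notation Delta := (std_simplex R).

Definition clamp (a : R) : R := Num.max 0 (Num.min a 1).

Lemma clamp_ge0 a : 0 <= clamp a. Proof. by rewrite /clamp le_max lexx. Qed.
Lemma clamp_le1 a : clamp a <= 1.
Proof. by rewrite /clamp ge_max ler01 ge_min lexx orbT. Qed.
Lemma clamp_id a : 0 <= a <= 1 -> clamp a = a.
Proof. by move=> /andP[a0 a1]; rewrite /clamp (min_idPl a1) (max_idPr a0). Qed.
Lemma clamp_continuous : continuous clamp.
Proof.
move=> a.
have c1 : {for a, continuous ((id : R -> R^o) \min (fun=> 1))}.
  by apply: continuous_min; [exact: cvg_id|exact: cvg_cst].
have c0 : {for a, continuous ((fun=> 0) : R -> R^o)} by exact: cvg_cst.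
exact: (continuous_max c0 c1).
Qed.

Lemma prism_mix_level n (x0 : Delta n * R) a t :
  prism_mix (nth x0 (map (fun x => (x, a)) (id_tuple R n))) t = (t, a).
Proof.
have xE (i : nat) : (i <= n)%N -> nth x0 (map (fun x => (x, a)) (id_tuple R n)) i =
    (nth x0.1 (id_tuple R n) i, a).
  by move=> il; rewrite (nth_map x0.1) // size_id_tuple.
congr (_, _).
  rewrite -[RHS](simplex_mix_id x0.1); apply: simplex_mix_ext => i il.
  by rewrite /= xE.
rewrite -[RHS]mul1r -(coord_sum t) mulr_suml; apply: eq_bigr => i _.
by rewrite xE // -ltnS.
Qed.

(** The prism operator: the homotopy between the inclusions of a simplex in its prism at
    levels 1 and 0, realized through [h]. *)
Lemma homotopy_boundary (A : set T) (B : set T') (h : T * R -> T') n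
    (z : singular_chain R k T) :
  cont_on (S := (T * R)%type) (A `*` `[0, 1]) h ->
  (forall x t, A x -> 0 <= t <= 1 -> B (h (x, t))) -> z \in cycles n A ->
  exists2 w, w \in chains (n + 1) B &
    push R k (fun x => h (x, 1)) z - push R k (fun x => h (x, 0)) z = singular_bd R k T' w.
Proof.
move=> ch hB zA.
pose ext n (f : Delta n -> T) (y : Delta n * R) := h (f y.1, clamp y.2).
pose level a m (i : nat) :
    {linear {freeg (seq (Delta m)) / k} -> {freeg (seq (Delta m * R)) / k}} :=
  tmap (fun x => (x, a)).
pose apex m (x : Delta m) (s : seq (Delta m)) : Delta m * R := (x, 0).
have levelE a : 0 <= a <= 1 -> universal (prism_mixing R) ext (level a) z =
    push R k (fun x => h (x, a)) z.
  move=> a01; apply: linear_eqU => -[m f]; rewrite universalU pushU.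
  rewrite /level tmapU realizeU (@real_tupleE _ _ _ _ _ (vertex R m 0, 0) m).
    congr (sing k _); apply/funext => t.
    by rewrite -[LHS]/(ext m f (prism_mix _ t)) prism_mix_level /ext /= clamp_id.
  by rewrite size_map size_id_tuple.
have level_size a m i c : supported (of_size i) c -> supported (of_size i) (level a m i c).
  apply: supported_linear; first exact: supported_vsubspace.
  by move=> s si; rewrite /level tmapU; apply: supportedU; rewrite /of_size /= size_map.
exists (universal (prism_mixing R) ext (family_htpy (level 1) (level 0) apex) z).
  move: zA; rewrite cyclesE => /andP[zA _]; apply: universal_chains zA.
    move=> m i c ci; rewrite addn1.
    by apply: tuple_htpy_size => // *; exact: level_size.
  by move=> m f fA y; apply: hB => //; rewrite clamp_ge0 clamp_le1.
rewrite (@universal_htpy _ _ _ _ _ (prism_mixing R) _ (@prism_face_affine R) _ _ _ _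
  _ _ _ _ _ _ _ n A).
- by rewrite !levelE ?lexx ?ler01.
- by [].
- by [].
- by move=> m i j c; rewrite /level -[LHS]/((tmap (prism_face i) \o tmap _) c)
    -[RHS]/((tmap _ \o tmap (face i)) c); apply: linear_eqU => s /=;
    rewrite -[LHS]/(tmap _ (tmap _ _)) -[RHS]/(tmap _ (tmap _ _)) !tmapU -!map_comp.
- by move=> m i j c; rewrite /level -[LHS]/((tmap (prism_face i) \o tmap _) c)
    -[RHS]/((tmap _ \o tmap (face i)) c); apply: linear_eqU => s /=;
    rewrite -[LHS]/(tmap _ (tmap _ _)) -[RHS]/(tmap _ (tmap _ _)) !tmapU -!map_comp.
- by move=> m c; apply: supported_eq => -[|x s] //; rewrite /level !tmapU.
- by move=> m i c _; rewrite /level tmap_tupbd.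
- by move=> m i c _; rewrite /level tmap_tupbd.
- move=> m f cf fA; apply: (ch _ (fun y => (f y.1, clamp y.2))).
    apply: pair_continuous => y.
      by apply: continuous_comp; [exact: cvg_fst|exact: cf].
    by apply: continuous_comp; [exact: cvg_snd|exact: clamp_continuous].
  by move=> y; split=> //=; rewrite in_itv /= clamp_ge0 clamp_le1.
- exact: zA.
Qed.

End HomotopyInvariance.

Section IteratedSubdivision.
Context (R : realType) (k : fieldType) (T : topologicalType).
Local Notation Delta := (std_simplex R).

Lemma barycenter_subproof n : (const_mx n.+1%:R^-1 : 'rV[R]_n.+1) \in Delta n.
Proof.
apply/mem_set; split=> [i|]; first by rewrite mxE invr_ge0.
under eq_bigr do rewrite mxE.
by rewrite sumr_const card_ord -[LHS]mulr_natl divff // pnatr_eq0.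
Qed.
Definition barycenter n : Delta n := exist _ (const_mx n.+1%:R^-1) (barycenter_subproof n).

Definition bary_apex m (x : Delta m) (s : seq (Delta m)) : Delta m :=
  simplex_mix (nth x (x :: s)) (barycenter (size s)).

Lemma bary_apex_nat m (i : 'I_m.+2) x s :
  face i (bary_apex x s) = bary_apex (face i x) (map (face i) s).
Proof.
rewrite /bary_apex -[LHS]/(face i (simplex_mixing R m _ _ _)) face_affine size_map.
apply: simplex_mix_ext => j jl; rewrite -[LHS]/(face i (nth x (x :: s) j)).
by rewrite -(nth_map x (face i x)).
Qed.

Definition subdivision it : {linear singular_chain R k T -> singular_chain R k T} :=
  universal (simplex_mixing R) (fun n => id)
    (fun m n => iter_subdiv (@bary_apex m) it n).

(** The homotopy from the identity to the iterated subdivision on tuples; it stays inside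
    the image of each simplex, hence in [A]. *)
Lemma subdivision_homologous it n A z : z \in cycles n A ->
  exists2 w, w \in chains (n + 1) A & z - subdivision it z = singular_bd R k T w.
Proof.
move=> zA.
pose idf m (i : nat) : {linear {freeg (seq (Delta m)) / k} -> {freeg (seq (Delta m)) / k}} :=
  idfun.
pose sdf m n : {linear {freeg (seq (Delta m)) / k} -> {freeg (seq (Delta m)) / k}} :=
  iter_subdiv (@bary_apex m) it n.
exists (universal (simplex_mixing R) (fun n => id) (family_htpy idf sdf bary_apex) z).
  move: zA; rewrite cyclesE => /andP[zA _]; apply: universal_chains zA => //.
  move=> m i c ci; rewrite addn1.
  by apply: tuple_htpy_size => // *; exact: iter_subdiv_size.
rewrite (@universal_htpy _ _ _ _ _ (simplex_mixing R) _ (@face_affine R) _ _ _ _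
  _ _ _ _ _ _ _ n A).
- congr (_ - _).
  rewrite -[LHS]/((idfun : {linear _ -> _}) z); apply: linear_eqU => -[m f].
  rewrite universalU realizeU (@real_tupleE _ _ _ _ _ (vertex R m 0) m) ?size_id_tuple //.
  by apply/esym/sing_eq => t; rewrite -[LHS]/(f (simplex_mix _ t)) simplex_mix_id.
- by [].
- exact: bary_apex_nat.
- by [].
- by move=> m i j c; apply: iter_subdiv_nat => *; exact: bary_apex_nat.
- by move=> m c _; rewrite /sdf iter_subdiv0.
- by [].
- by move=> m i c ci; exact: iter_subdiv_tupbd.
- by [].
- exact: zA.
Qed.

End IteratedSubdivision.
Arguments subdivision {R k T} it.

(** * The mesh of a subdivision *)

Section Mesh.
Context (R : realType) (k : fieldType) (m : nat).
Local Notation Delta := (std_simplex R).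
Implicit Types (s : seq (Delta m)) (x y : Delta m).

Definition coord_close d x y := forall i, `|set_val x 0 i - set_val y 0 i| <= d :> R.
Definition diam_le d s := forall x y, x \in s -> y \in s -> coord_close d x y.
(** A substitute for the convex hull that suffices for estimates: [y] belongs to every box,
    in each coordinate, that contains [s]. *)
Definition box_hull s y := forall i (c r : R),
  (forall v, v \in s -> `|c - set_val v 0 i| <= r) -> `|c - set_val y 0 i| <= r.

Lemma box_hull_mix n (v : nat -> Delta m) (t : Delta n) s :
  (forall l, (l <= n)%N -> v l \in s) -> box_hull s (simplex_mix v t).
Proof.
move=> vs i c r cr; rewrite simplex_mixE -[c]mul1r -(coord_sum t) mulr_suml -sumrB.
apply: (le_trans (ler_norm_sum _ _ _)).
have -> : r = \sum_l set_val t 0 l * r by rewrite -mulr_suml coord_sum mul1r.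
apply: ler_sum => l _; rewrite -mulrBr normrM ger0_norm ?coord_ge0 //.
by rewrite ler_wpM2l ?coord_ge0 // cr // vs // -ltnS.
Qed.

(** In the mean of the differences between [v] and the points of the tuple, the term of [v]
    itself vanishes, which gains the factor n/(n+1). *)
Lemma barycenter_close d x s v : diam_le d (x :: s) -> v \in x :: s ->
  coord_close ((size s)%:R / (size s).+1%:R * d) (bary_apex x s) v.
Proof.
move=> sd vs i; rewrite simplex_mixE; set n := size s.
have w0 : (n.+1%:R : R) != 0 by rewrite pnatr_eq0.
(* both terms are written as means over the tuple *)
have vE : set_val v 0 i = \sum_(l < n.+1) n.+1%:R^-1 * set_val v 0 i.
  by rewrite -mulr_suml sumr_const card_ord -[X in X * _]mulr_natl divff // mul1r.
rewrite vE -sumrB; apply: (le_trans (ler_norm_sum _ _ _)).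
have j_lt : (index v (x :: s) < n.+1)%N by rewrite index_mem.
pose j := Ordinal j_lt.
have vj : nth x (x :: s) j = v by exact: nth_index.
rewrite (bigD1 j) //= mxE vj subrr normr0 add0r.
have -> : n%:R / n.+1%:R * d = \sum_(l < n.+1 | l != j) n.+1%:R^-1 * d.
  rewrite sumr_const -[RHS]mulr_natl mulrA; congr (_%:R / _ * d).
  by rewrite (eq_card (_ : _ =i predC1 j)) ?cardC1 ?card_ord.
apply: ler_sum => l _; rewrite mxE -mulrBr normrM ger0_norm ?invr_ge0 //.
by rewrite ler_wpM2l ?invr_ge0 //; apply: sd => //; exact: mem_nth.
Qed.

Definition mesh_ratio (N : nat) : R := N%:R / N.+1%:R.

Lemma mesh_ratio_le n N : (n <= N)%N -> n%:R / n.+1%:R <= mesh_ratio N.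
Proof.
move=> nN; rewrite /mesh_ratio ler_pdivrMr ?ltr0n // mulrAC ler_pdivlMr ?ltr0n //.
by rewrite -!natrM ler_nat; lia.
Qed.

(** The hull condition is carried along because the new apex must be compared with points
    that come from the subdivision of the faces, not only with the original vertices. *)
Lemma subdiv_diam N d n s : (n <= N.+1)%N -> size s = n -> 0 <= d -> diam_le d s ->
  supported [set s' | diam_le (mesh_ratio N * d) s' /\ forall y, y \in s' -> box_hull s y]
    (subdiv (k := k) (@bary_apex R m) n << s >>).
Proof.
move=> + + d0; elim: n s => [|n IH] s nN sn sd.
  by apply: supportedU; case: s sn {sd}.
case: s sn sd => [//|x s] /= [sn] sd; rewrite cone_extU.
set Q := (X in supported X _).
have sQ := @supported_vsubspace k (seq (Delta m)) Q.
have QU : supported Q (subdiv (k := k) (@bary_apex R m) n (tuple_bd (x :: s))).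
  rewrite tuple_bdE linear_sum; apply: (vsubspace_sum sQ) => i.
  rewrite linearZ; apply: (vsubspaceZ _ sQ).
  have del_sub v : v \in del i (x :: s) -> v \in x :: s.
    move=> /(nthP x)[j jn <-]; rewrite nth_del mem_nth // /bump.
    have jn' : (j < size s)%N by move: jn; rewrite size_del.
    by rewrite /=; case: (i <= j)%N; rewrite ?add1n ?add0n ltnS // ltnW.
  have := IH (del i (x :: s)) (ltnW nN); rewrite size_del //= => /(_ sn) {}IH.
  apply: supportedS (IH _) => [t [td th]|y z /del_sub ys /del_sub zs]; last exact: sd.
  by split=> // y /th yh j c r cr; apply: yh => v /del_sub; exact: cr.
apply: (supported_linear sQ _ QU) => t [td th].
have xs_close v : v \in x :: s -> coord_close (mesh_ratio N * d) (bary_apex x s) v.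
  move=> vs i; apply: (le_trans (barycenter_close sd vs i)).
  by rewrite ler_wpM2r // mesh_ratio_le // sn.
have b_close y : y \in t -> coord_close (mesh_ratio N * d) (bary_apex x s) y.
  by move=> yt i; apply: th => // v vs; exact: xs_close.
rewrite coneU; apply: supportedU; split=> [y z|y]; last first.
  rewrite inE => /orP[/eqP->|/th//].
  by apply: box_hull_mix => l lt; apply: mem_nth.
rewrite !inE => /orP[/eqP->|yt] /orP[/eqP->|zt].
- by move=> i; rewrite subrr normr0 mulr_ge0 // divr_ge0.
- exact: b_close.
- by move=> i; rewrite distrC; exact: b_close.
- exact: td.
Qed.

Lemma simplex_close x y : coord_close 1 x y.
Proof.
have le1 (z : Delta m) i : set_val z 0 i <= 1 :> R.
  rewrite -(coord_sum z) (bigD1 i) //= lerDl; apply: sumr_ge0 => j _.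
  exact: coord_ge0.
by move=> i; have := le1 x i; have := le1 y i; have := coord_ge0 x i;
  have := coord_ge0 y i; rewrite ler_norml => *; apply/andP; split; lra.
Qed.

Lemma iter_subdiv_diam N it s : size s = N.+1 ->
  supported [set s' | size s' = N.+1 /\ diam_le (mesh_ratio N ^+ it) s']
    (iter_subdiv (k := k) (@bary_apex R m) it N.+1 << s >>).
Proof.
move=> sN; elim: it => [|it IH].
  by apply: supportedU; split=> // x y _ _; exact: simplex_close.
apply: (supported_linear _ _ IH); first exact: supported_vsubspace.
move=> t [tN td] u uP.
split; first by apply: (@subdiv_size _ _ (@bary_apex R m) _ << t >> _ u uP); exact: supportedU.
have r0 : 0 <= mesh_ratio N ^+ it by rewrite exprn_ge0 // divr_ge0.
by have [ud _] := subdiv_diam (leqnn _) tN r0 td uP; rewrite exprS.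
Qed.

End Mesh.

(** * Cycles made of small simplices *)

Section SmallSimplices.
Context (R : realType) (k : fieldType) (T : topologicalType).
Local Notation Delta := (std_simplex R).

Lemma simplex_compact n : compact (Delta n).
Proof.
have cube := @rV_compact R n.+1 (fun=> `[0, 1]%classic) (fun=> @segment_compact R 0 1).
apply: (subclosed_compact _ cube).
  have -> : Delta n = \bigcap_i [set x : 'rV[R]_n.+1 | 0 <= x 0 i] `&`
      (fun x : 'rV[R]_n.+1 => \sum_i x 0 i : R) @^-1` [set y | y = 1].
    apply/seteqP; split=> [x [x0 x1]|x [x0 x1]]; first by split=> // i _; exact: x0.
    by split=> // i; exact: x0.
  apply: closedI.
    apply: closed_bigI => i _.
    apply: (@closed_comp _ _ (fun x : 'rV[R]_n.+1 => x 0 i : R) [set y | 0 <= y]).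
      by move=> x _; exact: coord_continuous.
    exact: closed_ge.
  apply: closed_comp; last exact: closed_eq.
  by move=> x _; apply: sum_continuous => i; exact: coord_continuous.
move=> x x01 i; have [x0 x1] := x01; rewrite /= in_itv /= x0 -x1 (bigD1 i) //= lerDl.
by apply: sumr_ge0 => j _.
Qed.

(** Compactness of the simplex, as a near covering with the radius as parameter. *)
Lemma lebesgue_number n (f : continuousType (Delta n) T) (O1 O2 : set T) :
  open O1 -> open O2 -> (forall t, O1 (f t) \/ O2 (f t)) ->
  exists2 e : R, 0 < e & forall t, (forall t', coord_close e t t' -> O1 (f t')) \/
                               (forall t', coord_close e t t' -> O2 (f t')).
Proof.
move=> oO1 oO2 fO.
pose P (O : set T) (e : R) (x : 'rV[R]_n.+1) := forall t' : Delta n,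
  (forall i, `|x 0 i - set_val t' 0 i| <= e) -> O (f t').
have nearP O (t : Delta n) : open O -> O (f t) ->
    \forall x' \near set_val t & e \near 0^'+, P O e x'.
  move=> oO Oft.
  have : open (f @^-1` O) by apply: open_comp => // y _; exact: cts_fun.
  move=> [B oB BE].
  have : nbhs (set_val t) B.
    by move: oB; rewrite openE; apply; rewrite -[B _]/((set_val @^-1` B) t) BE.
  move=> /nbhs_ballP[d /= d0 dB].
  exists (ball (set_val t) (d / 2), [set e | e < d / 2]).
    split=> /=; first by apply: nbhsx_ballx; rewrite divr_gt0.
    by apply: nbhs_right_lt; rewrite divr_gt0.
  move=> [x' e] /= [[_ xx'] ed] t' x't'.
  suff : (f @^-1` O) t' by [].
  rewrite -BE; apply: dB; split=> // a i.
  have := xx' a i; rewrite (ord1 a) /ball /= => x1.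
  apply: le_lt_trans (ler_distD (x' 0 i) _ _) _.
  by rewrite [d]splitr; apply: ltrD => //; apply: le_lt_trans ed; exact: x't'.
have /compact_near_coveringP nc := @simplex_compact n.
have : \forall e \near 0^'+, Delta n `<=` (fun x => P O1 e x \/ P O2 e x).
  apply: nc => x xD; have {xD}[t <-] : exists t : Delta n, set_val t = x.
    by exists (exist _ x (mem_set xD)).
  have [/(nearP _ _ oO1)|/(nearP _ _ oO2)] := fO t; apply: filterS => -[x' e] /= ?.
    by left.
  by right.
move=> /(filterI (nbhs_right_gt 0))/filter_ex[e [e0 eP]].
by exists e => // t; apply: eP; exact: (set_mem (valP t)).
Qed.

Variables (O1 O2 Y : set T) (n : int).
Hypotheses (oO1 : open O1) (oO2 : open O2) (YO : Y `<=` O1 `|` O2).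

Definition split_chains : set (singular_chain R k T) :=
  [set c | exists u v, [/\ u \in chains n (Y `&` O1), v \in chains n (Y `&` O2) & c = u + v]].

Lemma split_chains_vsubspace : vsubspace split_chains.
Proof.
split=> [|a _ _ [u [v [uP vP ->]]] [u' [v' [u'P v'P ->]]]].
  by exists 0, 0; rewrite !rpred0 addr0.
exists (a *: u + u'), (a *: v + v'); rewrite !rpredD ?rpredZ //; split=> //.
by rewrite scalerDr addrACA.
Qed.

(** Once the mesh is below the Lebesgue number of the cover pulled back by [f], each piece
    lands in one of the two open sets. *)
Lemma subdivision_split_simplex m (f : continuousType (Delta m) T) :
  m%:Z = n -> (forall t, Y (f t)) ->
  \forall it \near \oo, split_chains (subdivision it (<< existT _ m f >> : singular_chain R k T)).
Proof.
move=> mn fY.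
have [e e0 eP] := lebesgue_number oO1 oO2 (fun t => YO (fY t)).
have r1 : `|mesh_ratio R m| < 1.
  rewrite /mesh_ratio ger0_norm ?divr_ge0 // ltr_pdivrMr ?ltr0n // mul1r ltr_nat.
  exact: ltnSn.
have /cvgrPdist_lt/(_ e e0) := cvg_expr r1.
apply: filterS => it; rewrite sub0r normrN => ite.
rewrite /subdivision universalU.
change (split_chains (realize k (simplex_mixing R m) f
  (iter_subdiv (@bary_apex R m) it m.+1 << id_tuple R m >>))).
apply: (@supported_linear _ _ _ (realize k (simplex_mixing R m) f) _ _ _
  split_chains_vsubspace _ (iter_subdiv_diam (size_id_tuple R m))).
move=> s [sm sd]; rewrite realizeU (real_tupleE _ _ (vertex R m 0) _ sm).
have x0s : nth (vertex R m 0) s 0 \in s by apply: mem_nth; rewrite sm.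
set x0 := nth _ _ _ in x0s.
have xs_close (t : Delta m) : coord_close e x0 (simplex_mix (nth (vertex R m 0) s) t).
  move=> i; apply: (@box_hull_mix _ _ _ _ _ s) => [l lm|v vs].
    by apply: mem_nth; rewrite sm ltnS.
  apply: (le_trans (sd _ _ x0s vs i)); apply: ltW; apply: le_lt_trans ite.
  exact: ler_norm.
case: (eP x0) => [in1|in2].
  exists (sing k (f \o simplex_mixing R m m (nth (vertex R m 0) s))), 0.
  rewrite rpred0 addr0; split=> //; rewrite -mn; apply: sing_chains => t; split; first exact: fY.
  by apply: in1; exact: xs_close.
exists 0, (sing k (f \o simplex_mixing R m m (nth (vertex R m 0) s))).
rewrite rpred0 add0r; split=> //; rewrite -mn; apply: sing_chains => t; split; first exact: fY.
by apply: in2; exact: xs_close.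
Qed.

(** A single number of subdivisions works for all the simplices of [z], since they are
    finitely many. *)
Lemma cycle_small_chains z : z \in cycles n Y -> exists u v w,
  [/\ u \in chains n (Y `&` O1), v \in chains n (Y `&` O2), w \in chains (n + 1) Y &
      z = u + v + singular_bd R k T w].
Proof.
move=> zY.
have [it [u [v [uP vP zuv]]]] : exists it, split_chains (subdivision it z).
  move: zY; rewrite cyclesE => /andP[/chainsP zY _].
  have : \forall it \near \oo, forall s, s \in dom z ->
      split_chains (subdivision it (<< s >> : singular_chain R k T)).
    have : forall s, s \in dom z -> (projT1 s)%:Z = n /\ forall x, Y (projT2 s x).
      by move=> s; rewrite mem_dom; exact: zY.
    elim: (dom z) => [|s l IH] lY; first by apply: nearW.
    have {}IH := IH (fun t tl => lY t (mem_behead (s := s :: l) tl)).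
    have := lY s (mem_head _ _); case: s {lY} => m f /= [mn fY].
    have := subdivision_split_simplex mn fY.
    move=> /(filterI IH); apply: filterS => it [lP fP] s.
    by rewrite inE => /orP[/eqP->//|/lP].
  move=> /filter_ex[it itP]; exists it.
  apply: (@supported_linear _ _ _ _ [set s | s \in dom z]) => //.
    exact: split_chains_vsubspace.
  by move=> s; rewrite /= mem_dom.
have [w wY zw] := subdivision_homologous it zY.
by exists u, v, w; split=> //; rewrite -zuv -zw addrC subrK.
Qed.

End SmallSimplices.

(** * Finitely generated homology *)

Section FiniteHomology.
Context (R : realType) (k : fieldType).
Implicit Types (T : topologicalType) (n : int).

(** For [A] contained in [B], this says that the image of the homology of [A] in that of [B]
    is finite-dimensional. *)
Definition fin_homology T n (A B : set T) :=
  fg_mod [set z : singular_chain R k T | z \in cycles n A] [set z | z \in boundaries n B].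

Lemma fin_homologyS T n (A A' B B' : set T) : A' `<=` A -> B `<=` B' ->
  fin_homology n A B -> fin_homology n A' B'.
Proof.
move=> AA BB; apply: fg_modS => z /=.
  by rewrite !cyclesE => /andP[/(chainsS AA)-> ->].
by move=> /boundariesP[y yB ->]; apply/boundariesP; exists y; rewrite ?(chainsS BB).
Qed.

Lemma bd_chains T n (A : set T) (z : singular_chain R k T) :
  z \in chains n A -> singular_bd R k T z \in chains (n - 1) A.
Proof.
move=> /chainsP zA.
apply: (supported_linear (vsubspace_pred (chains (n - 1) A)) _ zA) => -[m f] /= [mn fA].
rewrite singular_bdU; case: m f mn fA => [|m] f mn fA; first exact: rpred0.
rewrite rpred_sum // => i _; rewrite rpredZ // -mn.
have -> : m.+1%:Z - 1 = m%:Z by lia.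
have -> : << existT _ m (f \o face i : continuousType _ _) >> = sing k (f \o face i).
  by apply/esym/sing_eq.
by apply: sing_chains => x; exact: fA.
Qed.

Lemma boundaries_vsubspace T n (A : set T) :
  vsubspace [set z : singular_chain R k T | z \in boundaries n A].
Proof. exact: vsubspace_pred (boundaries n A). Qed.

Section MayerVietoris.
Context (T : topologicalType) (Y O1 O2 : set T) (n : int).
Local Notation bd := (singular_bd R k T).
Local Notation W := (Y `&` O1 `&` O2).

Let common_bd : set (singular_chain R k T) := [set x | exists u v,
  [/\ u \in chains n (Y `&` O1), v \in chains n (Y `&` O2), bd u + bd v = 0 & x = bd u]].

Let common_bd_vsubspace : vsubspace common_bd.
Proof.
split=> [|a _ _ [u [v [uP vP uv0 ->]]] [u' [v' [u'P v'P uv'0 ->]]]].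
  by exists 0, 0; rewrite !rpred0 linear0 addr0.
exists (a *: u + u'), (a *: v + v'); rewrite !rpredD ?rpredZ // !linearP; split=> //.
by rewrite addrACA -scalerDr uv0 uv'0 scaler0 addr0.
Qed.

Let common_bd_cycles x : common_bd x -> x \in cycles (n - 1) W.
Proof.
move=> [u [v [/bd_chains/chainsP uP /bd_chains/chainsP vP uv0 ->]]].
rewrite cyclesE singular_bd_bd eqxx andbT; apply/chainsP => s us.
have [sn s1] := uP s us; have [|_ s2] := vP s.
  move/eqP: uv0; rewrite addrC addr_eq0 => /eqP->.
  by rewrite coeffN oppr_eq0.
by split=> // y; split=> //; have [] := s2 y.
Qed.

(** A relation between boundaries bd u, modulo boundaries of chains of the overlap, lifts to
    the sums [u + v]: correcting [u] and [v] by opposite chains of the overlap turns both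
    into cycles. *)
Let lift_common_bd e : (forall x, x \in e -> common_bd x) ->
  exists e', forall u v, u \in chains n (Y `&` O1) -> v \in chains n (Y `&` O2) ->
    bd u + bd v = 0 -> span_mod [set z | z \in boundaries (n - 1) W] e (bd u) ->
    span_mod [set z | exists u' v', [/\ u' \in cycles n (Y `&` O1),
      v' \in cycles n (Y `&` O2) & z = u' + v']] e' (u + v).
Proof.
elim: e => [|x e IH] eP.
  exists [::] => u v uP vP uv0 /boundariesP[w]; rewrite subrK => wW uw.
  (* [w] lies in the overlap, so it may be subtracted on one side and added on the other *)
  have w1 : w \in chains n (Y `&` O1) by apply: chainsS wW => y [].
  have w2 : w \in chains n (Y `&` O2) by apply: chainsS wW => y [[]].
  exists (u - w), (v + w); rewrite !cyclesE (rpredB uP w1) (rpredD vP w2); split.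
  - by rewrite linearB -uw subrr eqxx.
  - by rewrite linearD -uw addrC uv0 eqxx.
  - by rewrite addrACA addNr addr0.
have [y ye|e' e'P] := IH; first by apply: eP; rewrite inE ye orbT.
have [ux [vx [uxP vxP uvx0 xE]]] := eP x (mem_head _ _).
exists ((ux + vx) :: e') => u v uP vP uv0 [a ua]; exists a.
have -> : u + v - a *: (ux + vx) = (u - a *: ux) + (v - a *: vx).
  by rewrite scalerDr opprD addrACA.
apply: e'P; rewrite ?rpredB ?rpredZ //.
  by rewrite !linearB !linearZ /= addrACA uv0 add0r -scalerDr -opprD uvx0 oppr0 scaler0.
by rewrite linearB linearZ -xE.
Qed.

(** Exactness of the Mayer-Vietoris sequence at the homology of [Y], in the weak form that
    finiteness requires: the class of [u + v] is determined by that of [bd u] in the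
    overlap, up to classes from the two open pieces. *)
Theorem mayer_vietoris_fin : open O1 -> open O2 -> Y `<=` O1 `|` O2 ->
  fin_homology n (Y `&` O1) Y -> fin_homology n (Y `&` O2) Y ->
  fin_homology (n - 1) W W -> fin_homology n Y Y.
Proof.
move=> oO1 oO2 YO [e1 e1P] [e2 e2P] WF.
have sB := boundaries_vsubspace.
have [e [eS eP]] : exists e, (forall x, x \in e -> common_bd x) /\
    common_bd `<=` span_mod [set z | z \in boundaries (n - 1) W] e.
  apply: fg_mod_inside; [exact: common_bd_vsubspace|exact: sB|].
  by apply: fg_modS WF => // x; exact: common_bd_cycles.
have [e' e'P] := lift_common_bd eS.
exists (e' ++ (e1 ++ e2)) => z zY.
have [u [v [w [uP vP wP zE]]]] := cycle_small_chains oO1 oO2 YO zY.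
have uv0 : bd u + bd v = 0.
  move: zY; rewrite /= cyclesE => /andP[_ /eqP].
  by rewrite zE !linearD /= singular_bd_bd addr0.
rewrite span_mod_cat zE; apply: vsubspaceD; last first.
- by do 2! apply: span_mod0; apply/boundariesP; exists w.
- apply: (span_modS _ (e'P _ _ uP vP uv0 (eP _ _))); last by exists u, v.
  move=> _ [u' [v' [/e1P u'P /e2P v'P ->]]].
  rewrite span_mod_cat; apply: vsubspaceD.
  + by apply: span_mod_vsubspace; exact: span_mod_vsubspace.
  + by apply: span_modS u'P; exact: span_mod0.
  + exact: span_mod0.
- by apply: span_mod_vsubspace; exact: span_mod_vsubspace.
Qed.

End MayerVietoris.

(** If the inclusion of [A] in [B] is homotopic to a map that factors through [A'], then its
    effect on homology factors through the homology of [A']. *)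
Lemma fin_homology_dominated (T T' : topologicalType) n (A B : set T) (A' : set T')
    (f : T -> T') (g : T' -> T) (h : T * R -> T) :
  cont_on A f -> (forall x, A x -> A' (f x)) ->
  cont_on A' g -> (forall x, A' x -> B (g x)) ->
  cont_on (S := (T * R)%type) (A `*` `[0, 1]) h ->
  (forall x t, A x -> 0 <= t <= 1 -> B (h (x, t))) ->
  (forall x, A x -> h (x, 0) = x) -> (forall x, A x -> h (x, 1) = g (f x)) ->
  fin_homology n A' A' -> fin_homology n A B.
Proof.
move=> cf fA cg gA ch hA h0 h1 [e' e'P]; exists (map (push R k g) e') => z zA.
have [w wB] := homotopy_boundary ch hA zA.
have zc : z \in chains n A by move: zA; rewrite /= cyclesE => /andP[].
rewrite (push_eq h0 zc) push_id (push_eq h1 zc) => /(canRL (subrK _)) zE.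
have -> : z = push R k (fun x => g (f x)) z - singular_bd R k T w by rewrite zE addrAC subrr add0r.
have sB := @boundaries_vsubspace T n B.
apply: vsubspaceB; first exact: span_mod_vsubspace.
  rewrite -[X in span_mod _ _ X](push_comp g cf zc); apply: span_mod_map; last first.
    by apply: e'P; rewrite /=; exact: push_cycles zA.
  by move=> b; exact: push_boundaries.
by apply: span_mod0; apply/boundariesP; exists w.
Qed.

Lemma fin_homology_set0 T n (B : set T) : fin_homology n set0 B.
Proof.
exists [::] => z; rewrite /= cyclesE => /andP[/chainsP z0 _].
suff -> : z = 0 by exact: rpred0.
apply/eqP/freeg_eqP => s; rewrite coeff0; apply/eqP/negPn/negP => /z0[_].
by move=> /(_ (vertex R _ 0)).
Qed.

Lemma fin_homology_point T n (c : T) : fin_homology n [set c] [set c].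
Proof.
exists [:: sing k (fun _ : std_simplex R `|n|%N => c)] => z.
rewrite /= cyclesE => /andP[/chainsP zc _].
pose s0 : singular_simplex R T := existT _ `|n|%N (cts_map (@cst_continuous _ _ c)).
have s0E : sing k (fun _ : std_simplex R `|n|%N => c) = << s0 >> by exact: sing_eq.
exists (coeff s0 z); rewrite s0E.
suff -> : z - coeff s0 z *: << s0 >> = 0 by exact: rpred0.
apply/eqP; rewrite subr_eq0; apply/freeg_eqP => s.
rewrite coeffZ coeffU mul1r; have [<-|s0s] := eqVneq s0 s; first by rewrite mulr1.
rewrite mulr0; apply/eqP/negPn/negP => /zc[sn sc]; move/eqP: s0s; apply.
case: s sn sc => m f /= mn fc; rewrite /s0; move: mn => /(congr1 absz) /= mn.
case: _ / mn; congr existT; apply/continuousEP => x /=; exact/esym/fc.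
Qed.

Section PuncturedSpace.
Variable d : nat.
Implicit Types (x : 'rV[R]_d).

Lemma line_continuous (c : 'rV[R]_d) :
  continuous (fun y : 'rV[R]_d * R => (1 - y.2) *: y.1 + y.2 *: c).
Proof.
apply: row_continuous => j y.
have -> : (fun y : 'rV[R]_d * R => ((1 - y.2) *: y.1 + y.2 *: c) 0 j : R) =
    (fun y => (1 - y.2) * y.1 0 j + y.2 * c 0 j) by apply/funext => z; rewrite !mxE.
apply: cvgD.
  apply: cvgM; first by apply: cvgB; [exact: cvg_cst|exact: cvg_snd].
  apply: (@cvg_comp _ _ _ fst (fun x : 'rV[R]_d => x 0 j)); first exact: cvg_fst.
  exact: coord_continuous.
by apply: cvgM; [exact: cvg_snd|exact: cvg_cst].
Qed.

Lemma fin_homology_star n (A : set 'rV[R]_d) c :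
  (forall x t, A x -> 0 <= t <= 1 -> A ((1 - t) *: x + t *: c)) ->
  (exists x, A x) -> fin_homology n A A.
Proof.
move=> Ac [x0 Ax0].
have Acc : A c.
  by have := Ac x0 1 Ax0; rewrite subrr scale0r add0r scale1r; apply; rewrite ler01 lexx.
apply: (@fin_homology_dominated _ _ n A A [set c] (fun=> c) id
  (fun y => (1 - y.2) *: y.1 + y.2 *: c)) => //=.
- by move=> Y g cg gA x; exact: cvg_cst.
- by move=> _ ->.
- by move=> Y g cg gA x; apply: continuous_comp; [exact: cg|exact: line_continuous].
- by move=> x _; rewrite subr0 scale1r scale0r addr0.
- by move=> x _; rewrite subrr scale0r add0r scale1r.
- exact: fin_homology_point.
Qed.

Definition nonzero_from (j : nat) : set 'rV[R]_d :=
  [set x | exists2 i : 'I_d, (j <= i)%N & x 0 i != 0].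

(** Each of the two signs of the [j]-th coordinate gives an open piece, star-shaped about a
    multiple of the [j]-th basis vector; no point has both signs, so the pieces meet in
    [nonzero_from j.+1]. *)
Lemma fin_homology_nonzero_from n j : fin_homology n (nonzero_from j) (nonzero_from j).
Proof.
have [l jl] : exists l, (d - j <= l)%N by exists (d - j)%N.
elim: l j n jl => [|l IH] j n jl.
  have -> : nonzero_from j = set0; last exact: fin_homology_set0.
  by rewrite -subset0 => x [i ji _]; have := ltn_ord i; lia.
have [jd|dj] := ltnP j d; last by apply: IH; lia.
pose o := Ordinal jd.
pose U (s : R) : set 'rV[R]_d := [set x | nonzero_from j.+1 x \/ 0 < s * x 0 o].
have oU s : open (U s).
  have -> : U s = \bigcup_(i in [set i : 'I_d | (j < i)%N]) [set x | x 0 i != 0] `|`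
      [set x | 0 < s * x 0 o].
    apply/seteqP; split=> x [[i ji xi]|xo]; try by right.
      by left; exists i.
    by left; exists i.
  apply: openU.
    apply: bigcup_open => i _.
    apply: (@open_comp _ _ (fun x : 'rV[R]_d => x 0 i : R) [set y | y != 0]).
      by move=> x _; exact: coord_continuous.
    exact: open_neq.
  apply: (@open_comp _ _ (fun x : 'rV[R]_d => s * x 0 o : R) [set y | 0 < y]).
    have cm : continuous (fun x : 'rV[R]_d => s * x 0 o : R).
      by apply: mulf_continuous; [exact: cst_continuous|exact: coord_continuous].
    by move=> x _; exact: cm.
  exact: open_gt.
have UE s : s * s = 1 -> nonzero_from j `&` U s = U s.
  move=> s1; apply/seteqP; split=> x; first by case.
  move=> xU; split=> //; case: xU => [[i ji xi]|xo]; first by exists i => //; exact: ltnW.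
  by exists o => //; apply: contraTneq xo => ->; rewrite mulr0 ltxx.
have UF s : s * s = 1 -> fin_homology n (nonzero_from j `&` U s) (nonzero_from j).
  move=> s1; apply: (@fin_homologyS _ _ (U s) _ (U s)).
  - by rewrite UE.
  - by rewrite -(UE _ s1) => x [].
  apply: (@fin_homology_star _ _ (s *: delta_mx 0 o)); last first.
    by exists (s *: delta_mx 0 o); right; rewrite !mxE !eqxx mulr1 s1.
  (* at [t = 1] all the later coordinates vanish, and the sign condition takes over *)
  move=> x t xU /andP[t0 t1]; have [->|tn1] := eqVneq t 1.
    by right; rewrite !mxE !eqxx subrr mul0r add0r mul1r mulr1 s1.
  case: xU => [[i ji xi]|xo].
    left; exists i => //; rewrite !mxE eqxx /=.
    have -> : (i == o) = false by apply/negbTE; rewrite -val_eqE /=; lia.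
    by rewrite !mulr0 addr0 mulf_neq0 // subr_eq0 eq_sym.
  right; rewrite !mxE !eqxx /= mulr1 mulrDr mulrCA [s * (t * s)]mulrCA s1 mulr1.
  by apply: ltr_wpDr => //; rewrite mulr_gt0 // subr_gt0 lt_neqAle tn1.
apply: (@mayer_vietoris_fin _ _ (U 1) (U (-1))) => //.
- move=> x [i ji xi]; have [ij|ij] := eqVneq (i : nat) j; last first.
    by left; left; exists i => //; rewrite ltn_neqAle eq_sym ij.
  have io : i = o by exact: val_inj.
  move: xi; rewrite io neq_lt => /orP[xo|xo]; [right|left]; right; rewrite ?mulN1r ?oppr_gt0 //.
  by rewrite mul1r.
- by apply: UF; rewrite mulr1.
- by apply: UF; rewrite mulrNN mulr1.
rewrite UE ?mulr1 //.
have -> : U 1 `&` U (-1) = nonzero_from j.+1.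
  apply/seteqP; split=> [x [[//|x1] [//|]]|x xj]; last by split; left.
  by move: x1; rewrite mul1r mulN1r oppr_gt0 => x1 /(lt_trans x1); rewrite ltxx.
by apply: IH; lia.
Qed.

Lemma fin_homology_punctured n (A := [set x : 'rV[R]_d | x != 0]) : fin_homology n A A.
Proof.
have -> : A = nonzero_from 0; last exact: fin_homology_nonzero_from.
apply/seteqP; split=> x /=; last by move=> [i _]; apply: contraNneq => ->; rewrite mxE.
move=> x0; apply: contrapT => nx; move/eqP: x0; apply; apply/rowP => i; rewrite mxE.
by apply/eqP/negPn/negP => xi; apply: nx; exists i.
Qed.

End PuncturedSpace.
End FiniteHomology.

(** * Continuity on closed pieces *)

Section ContinuityTools.
Context (R : realType) (S : topologicalType).
Implicit Types (f g : S -> R).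

Lemma max_fun_continuous f g : continuous f -> continuous g ->
  continuous (fun x => Num.max (f x) (g x)).
Proof.
move=> cf cg x; have cfx : {for x, continuous (f : S -> R^o)} := cf x.
have cgx : {for x, continuous (g : S -> R^o)} := cg x.
exact: (continuous_max cfx cgx).
Qed.
Lemma min_fun_continuous f g : continuous f -> continuous g ->
  continuous (fun x => Num.min (f x) (g x)).
Proof.
move=> cf cg x; have cfx : {for x, continuous (f : S -> R^o)} := cf x.
have cgx : {for x, continuous (g : S -> R^o)} := cg x.
exact: (continuous_min cfx cgx).
Qed.
Lemma addf_continuous f g : continuous f -> continuous g ->
  continuous (fun x => f x + g x).
Proof. by move=> cf cg x; apply: cvgD; [exact: cf|exact: cg]. Qed.
Lemma subf_continuous f g : continuous f -> continuous g ->
  continuous (fun x => f x - g x).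
Proof. by move=> cf cg x; apply: cvgB; [exact: cf|exact: cg]. Qed.
Lemma invf_continuous f : continuous f -> (forall x, f x != 0) ->
  continuous (fun x => (f x)^-1).
Proof. by move=> cf f0 x; apply: cvgV; [exact: f0|exact: cf]. Qed.
Lemma scalef_continuous d f (v : S -> 'rV[R]_d) : continuous f -> continuous v ->
  continuous (fun x => f x *: v x).
Proof. by move=> cf cv x; apply: cvgZ; [exact: cf|exact: cv]. Qed.
Lemma compf_continuous (S' S'' : topologicalType) (f : S -> S') (g : S' -> S'') :
  continuous f -> continuous g -> continuous (fun x => g (f x)).
Proof. by move=> cf cg x; apply: continuous_comp; [exact: cf|exact: cg]. Qed.

End ContinuityTools.

Section ClosedOn.
Implicit Types (S T Z : topologicalType).

(** For closed [K] this is continuity of [f] on [K]; stated by closed sets of the ambient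
    space, it can be glued along finite closed covers. *)
Definition closed_on S Z (K : set S) (f : S -> Z) :=
  forall F, closed F -> closed (K `&` f @^-1` F).

Lemma closed_on_cont S Z (K : set S) (f : S -> Z) : closed_on K f -> cont_on K f.
Proof.
move=> fK Y g cg gK; apply/continuous_closedP => F /fK cF.
have -> : (f \o g) @^-1` F = g @^-1` (K `&` f @^-1` F).
  by apply/seteqP; split=> [y fgy|y []//]; split=> //; exact: gK.
by move/continuous_closedP: cg; apply.
Qed.

Lemma closed_on_comp S S' Z (K : set S) (K' : set S') (g : S -> S') (f : S' -> Z) :
  closed K -> continuous g -> (forall x, K x -> K' (g x)) -> closed_on K' f ->
  closed_on K (f \o g).
Proof.
move=> cK /continuous_closedP cg gK fK F /fK/cg cF.
have -> : K `&` (f \o g) @^-1` F = K `&` g @^-1` (K' `&` f @^-1` F).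
  by apply/seteqP; split=> x [Kx]; [split=> //; split=> //; exact: gK|case].
exact: closedI.
Qed.

Lemma closed_on_id S (K : set S) : closed K -> closed_on K id.
Proof. by move=> cK F; exact: closedI. Qed.

Lemma closed_on_eq S Z (K : set S) (f g : S -> Z) : (forall x, K x -> f x = g x) ->
  closed_on K g -> closed_on K f.
Proof.
move=> fg gK F /gK; congr closed; apply/seteqP.
by split=> x [Kx]; rewrite /= ?fg // => ?; split=> //=; rewrite ?fg.
Qed.

Lemma within_closed_on S Z (K : set S) (f : S -> Z) :
  closed K -> {within K, continuous f} -> closed_on K f.
Proof.
move=> cK /continuous_closedP fK F /fK/closed_subspaceP[V cV VE].
by rewrite setIC -VE; exact: closedI.
Qed.

(** A continuous map from a compact set to a Hausdorff space is closed, so the continuity of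
    [f] on its image can be tested upstairs. *)
Lemma closed_on_glue S T Z (A : set T) (K : set S) (q : S -> T) (f : T -> Z) :
  hausdorff_space T -> compact K -> {within K, continuous q} ->
  closed_on A f -> closed_on K (f \o q) -> closed_on (A `|` q @` K) f.
Proof.
move=> hT cK cq fA fK F cF.
have -> : (A `|` q @` K) `&` f @^-1` F =
    (A `&` f @^-1` F) `|` q @` (K `&` (f \o q) @^-1` F).
  apply/seteqP; split=> x.
    by move=> [[Ax|[y Ky <-]] fx]; [left|right; exists y].
  by move=> [[Ax fx]|[y [Ky fy] <-]]; split=> //; [left|right; exists y].
apply: closedU; first exact: fA.
apply: compact_closed => //; apply: continuous_compact.
  by apply: (continuous_subspaceW _ cq); exact: subIsetl.
by apply: (subclosed_compact _ cK); [exact: fK|exact: subIsetl].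
Qed.

Lemma hausdorff_prod S T : hausdorff_space S -> hausdorff_space T ->
  hausdorff_space (S * T)%type.
Proof.
rewrite !open_hausdorff => hS hT [x1 y1] [x2 y2] neq.
have [x12|y12] : x1 != x2 \/ y1 != y2.
- by apply/orP; move: neq; apply: contraNT; rewrite negb_or !negbK => /andP[/eqP-> /eqP->].
- have [[U V] /= [Ux Vx] [oU oV /eqP UV]] := hS _ _ x12.
  exists (fst @^-1` U, fst @^-1` V) => /=.
    by move: Ux Vx; rewrite !inE.
  split; [by apply: open_comp => // z _; exact: cvg_fst
         |by apply: open_comp => // z _; exact: cvg_fst|].
  by rewrite -preimage_setI UV preimage_set0.
- have [[U V] /= [Uy Vy] [oU oV /eqP UV]] := hT _ _ y12.
  exists (snd @^-1` U, snd @^-1` V) => /=.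
    by move: Uy Vy; rewrite !inE.
  split; [by apply: open_comp => // z _; exact: cvg_snd
         |by apply: open_comp => // z _; exact: cvg_snd|].
  by rewrite -preimage_setI UV preimage_set0.
Qed.

Lemma closed_prod S T (A : set S) (B : set T) : closed A -> closed B ->
  closed (A `*` B : set (S * T)).
Proof.
move=> cA cB; have -> : A `*` B = (fst @^-1` A) `&` (snd @^-1` B) by [].
apply: closedI; apply: closed_comp => // z _; [exact: cvg_fst|exact: cvg_snd].
Qed.

Lemma within_continuous_prod_id S T Z (K : set S) (B : set Z) (f : S -> T) :
  {within K, continuous f} ->
  {within K `*` B, continuous (fun z : S * Z => (f z.1, z.2))}.
Proof.
move=> /subspace_continuousP cf; apply/subspace_continuousP => -[x z] [/= Kx Bz].
apply: cvg_pair => /=.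
  apply: (@cvg_comp _ _ _ fst f _ (within K (nbhs x))); last exact: cf.
  move=> U KU; have : \forall y \near (x, z), K y.1 -> U y.1.
    exact: (@cvg_fst _ _ (nbhs x) (nbhs z) _ _ KU).
  by apply: filterS => -[y w] /= yU [Ky _]; exact: yU.
apply: cvg_within_filter; exact: cvg_snd.
Qed.

End ClosedOn.

Section EuclideanNorm.
Context (R : realType) (d : nat).
Implicit Types (x : 'rV[R]_d).

Definition enorm x : R := Num.sqrt (\sum_i x 0 i ^+ 2).

Lemma enorm_ge0 x : 0 <= enorm x. Proof. exact: sqrtr_ge0. Qed.

Lemma sum_sqr_ge0 x : 0 <= \sum_i x 0 i ^+ 2.
Proof. by apply: sumr_ge0 => i _; exact: sqr_ge0. Qed.

Lemma enorm_sqr x : enorm x ^+ 2 = \sum_i x 0 i ^+ 2.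
Proof. by rewrite sqr_sqrtr // sum_sqr_ge0. Qed.

Lemma enorm_le1 x : (enorm x <= 1) = (\sum_i x 0 i ^+ 2 <= 1).
Proof. by rewrite -enorm_sqr expr_le1 // enorm_ge0. Qed.
Lemma enorm_lt1 x : (enorm x < 1) = (\sum_i x 0 i ^+ 2 < 1).
Proof. by rewrite -enorm_sqr expr_lt1 // enorm_ge0. Qed.
Lemma enorm_eq1 x : (enorm x == 1) = (\sum_i x 0 i ^+ 2 == 1).
Proof. by rewrite -enorm_sqr pexprn_eq1 ?enorm_ge0. Qed.

Lemma enormZ a x : enorm (a *: x) = `|a| * enorm x.
Proof.
rewrite /enorm -sqrtr_sqr -sqrtrM ?sqr_ge0 // mulr_sumr; congr Num.sqrt.
by apply: eq_bigr => i _; rewrite mxE exprMn.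
Qed.

Lemma enorm0 : enorm 0 = 0.
Proof. by rewrite -(scale0r (0 : 'rV[R]_d)) enormZ normr0 mul0r. Qed.

Lemma enorm_gt0 x : x != 0 -> 0 < enorm x.
Proof.
move=> x0; rewrite lt_neqAle enorm_ge0 andbT eq_sym; apply: contra x0.
rewrite -sqrf_eq0 enorm_sqr psumr_eq0 => [/allP x0|i _]; last exact: sqr_ge0.
apply/eqP/rowP => i; rewrite mxE; apply/eqP; rewrite -sqrf_eq0.
by apply: x0; rewrite mem_index_enum.
Qed.

Lemma enorm_continuous : continuous enorm.
Proof.
apply: (compf_continuous (g := Num.sqrt)); last exact: sqrt_continuous.
apply: sum_continuous => i.
by apply: mulf_continuous; exact: coord_continuous.
Qed.

Lemma disk_closed_le r : closed [set x | enorm x <= r].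
Proof.
apply: (@closed_comp _ _ enorm [set y | y <= r]); last exact: closed_le.
by move=> x _; exact: enorm_continuous.
Qed.

Lemma closed_shell r : closed [set x | r <= enorm x].
Proof.
apply: (@closed_comp _ _ enorm [set y | r <= y]); last exact: closed_ge.
by move=> x _; exact: enorm_continuous.
Qed.

Lemma unit_disk_compact : compact [set x | enorm x <= 1].
Proof.
have cube := @rV_compact R d (fun=> `[-1, 1]%classic) (fun=> @segment_compact R (-1) 1).
apply: (subclosed_compact _ cube); first exact: disk_closed_le.
move=> x /= x1 i; rewrite in_itv /= -ler_norml -(@ler_pXn2r _ 2) ?nnegrE //.
rewrite expr1n real_normK ?num_real //; apply: le_trans (_ : enorm x ^+ 2 <= 1).
  by rewrite enorm_sqr (bigD1 i) //= lerDl; apply: sumr_ge0 => j _; exact: sqr_ge0.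
by rewrite expr_le1 // enorm_ge0.
Qed.

End EuclideanNorm.

(** * Attaching a cell *)

Section AttachCell.
Context (R : realType) (k : fieldType) (T : topologicalType).
Context (A : set T) (d : nat) (phi : 'rV[R]_d -> T).
Hypotheses (hT : hausdorff_space T) (cA : closed A).
Local Notation N := (@enorm R d).
Local Notation D := [set x | N x <= 1].
Hypotheses (cphi : {within D, continuous phi})
  (phi_inj : forall x y, N x < 1 -> N y < 1 -> phi x = phi y -> x = y)
  (phi_out : forall x, N x < 1 -> ~ A (phi x))
  (phi_bd : forall x, N x = 1 -> A (phi x)).
Local Notation Y := (A `|` phi @` D).

(** Points of the open cell have a single preimage even in the closed disk, since the
    boundary sphere goes to [A]. *)
Lemma cell_inj x y : N x < 1 -> N y <= 1 -> phi x = phi y -> x = y.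
Proof.
move=> x1; rewrite le_eqVlt => /orP[/eqP/phi_bd Ay xy|]; last exact: phi_inj.
by have := phi_out x1; rewrite xy.
Qed.

Let cD : closed D. Proof. exact: disk_closed_le. Qed.

Definition cell_inv (y : T) : 'rV[R]_d := xget 0 [set x | N x < 1 /\ phi x = y].
Lemma cell_invK x : N x < 1 -> cell_inv (phi x) = x.
Proof.
move=> x1; rewrite /cell_inv; case: xgetP => [y _ [y1 yx]|/(_ x)]; last by case.
exact: phi_inj.
Qed.

Definition in_cell y := exists2 x, N x < 1 & phi x = y.

Lemma in_cellN y : A y -> ~ in_cell y.
Proof. by move=> Ay [x x1 xy]; apply: (phi_out x1); rewrite xy. Qed.

Let closed_image (K : set 'rV[R]_d) : closed K -> K `<=` D -> closed (phi @` K).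
Proof.
move=> cK KD; apply: compact_closed => //; apply: continuous_compact.
  exact: continuous_subspaceW KD cphi.
by apply: (subclosed_compact cK _ KD); exact: unit_disk_compact.
Qed.

Let phi_cont_on : cont_on D phi.
Proof. by apply: closed_on_cont; exact: within_closed_on. Qed.

(** Equal to 1 up to radius 3/4 and to 0 at radius 1. *)
Definition cutoff (r : R) : R := Num.min 1 (4 * (1 - r)).
(** An inverse of [phi] on the ball of radius 3/4, cut off so as to extend continuously by 0
    to all of [Y]. *)
Definition cell_chart y : 'rV[R]_d :=
  if pselect (in_cell y) then cutoff (N (cell_inv y)) *: cell_inv y else 0.

Lemma cell_chartE x : N x <= 1 -> cell_chart (phi x) = cutoff (N x) *: x.
Proof.
move=> x1; rewrite /cell_chart; case: pselect => /= [[z z1 zx]|xn].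
  by rewrite -zx cell_invK // (cell_inj z1 x1 zx).
have -> : N x = 1.
  by move: x1; rewrite le_eqVlt => /orP[/eqP//|x1]; exfalso; apply: xn; exists x.
by rewrite /cutoff subrr mulr0 min_r ?ler01 // scale0r.
Qed.

Lemma cell_chart_inner x : N x <= 3 / 4 -> cell_chart (phi x) = x.
Proof.
move=> x1; rewrite cell_chartE; last by apply: le_trans x1 _; lra.
by rewrite /cutoff min_l ?scale1r //; lra.
Qed.

Let chart_cont_on : cont_on Y cell_chart.
Proof.
apply: closed_on_cont; apply: closed_on_glue => //; first exact: unit_disk_compact.
  apply: (closed_on_eq (g := fun=> (0 : 'rV[R]_d))) => [y Ay|].
    by rewrite /cell_chart; case: pselect => //= /(in_cellN Ay).
  apply: (closed_on_comp cA _ _ (@closed_on_id _ setT closedT)) => //.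
  by move=> x; exact: cvg_cst.
apply: (closed_on_eq (g := fun x => cutoff (N x) *: x)) => [x x1|].
  exact: cell_chartE.
apply: (closed_on_comp cD _ _ (@closed_on_id _ setT closedT)) => //.
apply: scalef_continuous; last by move=> x; exact: cvg_id.
apply: min_fun_continuous; first exact: cst_continuous.
apply: mulf_continuous; first exact: cst_continuous.
apply: subf_continuous; first exact: cst_continuous.
exact: enorm_continuous.
Qed.

(** At time [t], the identity on the unit sphere and the radial stretching by 1/(1 - t/2), up
    to the unit sphere.  The inner maximum only keeps the denominator positive for all [t]. *)
Definition stretch (z : 'rV[R]_d * R) : 'rV[R]_d :=
  (Num.max (N z.1) (Num.max 2^-1 (1 - z.2 / 2)))^-1 *: z.1.

Let stretch_gt0 z : 0 < Num.max (N z.1) (Num.max 2^-1 (1 - z.2 / 2)) :> R.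
Proof. by rewrite !lt_max invr_gt0 ltr0n orbT. Qed.

Lemma stretch_continuous : continuous stretch.
Proof.
have cfst : continuous (fst : 'rV[R]_d * R -> _) by move=> z; exact: cvg_fst.
have csnd : continuous (snd : 'rV[R]_d * R -> _) by move=> z; exact: cvg_snd.
apply: scalef_continuous; last exact: cfst.
apply: invf_continuous; last by move=> z; rewrite gt_eqF ?stretch_gt0.
apply: max_fun_continuous.
  exact: (compf_continuous cfst (@enorm_continuous R d)).
apply: max_fun_continuous; first exact: cst_continuous.
apply: subf_continuous; first exact: cst_continuous.
by apply: mulf_continuous => //; exact: cst_continuous.
Qed.

Lemma stretch_le1 z : N (stretch z) <= 1.
Proof.
rewrite enormZ ger0_norm ?invr_ge0 ?(ltW (stretch_gt0 z)) // mulrC.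
by rewrite ler_pdivrMr ?stretch_gt0 // mul1r le_max lexx.
Qed.
Lemma stretch0 x : N x <= 1 -> stretch (x, 0) = x.
Proof.
move=> x1; rewrite /stretch /= mul0r subr0 [Num.max 2^-1 _]max_r ?max_r ?invr1 ?scale1r //.
by lra.
Qed.
Lemma stretch_bd x t : N x = 1 -> 0 <= t -> stretch (x, t) = x.
Proof.
move=> x1 t0; rewrite /stretch /= x1 max_l ?invr1 ?scale1r //.
by rewrite ge_max; apply/andP; split; lra.
Qed.
Lemma stretch1 x : 2^-1 <= N x -> N (stretch (x, 1)) = 1.
Proof.
move=> x2; have x0 : 0 < N x by apply: lt_le_trans x2; rewrite invr_gt0.
rewrite enormZ /=.
have -> : (1 - 1 / 2 : R) = 2^-1 by lra.
rewrite maxxx max_l // ger0_norm ?invr_ge0 ?(ltW x0) // mulVf //.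
by rewrite gt_eqF.
Qed.

(** The homotopy that [stretch] induces on the whole of [Y], fixing [A]. *)
Definition push_out (z : T * R) : T :=
  if pselect (in_cell z.1) then phi (stretch (cell_inv z.1, z.2)) else z.1.

Lemma push_outA y t : A y -> push_out (y, t) = y.
Proof. by move=> Ay; rewrite /push_out; case: pselect => //= /(in_cellN Ay). Qed.
Lemma push_outE x t : N x <= 1 -> 0 <= t -> push_out (phi x, t) = phi (stretch (x, t)).
Proof.
move=> x1 t0; rewrite /push_out; case: pselect => /= [[z z1 zx]|xn].
  by rewrite -zx cell_invK // (cell_inj z1 x1 zx).
rewrite stretch_bd //.
by move: x1; rewrite le_eqVlt => /orP[/eqP//|x1]; exfalso; apply: xn; exists x.
Qed.

Let cI : closed (`[0, 1]%classic : set R).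
Proof. exact: interval_closed. Qed.

Let push_out_cont_on : cont_on (S := (T * R)%type) (Y `*` `[0, 1]) push_out.
Proof.
apply: closed_on_cont.
have -> : Y `*` `[0, 1] = (A `*` `[0, 1]%classic) `|`
    (fun z : 'rV[R]_d * R => (phi z.1, z.2)) @` (D `*` `[0, 1]%classic).
  apply/seteqP; split=> [[y t] [/= [Ay|[x x1 <-]] t01]|[y t]].
  - by left.
  - by right; exists (x, t).
  - by move=> [[Ay t01]|[[x u] /= [x1 u01] [<- <-]]]; split=> //=; [left|right; exists x].
apply: closed_on_glue.
- by apply: hausdorff_prod => //; exact: norm_hausdorff.
- by apply: compact_setX; [exact: unit_disk_compact|exact: segment_compact].
- exact: within_continuous_prod_id.
- apply: (closed_on_eq (g := fst)) => [[y t] [/= Ay _]|]; first exact: push_outA.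
  apply: (closed_on_comp (K' := setT) (g := fst) (f := id)) => //.
  + exact: closed_prod.
  + by move=> z; exact: cvg_fst.
  + exact: closed_on_id closedT.
- apply: (closed_on_eq (g := phi \o stretch)) => [[x t] [/= x1]|].
    by rewrite in_itv /= => /andP[t0 _]; exact: push_outE.
  apply: (closed_on_comp (K' := D)); [exact: closed_prod|exact: stretch_continuous|..].
    by move=> z _; exact: stretch_le1.
  exact: within_closed_on.
Qed.

Let O1 := ~` (phi @` [set x | N x <= 1 / 2]).
Let O2 := ~` (A `|` phi @` [set x | 3 / 4 <= N x <= 1]).

Let oO1 : open O1.
Proof.
apply: closed_openC; apply: closed_image; first exact: disk_closed_le.
by move=> x /= x1; lra.
Qed.
Let oO2 : open O2.
Proof.
apply: closed_openC; apply: closedU => //; apply: closed_image; last first.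
  by move=> x /= /andP[].
have -> : [set x | 3 / 4 <= N x <= 1] = [set x | 3 / 4 <= N x] `&` D.
  by apply/seteqP; split=> [x /= /andP[]|x /= [-> ->]].
by apply: closedI => //; exact: closed_shell.
Qed.

Let O2P y : Y y -> O2 y -> exists2 x, N x < 3 / 4 & phi x = y.
Proof.
move=> [Ay /(_ (or_introl Ay))//|[x x1 <-] xO]; exists x => //.
rewrite ltNge; apply/negP => x3; apply: xO; right; exists x => //=.
by rewrite x3 x1.
Qed.

Let mem_O2 x : N x < 3 / 4 -> O2 (phi x).
Proof.
move=> x3; have x1 : N x < 1 by lra.
move=> [/(phi_out x1)//|[z /= /andP[z3 z1] /esym xz]].
by move: z3; rewrite -(cell_inj x1 z1 xz); lra.
Qed.

Let mem_O1 x : N x <= 1 -> 1 / 2 < N x -> O1 (phi x).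
Proof.
move=> x1 x2 [z /= z2 zx]; have z1 : N z < 1 by lra.
by move: x2; rewrite -(cell_inj z1 x1 zx); lra.
Qed.

Let mem_Y x : N x <= 1 -> Y (phi x).
Proof. by move=> x1; right; exists x. Qed.

(** Outside the ball of radius 1/2, [push_out] ends in [A]. *)
Let outer_fin n : fin_homology R k n A A -> fin_homology R k n (Y `&` O1) Y.
Proof.
apply: (fin_homology_dominated (f := fun y => push_out (y, 1)) (g := id) (h := push_out)).
- move=> Z g cg gY; apply: (push_out_cont_on (g := fun z => (g z, 1))).
    by apply: pair_continuous => //; exact: cst_continuous.
  by move=> z; split=> /=; [case: (gY z)|rewrite in_itv /= ler01 lexx].
- move=> y [[Ay|[x x1 <-] xO]]; first by rewrite push_outA.
  rewrite push_outE // ?ler01 //; apply: phi_bd; apply: stretch1.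
  by rewrite leNgt; apply/negP => x2; apply: xO; exists x => //=; lra.
- by move=> Z g cg _.
- by move=> y Ay; left.
- move=> Z g cg gY; apply: push_out_cont_on => // z.
  by have [[Yz _] tz] := gY z; split.
- move=> y t [[Ay _|[x x1 <-] _]] /andP[t0 t1]; first by left; rewrite push_outA.
  by rewrite push_outE //; apply: mem_Y; exact: stretch_le1.
- move=> y [[Ay _|[x x1 <-] _]]; first by rewrite push_outA.
  by rewrite push_outE // stretch0.
- by [].
Qed.

(** The ball of radius 3/4 contracts to its center. *)
Let inner_fin n : fin_homology R k n (Y `&` O2) Y.
Proof.
apply: (fin_homology_dominated (A' := [set phi 0]) (f := fun=> phi 0) (g := id)
  (h := fun z => phi ((1 - z.2) *: cell_chart z.1))).
- by move=> Z g cg gY; move=> x; exact: cvg_cst.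
- by [].
- by move=> Z g cg _.
- by move=> _ ->; apply: mem_Y; rewrite enorm0.
- move=> Z g cg gY; apply: (phi_cont_on (g := fun z => (1 - (g z).2) *: cell_chart (g z).1)).
    apply: scalef_continuous.
      apply: subf_continuous; first exact: cst_continuous.
      by apply: (compf_continuous cg) => z; exact: cvg_snd.
    apply: (chart_cont_on (g := fun z => (g z).1)).
      by apply: (compf_continuous cg) => z; exact: cvg_fst.
    by move=> z; have [[]] := gY z.
  move=> z; have [[Yz /(O2P Yz)[x x3 <-]] /=] := gY z.
  rewrite in_itv /= => /andP[t0 t1]; rewrite cell_chart_inner ?ltW // enormZ.
  rewrite ger0_norm ?subr_ge0 //; have := enorm_ge0 x; nra.
- move=> y t [Yy /(O2P Yy)[x x3 <-]] /andP[t0 t1]; rewrite /= cell_chart_inner ?ltW //.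
  apply: mem_Y; rewrite enormZ ger0_norm ?subr_ge0 //; have := enorm_ge0 x; nra.
- by move=> y [Yy /(O2P Yy)[x x3 <-]]; rewrite /= cell_chart_inner ?ltW // subr0 scale1r.
- by move=> y [Yy /(O2P Yy)[x x3 <-]]; rewrite /= subrr scale0r.
- exact: fin_homology_point.
Qed.

Let WP y : (Y `&` O1 `&` O2) y -> exists x, [/\ 1 / 2 < N x, N x < 3 / 4 & phi x = y].
Proof.
move=> [[Yy O1y] /(O2P Yy)[x x3 xy]]; exists x; split=> //.
by rewrite ltNge; apply/negP => x2; apply: O1y; exists x.
Qed.
Let mem_W x : 1 / 2 < N x -> N x < 3 / 4 -> (Y `&` O1 `&` O2) (phi x).
Proof.
move=> x2 x3; have x1 : N x <= 1 by lra.
by split; [split; [exact: mem_Y|exact: mem_O1]|exact: mem_O2].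
Qed.

(** The annulus is dominated by the punctured space: the chart maps it there, and the points
    of radius 5/8 bring it back. *)
Let annulus_fin n : fin_homology R k n (Y `&` O1 `&` O2) (Y `&` O1 `&` O2).
Proof.
have radius x t : x != 0 -> 0 <= t <= 1 ->
    N (((1 - t) + t * (5 / 8 / N x)) *: x) = (1 - t) * N x + t * (5 / 8).
  move=> /enorm_gt0 x0 /andP[t0 t1]; rewrite enormZ ger0_norm.
    by rewrite mulrDl -[t * _ * _]mulrA divfK // gt_eqF.
  rewrite addr_ge0 ?subr_ge0 // mulr_ge0 // divr_ge0 ?(ltW x0) //; lra.
have chart_neq0 y : (Y `&` O1 `&` O2) y ->
    [/\ cell_chart y != 0, 1 / 2 < N (cell_chart y), N (cell_chart y) < 3 / 4 &
        phi (cell_chart y) = y].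
  move=> /WP[x [x2 x3 <-]]; rewrite cell_chart_inner ?ltW //; split=> //.
  by apply: contraTneq x2 => ->; rewrite enorm0 -leNgt; lra.
apply: (fin_homology_dominated (A' := [set x : 'rV[R]_d | x != 0]) (f := cell_chart)
  (g := fun x => phi ((5 / 8 / N x) *: x))
  (h := fun z => phi (((1 - z.2) + z.2 * (5 / 8 / N (cell_chart z.1))) *: cell_chart z.1))).
- by move=> Z g cg gW; apply: chart_cont_on => // z; have [[]] := gW z.
- by move=> y /chart_neq0[].
- move=> Z g cg g0; apply: (phi_cont_on (g := fun z => (5 / 8 / N (g z)) *: g z)).
    apply: scalef_continuous => //.
    apply: mulf_continuous; first exact: cst_continuous.
    apply: invf_continuous; first exact: (compf_continuous cg (@enorm_continuous R d)).
    by move=> z; rewrite gt_eqF // enorm_gt0 // g0.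
  move=> z; have := radius (g z) 1 (g0 z).
  rewrite subrr add0r mul1r mul0r add0r mul1r => /= ->; lra.
- move=> x x0; have := radius x 1 x0; rewrite subrr add0r mul1r mul0r add0r mul1r.
  by move=> E; apply: mem_W; rewrite E; lra.
- move=> Z g cg gW.
  pose c z := cell_chart (g z).1.
  have cc : continuous c.
    apply: (chart_cont_on (g := fun z => (g z).1)).
      by apply: (compf_continuous cg) => z; exact: cvg_fst.
    by move=> z; have [[[]]] := gW z.
  have c2 : continuous (fun z => (g z).2) by apply: (compf_continuous cg) => z; exact: cvg_snd.
  apply: (phi_cont_on (g := fun z =>
    ((1 - (g z).2) + (g z).2 * (5 / 8 / N (c z))) *: c z)).
    apply: scalef_continuous => //; apply: addf_continuous.
      by apply: subf_continuous => //; exact: cst_continuous.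
    apply: mulf_continuous => //; apply: mulf_continuous; first exact: cst_continuous.
    apply: invf_continuous; first exact: (compf_continuous cc (@enorm_continuous R d)).
    move=> z; have [Wz _] := gW z; have [c0 _ _ _] := chart_neq0 _ Wz.
    by rewrite gt_eqF // enorm_gt0.
  move=> z; have [Wz] := gW z; rewrite /= in_itv /= => t01.
  have [c0 cl cr _] := chart_neq0 _ Wz; rewrite radius //.
  by case/andP: t01 => t0 t1; nra.
- move=> y t Wy t01; have [c0 cl cr _] := chart_neq0 _ Wy.
  by apply: mem_W; rewrite /= radius //; case/andP: t01 => t0 t1; nra.
- move=> y Wy; have [c0 cl cr yE] := chart_neq0 _ Wy.
  by rewrite /= subr0 mul0r addr0 scale1r.
- by move=> y Wy; rewrite /= subrr add0r mul1r.
- exact: fin_homology_punctured.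
Qed.

Theorem attach_cell_fin n : (forall m, fin_homology R k m A A) -> fin_homology R k n Y Y.
Proof.
move=> finA; apply: (mayer_vietoris_fin oO1 oO2).
- move=> y Yy; have [y2|/contrapT] := pselect (O2 y); first by right.
  move=> [Ay|[x /= /andP[x3 x1] <-]]; left; last by apply: mem_O1 => //; lra.
  move=> [x /= x2 xy]; apply: (phi_out (x := x)); last by rewrite xy.
  by lra.
- exact: outer_fin.
- exact: inner_fin.
- exact: annulus_fin.
Qed.

End AttachCell.

(** * Finite CW complexes *)

Section FiniteCW.
Context (R : realType) (k : fieldType) (T : topologicalType).
Hypothesis hT : hausdorff_space T.

Section Cells.
Context (I : finType) (d : I -> nat) (phi : forall i, 'rV[R]_(d i) -> T).
Arguments phi : clear implicits.
Local Notation cell i := (phi i @` @open_disk R (d i)).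
Hypotheses (cphi : forall i, {within @disk R (d i), continuous (phi i)})
  (phi_inj : forall i, {in @open_disk R (d i) &, injective (phi i)})
  (cells_triv : trivIset [set: I] (fun i => cell i)).

Definition cells (J : {set I}) : set T := \bigcup_(i in [set i | i \in J]) cell i.

Definition cell_closed (J : {set I}) := forall i, i \in J ->
  phi i @` @disk_sphere R (d i) `<=` \bigcup_(j in [set j | j \in J /\ (d j < d i)%N]) cell j.

(** Removing a cell of maximal dimension leaves a family that is still closed under
    boundaries. *)
Lemma cells_fin_homology (J : {set I}) : cell_closed J ->
  closed (cells J) /\ forall n, fin_homology R k n (cells J) (cells J).
Proof.
have [m Jm] : exists m, (#|J| <= m)%N by exists #|J|.
elim: m J Jm => [|m IH] J Jm Jc.
  have -> : cells J = set0; last by split; [exact: closed0|move=> n; exact: fin_homology_set0].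
  move: Jm; rewrite leqn0 cards_eq0 => /eqP->; rewrite -subset0 => x [i] /=.
  by rewrite inE.
have [J0|[i0 Ji0]] := set_0Vmem J.
  by apply: IH => //; rewrite J0 cards0.
(* the boundaries of the remaining cells cannot meet a cell of maximal dimension *)
case: (arg_maxnP d Ji0) => i iJ imax; have Ji : i \in J := iJ.
have [A_cl A_fin] : closed (cells (J :\ i)) /\
    forall n, fin_homology R k n (cells (J :\ i)) (cells (J :\ i)).
  apply: IH => [|j]; first by move: Jm; rewrite (cardsD1 i) Ji.
  rewrite in_setD1 => /andP[ji Jj] x /(Jc _ Jj)[l [Jl lj] lx]; exists l => //.
  split=> //; rewrite in_setD1 Jl andbT; apply: contraTneq lj => ->.
  by rewrite -leqNgt; exact: imax.
have diskE : @disk R (d i) = [set x | enorm x <= 1].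
  by apply/seteqP; split=> x; rewrite /disk /= enorm_le1.
have bdA x : enorm x = 1 -> cells (J :\ i) (phi i x).
  move=> /eqP; rewrite enorm_eq1 => /eqP x1.
  have [l [Jl li] lx] : (\bigcup_(j in [set j | j \in J /\ (d j < d i)%N]) cell j) (phi i x).
    by apply: (Jc _ Ji); exists x.
  exists l => //=; rewrite in_setD1 Jl andbT; apply: contraTneq li => ->.
  by rewrite ltnn.
have XE : cells J = cells (J :\ i) `|` phi i @` [set x | enorm x <= 1].
  apply/seteqP; split=> y.
    move=> [j /= Jj jy]; have [ji|ji] := eqVneq j i; last first.
      by left; exists j => //=; rewrite in_setD1 ji.
    move: jy; rewrite ji => -[x x1 <-]; right; exists x => //=.
    by apply: ltW; rewrite enorm_lt1.
  move=> [[j /=]|[x /=]].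
    by rewrite in_setD1 => /andP[_ Jj] jy; exists j.
  rewrite le_eqVlt => /orP[/eqP/bdA[j /=]|].
    by rewrite in_setD1 => /andP[_ Jj] jx <-; exists j.
  by rewrite enorm_lt1 => x1 <-; exists i => //; exists x.
have ci : {within [set x | enorm x <= 1], continuous (phi i)} by rewrite -diskE.
split.
  rewrite XE; apply: closedU => //; apply: compact_closed => //.
  by apply: continuous_compact => //; exact: unit_disk_compact.
move=> n; rewrite XE; apply: attach_cell_fin => //.
- move=> x y; rewrite !enorm_lt1 => x1 y1; apply: phi_inj; exact: mem_set.
- move=> x; rewrite enorm_lt1 => x1 [j /=]; rewrite in_setD1 => /andP[ji _] jx.
  move/eqP: ji; apply; apply: (cells_triv (i := j) (j := i)) => //.
  by exists (phi i x); split=> //; exists x.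
Qed.

End Cells.

Theorem finite_CW_fin (X : set T) n : finite_CW R X -> fin_homology R k n X X.
Proof.
move=> [_ [I [d [phi [cphi phi_inj triv -> bdP]]]]].
have -> : \bigcup_i (phi i @` @open_disk R (d i)) = cells phi [set: I]%SET.
  by apply/seteqP; split=> x [i _ ix]; exists i => //=; rewrite ?inE.
have [|_ fin] := @cells_fin_homology I d phi cphi phi_inj triv [set: I]%SET; last exact: fin.
by move=> i _ x /bdP[j ji jx]; exists j => //; split; rewrite ?inE.
Qed.

End FiniteCW.

(** The separation hypothesis is stated for the space of points of a subset; for the full
    set it gives back the ambient space. *)
Lemma hausdorff_setT (T : topologicalType) :
  hausdorff_space (set_type [set: T]) -> hausdorff_space T.
Proof.
rewrite !open_hausdorff => hT x y xy.
pose s (z : T) : set_type [set: T] := exist _ z (mem_set I).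
have [|[A B] /= [xU yV] [[U oU UA] [V oV VB] /eqP UV]] := hT (s x) (s y).
  by apply: contra_neq xy => /(congr1 set_val).
rewrite -UA -VB in xU yV UV; exists (U, V) => /=; first by move: xU yV; rewrite !inE.
split=> //; apply/eqP; rewrite -subset0 => z [Uz Vz].
by rewrite -[set0 z]/(set0 (s z)) -UV.
Qed.

(** * Gradings on the derived couples *)

Section Projection.
Context (k : fieldType) (I : choiceType) (V : I -> lmodType k).

Definition dsum_proj (a : I) (x : dsum V) : dsum V := dsum_in (x a).

Lemma dsum_proj_linear a : linear (dsum_proj a).
Proof. by move=> b x y; rewrite /dsum_proj -linearP. Qed.
HB.instance Definition _ a :=
  GRing.isLinear.Build k (dsum V) (dsum V) *:%R (dsum_proj a) (dsum_proj_linear a).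

Lemma dsum_in_same a (v : V a) : dsum_in v a = v.
Proof. exact: dfwithin. Qed.
Lemma dsum_in_other a (v : V a) l : a != l -> dsum_in v l = 0.
Proof. exact: dfwithout. Qed.

Lemma dsum_projK a x : dsum_proj a (dsum_proj a x) = dsum_proj a x.
Proof. by rewrite /dsum_proj dsum_in_same. Qed.

Lemma dsum_in_inj a : injective (@dsum_in k I V a).
Proof. by move=> u v /(congr1 (fun x : dsum V => x a)); rewrite !dsum_in_same. Qed.

End Projection.

Lemma dsum_map_proj (k : fieldType) (I J : choiceType) (U : I -> lmodType k)
    (V : J -> lmodType k) (s : I -> J) (g : forall a, {linear U a -> V (s a)}) a x :
  injective s -> (forall b, exists a, b = s a) ->
  dsum_map g (dsum_proj a x) = dsum_proj (s a) (dsum_map g x).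
Proof.
move=> s_inj s_surj; apply: dsumP => c; have [b ->] := s_surj c.
rewrite dsum_mapE // /dsum_proj; have [<-|ab] := eqVneq a b.
  by rewrite !dsum_in_same dsum_mapE.
by rewrite !dsum_in_other ?linear0 // (inj_eq s_inj).
Qed.

Section SpectralDimension.
Context (R : realType) (k : fieldType) (T : topologicalType) (X : filtration T).
Local Notation D1 := (dsum (pageD R k X)).
Local Notation I1 := (dsum_map (page_i R k X)).
Local Notation degree := (int * int)%type.

(** What is remembered of the couple [C] obtained after [m] derivations: its [D] embeds by
    [iota] in the [D] of the first couple as the image of the [m]-th iterate of [i], and the
    bigraded pieces are the fixed points of the projections [pD] and [pE], which commute,
    up to the shifts of degree, with all the maps.  The map [j] has bidegree (-m, m), so its
    source degree is the [m]-fold [shift_i] of its target degree. *)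
Definition graded_page m (C : bigraded_couple k) : Prop :=
  exists (iota : {linear coupleD C -> D1})
    (pD : degree -> {linear coupleD C -> coupleD C})
    (pE : degree -> {linear coupleE C -> coupleE C}),
  [/\ injective iota, (forall y, iota (couple_i C y) = I1 (iota y)),
      range iota = range (iter m I1),
      (forall a y, iota (pD a y) = dsum_proj a (iota y)) &
  [/\ (forall a x, couple_bd C (pE a x) = pD (shift_bd a) (couple_bd C x)),
      (forall a y, couple_j C (pD (iter m shift_i a) y) = pE a (couple_j C y)),
      (forall a x, pE a (pE a x) = pE a x) &
      (forall p q, @bcoupleE _ C p q = [set x | pE (p, q) x = x])]].

Lemma graded_page1 : graded_page 0 (bigraded1 R k X).
Proof.
exists idfun, (@dsum_proj _ _ _), (@dsum_proj _ _ _); split=> //; split.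
- move=> a x; apply: dsum_map_proj; [exact: shift_bd_inj|exact: shift_bd_surj].
- by move=> a x; apply: dsum_map_proj => //; exact: id_surj.
- exact: dsum_projK.
- move=> p q; apply/seteqP; split=> [_ [v _ <-]|x <-]; last by exists (x (p, q)).
  by rewrite /= /dsum_proj dsum_in_same.
Qed.

Lemma iter_shift_surj m (a : degree) : exists b, a = iter m shift_i b.
Proof.
elim: m a => [|m IH] a; first by exists a.
by have [b ->] := shift_i_surj a; have [c ->] := IH b; exists c.
Qed.

Section Derived.
Context (m : nat) (C : bigraded_couple k).
Context (iota : {linear coupleD C -> D1}).
Context (pD : degree -> {linear coupleD C -> coupleD C}).
Context (pE : degree -> {linear coupleE C -> coupleE C}).
Hypotheses (iota_inj : injective iota)
  (iota_i : forall y, iota (couple_i C y) = I1 (iota y))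
  (iota_range : range iota = range (iter m I1))
  (iota_pD : forall a y, iota (pD a y) = dsum_proj a (iota y))
  (bd_pE : forall a x, couple_bd C (pE a x) = pD (shift_bd a) (couple_bd C x))
  (j_pD : forall a y, couple_j C (pD (iter m shift_i a) y) = pE a (couple_j C y))
  (pE_id : forall a x, pE a (pE a x) = pE a x)
  (E_fix : forall p q, @bcoupleE _ C p q = [set x | pE (p, q) x = x]).

Lemma i_pD a y : pD (shift_i a) (couple_i C y) = couple_i C (pD a y).
Proof.
apply: iota_inj; rewrite iota_pD !iota_i iota_pD dsum_map_proj //.
  exact: shift_i_inj.
exact: shift_i_surj.
Qed.

(** The differential is bihomogeneous; the degree of the target is recovered from that of
    the source by a choice because [iter m shift_i] is only used through its surjectivity. *)
Lemma d_pE a x : couple_d C (pE a x) =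
  pE (xget (0, 0) [set b | shift_bd a = iter m shift_i b]) (couple_d C x).
Proof.
rewrite /couple_d /= bd_pE; case: xgetP => [b _ /= ->|nb]; first exact: j_pD.
by have [b /nb] := iter_shift_surj m (shift_bd a).
Qed.

Lemma pE_kernel a : {in lkernel (couple_d C), forall x, pE a x \in lkernel (couple_d C)}.
Proof. by move=> x; rewrite !inE => /eqP dx; rewrite d_pE dx linear0. Qed.

Lemma pE_image a : {in limage (couple_d C), forall x, pE a x \in limage (couple_d C)}.
Proof.
move=> _ /limageP[x <-]; have [b ab] := shift_bd_surj (iter m shift_i a).
by apply/limageP; exists (pE b x); rewrite /couple_d /= bd_pE -ab j_pD.
Qed.

Lemma pD_image a (y : submod (limage (couple_i C))) :
  pD a (submod_val y) \in limage (couple_i C).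
Proof.
case: y => _ /= /limageP[w <-]; have [b ->] := shift_i_surj a.
by apply/limageP; exists (pD b w); rewrite i_pD.
Qed.

Definition derived_pD a (y : derivedD C) : derivedD C := Submod (pD_image a y).
Lemma derived_pD_linear a : linear (derived_pD a).
Proof. by move=> b x y; apply: submod_inj; rewrite /= linearP. Qed.
HB.instance Definition _ a :=
  GRing.isLinear.Build k (derivedD C) (derivedD C) *:%R (derived_pD a) (derived_pD_linear a).

Definition derived_iota (y : derivedD C) : D1 := iota (submod_val y).
Lemma derived_iota_linear : linear derived_iota.
Proof. by move=> b x y; rewrite /derived_iota -linearP. Qed.
HB.instance Definition _ :=
  GRing.isLinear.Build k (derivedD C) D1 *:%R derived_iota derived_iota_linear.

Definition derived_pE a : {linear derivedE C -> derivedE C} :=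
  subq_map (@pE_kernel a) (@pE_image a).

Lemma derived_pE_pi a z : derived_pE a (subq_pi _ z) =
  subq_pi (limage (couple_d C)) (Submod (pE_kernel a (submodP z))).
Proof. exact: subq_mapE. Qed.

Lemma graded_derived_from : graded_page m.+1 (bigraded_derived C).
Proof.
exists derived_iota, derived_pD, derived_pE; split; last split.
- by move=> x y /iota_inj/submod_inj.
- by move=> y; rewrite /= /derived_iota /= iota_i.
- apply/seteqP; split=> [_ [y _ <-]|_ [x _ <-]].
    rewrite /= /derived_iota; case: y => _ /= /limageP[w <-]; rewrite iota_i.
    have : range iota (iota w) by exists w.
    by rewrite iota_range => -[x _ <-]; exists x.
  have : range (iter m I1) (iter m I1 x) by exists x.
  rewrite -iota_range => -[w _ wx].
  have iw : couple_i C w \in limage (couple_i C) by apply/limageP; exists w.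
  by exists (Submod iw) => //=; rewrite /derived_iota /= iota_i wx.
- by move=> a y; exact: iota_pD.
- move=> a c; rewrite -[c]subq_reprK [derived_pE _ _]derived_pE_pi.
  apply: submod_inj; rewrite [LHS]derived_bdE [RHS]/=.
  by rewrite bd_pE -derived_bdE.
- move=> a y; have iw := preim_iK y.
  rewrite [RHS]derived_pE_pi.
  rewrite [LHS](@derived_jE _ _ (pD (iter m shift_i a) (preim_i y))); last first.
    by rewrite /= -i_pD iw.
  by apply/subq_eqP; rewrite /= j_pD subrr rpred0.
- move=> a c; rewrite -[c]subq_reprK; move: (subq_repr c) => z.
  rewrite !(derived_pE_pi a z) derived_pE_pi.
  by apply/subq_eqP; rewrite /= pE_id subrr rpred0.
- move=> p q; apply/seteqP; split=> [_ [z /= zE <-]|c /= cE].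
    rewrite derived_pE_pi; apply/subq_eqP => /=.
    by move: zE; rewrite E_fix /= => ->; rewrite subrr rpred0.
  exists (Submod (pE_kernel (p, q) (submodP (subq_repr c)))).
    by rewrite /= E_fix /= pE_id.
  by rewrite -derived_pE_pi subq_reprK.
Qed.

End Derived.

Lemma graded_derived m C : graded_page m C -> graded_page m.+1 (bigraded_derived C).
Proof.
by move=> [iota [pD [pE [? ? ? ? [? ? ? ?]]]]]; exact: (@graded_derived_from m C iota pD pE).
Qed.

Lemma graded_pageP m : graded_page m (bigraded_page R k X m.+1).
Proof. by elim: m => [|m IH]; [exact: graded_page1|exact: graded_derived]. Qed.

End SpectralDimension.

(** * Counting dimensions on a page *)

(** Generators of [Z] modulo [B] that lie in [Z] can be projected to the quotient. *)
Lemma fin_dim_subquot (k : fieldType) (V : lmodType k) (Z B : submodClosed V) :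
  fg_mod [set z | z \in Z] [set z | z \in B] -> fin_dim [set: subquot Z B].
Proof.
move=> /(fg_mod_inside (vsubspace_pred Z) (vsubspace_pred B))[e [eZ eP]].
have [e' e'P] : exists e' : seq (subquot Z B), forall z : submod Z,
    span_mod [set z | z \in B] e (submod_val z) -> span_mod [set 0] e' (subq_pi B z).
  elim: e eZ {eP} => [|x e IH] eZ.
    by exists [::] => z zB; apply/subq_pi_eq0.
  have [y ye|e' e'P] := IH; first by apply: eZ; rewrite inE ye orbT.
  have xZ : x \in Z by exact: eZ (mem_head _ _).
  exists (subq_pi B (Submod xZ) :: e') => z [a za]; exists a.
  by rewrite -linearZ -linearB; exact: e'P.
split; first by split.
by exists e' => c _; rewrite -[c]subq_reprK; apply: e'P; apply: eP; exact: submodP.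
Qed.

Section Betti.
Context (R : realType) (k : fieldType) (T : topologicalType).

Lemma homology_inclE n m (nm : n = m) (A B : set T) (AB : A `<=` B) z :
  homology_incl R k nm AB (subq_pi _ z) =
  subq_pi (boundaries m B) (Submod (incl_cycles nm AB (submodP z))).
Proof. exact: subq_mapE. Qed.

Lemma homology_incl_id n (A : set T) (e : n = n) (AA : A `<=` A) x :
  homology_incl R k e AA x = x.
Proof.
rewrite -[x]subq_reprK homology_inclE.
by apply/subq_eqP; rewrite /= subrr rpred0.
Qed.

Lemma homology_incl_comp n1 n2 n3 (A B C : set T) (e12 : n1 = n2) (e23 : n2 = n3)
    (e13 : n1 = n3) (AB : A `<=` B) (BC : B `<=` C) (AC : A `<=` C) x :
  homology_incl R k e23 BC (homology_incl R k e12 AB x) = homology_incl R k e13 AC x.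
Proof.
rewrite -[x]subq_reprK (homology_inclE e12) !homology_inclE.
by apply/subq_eqP; rewrite /= subrr rpred0.
Qed.

(** [e] and [st] are left free so as to cover the degrees and inclusions that iterating
    [shift_i] produces. *)
Lemma bettiE (X : filtration T) n n' (s t : int) (e : n = n') (st : X s `<=` X t) :
  s <= t -> betti R k X n s t = dimk (range (homology_incl R k e st)).
Proof.
move=> le_st; case: n' / e; rewrite /betti.
have matchE (P : Prop) (b : bool) (u : reflect P b) (F : P -> nat) v (p : P) :
    match u with ReflectT q => F q | ReflectF _ => v end = F p.
  by case: u => // q; congr F; exact: Prop_irrelevance.
rewrite (matchE _ _ _ _ _ le_st); congr (dimk (range (homology_incl R k _ _))).
exact: Prop_irrelevance.
Qed.

End Betti.

Section Dimension.
Context (R : realType) (k : fieldType) (T : topologicalType) (X : filtration T).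
Hypothesis X_fin : forall n s, fin_homology R k n (X s) (X s).
Local Notation D1 := (dsum (pageD R k X)).
Local Notation I1 := (dsum_map (page_i R k X)).
Local Notation degree := (int * int)%type.

Lemma iter_shift_inj m : injective (iter m shift_i).
Proof. by elim: m => // m IH x y /= /shift_i_inj/IH. Qed.

Definition shifted m (a : degree) : degree := (a.1 - m%:Z, a.2 + m%:Z).

Lemma iter_shiftE m (a : degree) : iter m shift_i a = (a.1 + m%:Z, a.2 - m%:Z).
Proof.
elim: m => [|m IH] /=; first by rewrite addr0 subr0 -surjective_pairing.
by rewrite IH /shift_i /=; congr (_, _); lia.
Qed.

Lemma shiftedK m a : iter m shift_i (shifted m a) = a.
Proof. by rewrite iter_shiftE /shifted /= subrK addrK -surjective_pairing. Qed.

Lemma iter_page_i m (a : degree) (x : D1)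
    (e : a.1 + a.2 = (iter m shift_i a).1 + (iter m shift_i a).2)
    (XX : X a.1 `<=` X (iter m shift_i a).1) :
  (iter m I1 x) (iter m shift_i a) = homology_incl R k e XX (x a).
Proof.
elim: m e XX => [|m IH] e XX; first by rewrite [RHS]homology_incl_id.
have e' : a.1 + a.2 = (iter m shift_i a).1 + (iter m shift_i a).2.
  by rewrite iter_shiftE /=; lia.
have XX' : X a.1 `<=` X (iter m shift_i a).1.
  by apply: filtS; rewrite iter_shiftE lerDl.
rewrite [LHS](dsum_mapE (page_i R k X) shift_i_inj) (IH e' XX').
exact: homology_incl_comp.
Qed.

(** The image under [iota] of a bigraded piece of the [D] of the couple obtained after [m]
    derivations: see [iota_Dpiece]. *)
Definition image_piece m (a : degree) : set D1 :=
  [set w | dsum_proj a w = w /\ range (iter m I1) w].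

Lemma fin_dim_homology n s : fin_dim [set: homology R k n (X s)].
Proof. exact/fin_dim_subquot/X_fin. Qed.

Lemma image_pieceE m (b : degree) (a := iter m shift_i b)
    (e : b.1 + b.2 = a.1 + a.2) (XX : X b.1 `<=` X a.1) :
  image_piece m a = @dsum_in _ _ (pageD R k X) a @` range (homology_incl R k e XX).
Proof.
apply/seteqP; split=> [w [wE [x _ xw]]|_ [_ [u _ <-] <-]].
  exists ((iter m I1 x) a); last by rewrite xw.
  by exists (x b) => //; rewrite -iter_page_i.
split; first by rewrite /dsum_proj dsum_in_same.
exists (@dsum_in _ _ (pageD R k X) b u) => //.
apply: dsumP => c; have [d ->] := iter_shift_surj m c.
have e' : d.1 + d.2 = (iter m shift_i d).1 + (iter m shift_i d).2.
  by rewrite iter_shiftE /=; lia.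
have XX' : X d.1 `<=` X (iter m shift_i d).1.
  by apply: filtS; rewrite iter_shiftE lerDl.
rewrite (iter_page_i _ e' XX'); have [bd|bd] := eqVneq b d; last first.
  by rewrite !dsum_in_other ?linear0 // (inj_eq (@iter_shift_inj m)).
subst d.
rewrite !dsum_in_same (Prop_irrelevance e' e) (Prop_irrelevance XX' XX).
by [].
Qed.

Lemma fin_dim_image_piece m a : fin_dim (image_piece m a).
Proof.
rewrite -(shiftedK m a); set b := shifted m a.
have e : b.1 + b.2 = (iter m shift_i b).1 + (iter m shift_i b).2.
  by rewrite iter_shiftE /=; lia.
have XX : X b.1 `<=` X (iter m shift_i b).1.
  by apply: filtS; rewrite iter_shiftE lerDl.
rewrite (image_pieceE e XX).
apply: (@fin_dim_image _ _ _ (@dsum_in _ _ (pageD R k X) _)).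
apply: (@fin_dim_image _ _ _ (homology_incl R k e XX)).
exact: fin_dim_homology.
Qed.

Lemma dimk_image_piece m a :
  dimk (image_piece m a) = betti R k X (a.1 + a.2) (a.1 - m%:Z) a.1.
Proof.
rewrite -[in LHS](shiftedK m a); set b := shifted m a.
have e : b.1 + b.2 = (iter m shift_i b).1 + (iter m shift_i b).2.
  by rewrite iter_shiftE /=; lia.
have le_b : b.1 <= (iter m shift_i b).1 by rewrite iter_shiftE lerDl.
have XX := @filtS _ X _ _ le_b.
rewrite (image_pieceE e XX).
rewrite (@dimk_inj _ _ _ (@dsum_in _ _ (pageD R k X) _)); last first.
- by apply: (@fin_dim_image _ _ _ (homology_incl R k e XX)); exact: fin_dim_homology.
- exact: dsum_in_inj.
have -> : betti R k X (a.1 + a.2) (a.1 - m%:Z) a.1 =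
    betti R k X (b.1 + b.2) b.1 (iter m shift_i b).1.
  by rewrite shiftedK /b /shifted; congr (betti R k X _ _ _) => /=; lia.
by rewrite (bettiE R k e XX).
Qed.

Section Page.
Context (m : nat) (C : bigraded_couple k).
Context (iota : {linear coupleD C -> D1}).
Context (pD : degree -> {linear coupleD C -> coupleD C}).
Context (pE : degree -> {linear coupleE C -> coupleE C}).
Hypotheses (iota_inj : injective iota)
  (iota_i : forall y, iota (couple_i C y) = I1 (iota y))
  (iota_range : range iota = range (iter m I1))
  (iota_pD : forall a y, iota (pD a y) = dsum_proj a (iota y))
  (bd_pE : forall a x, couple_bd C (pE a x) = pD (shift_bd a) (couple_bd C x))
  (j_pD : forall a y, couple_j C (pD (iter m shift_i a) y) = pE a (couple_j C y))
  (pE_id : forall a x, pE a (pE a x) = pE a x).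

Definition Dpiece a : set (coupleD C) := [set y | pD a y = y].
Definition Epiece a : set (coupleE C) := [set x | pE a x = x].

Lemma iota_Dpiece a : iota @` Dpiece a = image_piece m a.
Proof.
apply/seteqP; split=> [_ [y /= ya <-]|w [wa]].
  by split; [rewrite -iota_pD ya|rewrite -iota_range; exists y].
rewrite -iota_range => -[y _ yw]; exists y => //.
by apply: iota_inj; rewrite iota_pD yw.
Qed.

(** Applying [i] once more to the image of the [m]-th iterate gives a piece for [m.+1]; this
    is why both kinds of persistent Betti numbers occur. *)
Lemma iota_i_Dpiece a : iota @` (couple_i C @` Dpiece a) = image_piece m.+1 (shift_i a).
Proof.
have I1_proj b x : I1 (dsum_proj b x) = dsum_proj (shift_i b) (I1 x).
  by apply: dsum_map_proj; [exact: shift_i_inj|exact: shift_i_surj].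
apply/seteqP; split=> [_ [_ [y /= ya <-] <-]|w [wa [x _ xw]]].
  rewrite iota_i; split; first by rewrite -I1_proj -iota_pD ya.
  have : range iota (iota y) by exists y.
  by rewrite iota_range => -[x _ <-]; exists x.
have : range (iter m I1) (iter m I1 x) by exists x.
rewrite -iota_range => -[y _ yx].
exists (couple_i C (pD a y)).
  exists (pD a y) => //; apply: iota_inj.
  by rewrite !iota_pD dsum_projK.
by rewrite iota_i iota_pD I1_proj yx -[I1 _]/(iter m.+1 I1 x) xw wa.
Qed.

Lemma fixed_vsubspace (V : lmodType k) (f : {linear V -> V}) : vsubspace [set x | f x = x].
Proof.
split=> [|a x y /= xE yE]; first by rewrite /= linear0.
by rewrite linearP xE yE.
Qed.

Lemma fin_dim_Dpiece a : fin_dim (Dpiece a).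
Proof.
apply: (@fin_dim_ker_image _ _ _ iota); first exact: fixed_vsubspace.
  by rewrite iota_Dpiece; exact: fin_dim_image_piece.
suff -> : Dpiece a `&` [set x | iota x = 0] = [set 0].
  by split; [exact: vsubspace0|exists [::]].
apply/seteqP; split=> [x [_ /= x0]|_ ->]; first by apply: iota_inj; rewrite x0 linear0.
by rewrite /Dpiece /=; split; rewrite /= linear0.
Qed.

Lemma dimk_Dpiece a : dimk (Dpiece a) = dimk (image_piece m a).
Proof. by rewrite -iota_Dpiece dimk_inj //; exact: fin_dim_Dpiece. Qed.

Lemma dimk_i_Dpiece a :
  dimk (couple_i C @` Dpiece a) = dimk (image_piece m.+1 (shift_i a)).
Proof.
rewrite -iota_i_Dpiece (dimk_inj iota_inj) //; apply: (@fin_dim_image _ _ _ (couple_i C)).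
exact: fin_dim_Dpiece.
Qed.

Lemma bd_Epiece a : couple_bd C @` Epiece a =
  Dpiece (shift_bd a) `&` [set y | couple_i C y = 0].
Proof.
apply/seteqP; split=> [_ [x /= xa <-]|y [/= ya]].
  by split=> /=; [rewrite /Dpiece /= -bd_pE xa|apply/couple_bdi; exists x].
move=> /couple_bdi[x yx]; exists (pE a x); first exact: pE_id.
by rewrite bd_pE -yx.
Qed.

Lemma ker_Epiece a : Epiece a `&` [set x | couple_bd C x = 0] =
  couple_j C @` Dpiece (iter m shift_i a).
Proof.
apply/seteqP; split=> [x [/= xa]|_ [y /= ya <-]].
  move=> /couple_jbd[y xy]; exists (pD (iter m shift_i a) y).
    by apply: iota_inj; rewrite !iota_pD dsum_projK.
  by rewrite j_pD -xy.
split; first by rewrite /Epiece /= -j_pD ya.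
by apply/couple_jbd; exists y.
Qed.

Lemma ker_Dpiece a : Dpiece (shift_i a) `&` [set y | couple_j C y = 0] =
  couple_i C @` Dpiece a.
Proof.
have i_pD' := i_pD iota_inj iota_i iota_pD.
apply/seteqP; split=> [y [/= ya]|_ [y /= ya <-]].
  move=> /couple_ij[w yw]; exists (pD a w).
    by apply: iota_inj; rewrite !iota_pD dsum_projK.
  by rewrite -i_pD' -yw.
split; first by rewrite /Dpiece /= i_pD' ya.
by apply/couple_ij; exists y.
Qed.

(** Rank-nullity for the boundary map on the piece of [E], whose image is a kernel of [i] and
    whose kernel is an image of [j], then for [i] and for [j] on the two pieces of [D] that
    are involved.  Written without subtraction. *)
Lemma dimk_Epiece (a b : degree) : shift_i b = iter m shift_i a ->
  (dimk (Epiece a) + (dimk (image_piece m.+1 (iter m shift_i a)) +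
     dimk (image_piece m.+1 (shift_i (shift_bd a)))) =
   dimk (image_piece m (iter m shift_i a)) + dimk (image_piece m (shift_bd a)))%N.
Proof.
move=> ab; have fD := fin_dim_Dpiece.
have fE : fin_dim (Epiece a).
  apply: (@fin_dim_ker_image _ _ _ (couple_bd C)); first exact: fixed_vsubspace.
    rewrite bd_Epiece; apply: (fin_dimS (fD (shift_bd a))); last exact: subIsetl.
    by apply: vsubspace_ker; exact: fixed_vsubspace.
  by rewrite ker_Epiece; exact: (@fin_dim_image _ _ _ (couple_j C)).
rewrite (rank_nullity (couple_bd C) fE) bd_Epiece ker_Epiece.
rewrite -!dimk_Dpiece (rank_nullity (couple_i C) (fD (shift_bd a))) dimk_i_Dpiece.
(* the source of [j] lies in degree [shift_i b], so its kernel there comes from degree [b] *)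
rewrite -ab (rank_nullity (couple_j C) (fD (shift_i b))) ker_Dpiece dimk_i_Dpiece.
lia.
Qed.

End Page.
End Dimension.

Theorem theorem1 (R : realType) (k : fieldType) (T : topologicalType)
    (X : filtration T) (N : int)
    (X_empty : forall i : int, i <= 0 -> X i = set0)
    (X_full : forall i : int, N <= i -> X i = setT)
    (X_CW : forall i : int, finite_CW R (X i))
    (r : nat) (p q : int) (r_ge1 : (1 <= r)%N) :
  let n : int := p + q in
  (dimk (spectralE R k X r p q))%:Z =
    ((betti R k X n p (p + r%:Z - 1))%:Z -
     (betti R k X n (p - 1) (p + r%:Z - 1))%:Z) +
    ((betti R k X (n - 1) (p - r%:Z) (p - 1))%:Z -
     (betti R k X (n - 1) (p - r%:Z) p)%:Z).
Proof.
have hT : hausdorff_space T.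
  by apply: hausdorff_setT; have [+ _] := X_CW N; rewrite X_full.
have X_fin n s : fin_homology R k n (X s) (X s) by exact: finite_CW_fin.
case: r r_ge1 => // m _ n.
have [iota [pD [pE [iI ii ir iP [bP jP pP E_fix]]]]] := graded_pageP R k X m.
have [b ab] : exists b, iter m shift_i (p, q) = shift_i b by exact: shift_i_surj.
have := dimk_Epiece X_fin iI ii ir iP bP jP pP (esym ab).
rewrite !dimk_image_piece // iter_shiftE /=.
rewrite /spectralE E_fix.
have -> : p + m%:Z + (q - m%:Z) = n by rewrite /n; lia.
have -> : p - 1 + q = n - 1 by rewrite /n; lia.
have -> : p - 1 + 1 + (q - 1) = n - 1 by rewrite /n; lia.
have -> : p + m%:Z - m.+1%:Z = p - 1 by lia.
have -> : p + m%:Z - m%:Z = p by lia.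
have -> : p - 1 + 1 - m.+1%:Z = p - m.+1%:Z by lia.
have -> : p - 1 - m%:Z = p - m.+1%:Z by lia.
have -> : p - 1 + 1 = p by lia.
have -> : p + m.+1%:Z - 1 = p + m%:Z by lia.
rewrite -[Epiece _ _]/[set x | pE (p, q) x = x].
by lia.
Qed.
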